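(* Let $\ell_1\le\ell_0\le2m_0$. Assume that there exist $C>0$, $k_0>0$ and $T>0$ such that $$\mathcal{E}_{\ell_1}(u^k)\le C\int_0^T\|\mathsf{L}u^k(t)\|_K^2\,dt$$ holds for every $U=(u^k)_{k\in\mathbb{N}^*}\in B^+$ and every $k\ge k_0$. Assume also that $\|\mathsf{L}(\bar u)\|_K=\|\mathsf{L}(u)\|_K$ for all $u\in D(\mathsf{L})$. Assume the unique continuation property: if $v$ is an eigenvector of $\mathsf{A}$ such that $\mathsf{L}v=0$, then $v=0$ (i.e. no eigenvector of $\mathsf{A}$ is annihilated by $\mathsf{L}$). Assume finally the admissibility condition for waves at the $\ell_0$-energy level (defined in the context). Then for every $T'>T$ there exists $C'>0$ such that for every $(\underline{u}^0,\underline{u}^1)\in D(\mathsf{A}^{\ell_0/2})\times D(\mathsf{A}^{(\ell_0-1)/2})$ the solution $u$ of $\partial_t^2u+\mathsf{A}u=0$, $u|_{t=0}=\underline{u}^0$, $\partial_tu|_{t=0}=\underline{u}^1$, satisfies $$\mathcal{E}_{\ell_1}(u)\le C'\int_0^{T'}\|\mathsf{L}u(t)\|_K^2\,dt.$$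
   Context: Let $E$ be a (complex) Hilbert space and $\mathsf{A}$ a positive unbounded selfadjoint operator on $E$ with dense domain. Assume there is a real Hilbert basis $(e_\nu)_{\nu\in\mathbb{N}}$ of $E$ made of eigenvectors of $\mathsf{A}$, associated with a nondecreasing sequence of eigenvalues $\lambda_\nu>0$, $\lambda_\nu\to+\infty$. Write $u=\sum_\nu u_\nu e_\nu$, $u_\nu=(u,e_\nu)_E$; complex conjugation is $\bar u=\sum_\nu\overline{u_\nu}e_\nu$ (the $e_\nu$ being real). For $s\ge0$, $D(\mathsf{A}^s)=\{u\in E: (\lambda_\nu^su_\nu)_\nu\in\ell^2(\mathbb{C})\}$; for $s<0$, $D(\mathsf{A}^s)$ is the dual of $D(\mathsf{A}^{|s|})$ with $E$ as pivot space, its elements being the series $u=\sum_\nu u_\nu e_\nu$ with $(\lambda_\nu^su_\nu)_\nu\in\ell^2(\mathbb{C})$. In all cases $\mathsf{A}^su=\sum_\nu\lambda_\nu^su_\nu e_\nu$ and $\|u\|_{D(\mathsf{A}^s)}^2=\sum_\nu\lambda_\nu^{2s}|u_\nu|^2$. Wave equation: for $s\in\mathbb{R}$, $\underline{u}^0\in D(\mathsf{A}^{s/2})$, $\underline{u}^1\in D(\mathsf{A}^{(s-1)/2})$, the equation $\partial_t^2u+\mathsf{A}u=0$, $u|_{t=0}=\underline{u}^0$, $\partial_tu|_{t=0}=\underline{u}^1$ has the unique solution $u\in\bigcap_{k\in\mathbb N}\mathscr{C}^k(\mathbb{R};D(\mathsf{A}^{(s-k)/2}))$, $$u(t)=\sum_\nu\big(e^{it\sqrt{\lambda_\nu}}u_\nu^++e^{-it\sqrt{\lambda_\nu}}u_\nu^-\big)e_\nu,\quad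 u_\nu^\pm=\tfrac12\big(\underline{u}^0_\nu\mp i\underline{u}^1_\nu/\sqrt{\lambda_\nu}\big).$$ One says that $u$ lies in the $s$-energy level. Its energy $\mathcal{E}_s(u)=\frac12\big(\|u(t)\|^2_{D(\mathsf{A}^{s/2})}+\|\partial_tu(t)\|^2_{D(\mathsf{A}^{(s-1)/2})}\big)=\sum_\nu\lambda_\nu^s(|u_\nu^+|^2+|u_\nu^-|^2)$ is independent of $t$. Dyadic decomposition: fix $0<\alpha<1$ and $\rho\in\,]1,1/\alpha[$. For $k\in\mathbb{N}^*$ let $J_k=\{\nu:\alpha\rho^{k}\le\sqrt{\lambda_\nu}<\rho^{k}/\alpha\}$ (a finite set) and $E_k=\mathrm{span}\{e_\nu:\nu\in J_k\}$ with the norm of $E$. An element $u=\sum_{\nu\in J_k}u_\nu e_\nu\in E_k$ is identified with the solution of the wave equation $u(t)=\sum_{\nu\in J_k}e^{it\sqrt{\lambda_\nu}}u_\nu e_\nu$. Set $B^+=\{(u^k)_{k\in\mathbb{N}^*}: u^k\in E_k,\ \|u^k\|_E\le1\}$. Observation operator: $K$ is a Hilbert space and $\mathsf{L}:E\to K$ is a possibly unbounded linear operator with domain $D(\mathsf{L})=D(\mathsf{A}^{m_0})$ for some $m_0\in\mathbb{R}$, with $\|\mathsf{L}u\|_K\le C_0\|u\|_{D(\mathsf{A}^{m_0})}$ for some constant $C_0$. Admissibility condition for waves at the $\ell_0$-energy level ($\ell_0\le2m_0$): the operator $\mathsf{L}$ (acting pointwise in time) extends as an unbounded linear operator from a subspace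 of $L^2_{\mathrm{loc}}(\mathbb{R};D(\mathsf{A}^{\ell_0/2}))$ into $L^2_{\mathrm{loc}}(\mathbb{R};K)$, also denoted by $\mathsf{L}$, commuting with time translations, and for some $S>0$ and $C_S>0$ one has $$\int_0^S\|\mathsf{L}u(t)\|_K^2\,dt\le C_S\,\mathcal{E}_{\ell_0}(u)$$ for every $u\in L^2_{\mathrm{loc}}(\mathbb{R};D(\mathsf{A}^{\ell_0/2}))\cap H^1_{\mathrm{loc}}(\mathbb{R};D(\mathsf{A}^{(\ell_0-1)/2}))\cap H^2_{\mathrm{loc}}(\mathbb{R};D(\mathsf{A}^{\ell_0/2-1}))$ solution of $\partial_t^2u+\mathsf{A}u=0$ (all such solutions belong to the domain of the extension). *)

(* Defs.v *)
From HB Require Import structures.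
From mathcomp Require Import all_boot all_order all_algebra.
From mathcomp Require Import complex.
From mathcomp Require Import all_classical all_reals all_analysis.

Set Implicit Arguments.
Unset Strict Implicit.
Unset Printing Implicit Defensive.

Import Order.TTheory GRing.Theory Num.Theory.
Import numFieldNormedType.Exports.

Local Open Scope classical_set_scope.
Local Open Scope ring_scope.
Local Open Scope complex_scope.

(* ** Hilbert spaces and unbounded operators *)

(* A norm over R[i] takes its (real) values in R[i]. *)
Definition rnorm (R : realType) (V : normedZmodType R[i]) (x : V) : R :=
  complex.Re `|x|.

Definition sqnorm (R : realType) (V : normedZmodType R[i]) (x : V) : \bar R :=
  (rnorm x ^+ 2)%:E.

(* A Hilbert space is a complete normed space over R[i] together with a
   positive definite hermitian form ip inducing its norm; ip is linear in its
   first argument. *)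
Definition hilbert_norm (R : realType) (E : normedModType R[i])
    (ip : {dot E for Num.conj}) : Prop :=
  forall u : E, ip u u = `|u| ^+ 2.

Definition subspace (C : pzRingType) (V : lmodType C) (D : set V) : Prop :=
  D 0 /\ forall (c : C) (u v : V), D u -> D v -> D (c *: u + v).

Definition linear_on (C : pzRingType) (V W : lmodType C)
    (D : set V) (f : V -> W) : Prop :=
  forall (c : C) (u v : V), D u -> D v -> f (c *: u + v) = c *: f u + f v.

(* The last clause says that A, with domain D, is equal to its adjoint: v lies
   in the domain of the adjoint with image w exactly when
   (A u, v) = (u, w) for every u in D. *)
Definition selfadjoint (R : realType) (E : normedModType R[i])
    (ip : {dot E for Num.conj}) (D : set E) (A : E -> E) : Prop :=
  [/\ subspace D, linear_on D A, closure D = setT &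
      forall v w : E,
        (D v /\ A v = w) <-> (forall u, D u -> ip (A u) v = ip u w)].

Definition positive_op (R : realType) (E : normedModType R[i])
    (ip : {dot E for Num.conj}) (D : set E) (A : E -> E) : Prop :=
  forall u, D u -> 0 <= ip (A u) u.

Definition hilbert_basis (R : realType) (E : normedModType R[i])
    (ip : {dot E for Num.conj}) (e : nat -> E) : Prop :=
  (forall i j, ip (e i) (e j) = (i == j)%:R) /\
  (forall u : E, (fun n => \sum_(0 <= nu < n) ip u (e nu) *: e nu) @ \oo --> u).

Definition eigenbasis (R : realType) (E : normedModType R[i])
    (ip : {dot E for Num.conj}) (D : set E) (A : E -> E)
    (e : nat -> E) (lambda : nat -> R) : Prop :=
  hilbert_basis ip e /\
  (forall nu, D (e nu) /\ A (e nu) = (lambda nu)%:C *: e nu) /\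
  [/\ forall nu, 0 < lambda nu,
      forall mu nu, (mu <= nu)%N -> lambda mu <= lambda nu &
      lambda @ \oo --> +oo].

(* ** The scale D(A^s)

   An element u of D(A^s), s real, is the formal series with general term
   u_nu e_nu; it is represented by its sequence of coefficients.  A vector u of
   E is identified with coef ip e u, so that E is D(A^0). *)
Definition cseq (R : realType) := nat -> R[i].

Definition coef (R : realType) (E : normedModType R[i])
    (ip : {dot E for Num.conj}) (e : nat -> E) (u : E) : cseq R :=
  fun nu => ip u (e nu).

Definition cseq_conj (R : realType) (u : cseq R) : cseq R :=
  fun nu => Num.conj (u nu).

(* The squared norm of D(A^s), equal to +oo outside D(A^s). *)
Definition sqnormA (R : realType) (lambda : nat -> R) (s : R) (u : cseq R) :
    \bar R :=
  (\sum_(0 <= nu <oo) (lambda nu `^ (2 * s) * rnorm (u nu) ^+ 2)%R%:E)%E.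

Definition domA_pow (R : realType) (lambda : nat -> R) (s : R) :
    set (cseq R) :=
  [set u | (sqnormA lambda s u < +oo)%E].

Definition A_pow (R : realType) (lambda : nat -> R) (s : R) (u : cseq R) :
    cseq R :=
  fun nu => (lambda nu `^ s)%:C * u nu.

(* Energy at the s-energy level, from u(t) and (d/dt) u(t). *)
Definition energy (R : realType) (lambda : nat -> R) (s : R)
    (ut dut : cseq R) : \bar R :=
  ((2^-1)%R%:E *
   (sqnormA lambda (s / 2)%R ut + sqnormA lambda ((s - 1) / 2)%R dut))%E.

(* ** The wave equation *)

(* The solution is du 0, and du k is its k-th time derivative.  As du k is
   continuous into D(A^((s-k)/2)) and differentiable, with derivative du k.+1,
   into D(A^((s-k-1)/2)), du 0 is of class C^k into D(A^((s-k)/2)) for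
   every k. *)
Definition wave_solution (R : realType) (lambda : nat -> R) (s : R)
    (u0 u1 : cseq R) (du : nat -> R -> cseq R) : Prop :=
  [/\ forall k t, domA_pow lambda ((s - k%:R) / 2) (du k t),
      forall k t,
        sqnormA lambda ((s - k%:R) / 2) (du k t' - du k t) @[t' --> t]
          --> (0 : \bar R)%E,
      forall k t,
        sqnormA lambda ((s - k.+1%:R) / 2)
          (h^-1%:C *: (du k (t + h) - du k t) - du k.+1 t) @[h --> (0 : R)^']
          --> (0 : \bar R)%E,
      forall t, du 2%N t + A_pow lambda 1 (du 0%N t) = 0 &
      du 0%N 0 = u0 /\ du 1%N 0 = u1].

Definition cis (R : realType) (x : R) : R[i] := cos x +i* sin x.

(* The k-th time derivative at t of the solution with general term
   e^{it sqrt lambda_nu} u_nu e_nu. *)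
Definition half_wave (R : realType) (lambda : nat -> R) (u : cseq R)
    (k : nat) (t : R) : cseq R :=
  fun nu => (0 +i* Num.sqrt (lambda nu)) ^+ k *
            cis (t * Num.sqrt (lambda nu)) * u nu.

(* ** Dyadic decomposition *)

Definition Jset (R : realType) (lambda : nat -> R) (alpha rho : R) (k : nat) :
    set nat :=
  [set nu | alpha * rho ^+ k <= Num.sqrt (lambda nu) < rho ^+ k / alpha].

Definition Espace (R : realType) (E : normedModType R[i]) (e : nat -> E)
    (lambda : nat -> R) (alpha rho : R) (k : nat) : set E :=
  [set u | exists c : nat -> R[i],
     u = \sum_(nu \in Jset lambda alpha rho k) c nu *: e nu].

(* The value U 0 is irrelevant. *)
Definition Bplus (R : realType) (E : normedModType R[i]) (e : nat -> E)
    (lambda : nat -> R) (alpha rho : R) : set (nat -> E) :=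
  [set U | forall k, (0 < k)%N ->
     Espace e lambda alpha rho k (U k) /\ `|U k| <= 1].

(* ** Vector-valued L^2_loc and Sobolev spaces on the line

   N is the squared norm of a normed space whose points are the x : V with
   N x < +oo (sqnorm on K, sqnormA lambda s for D(A^s)).  Classes modulo
   almost everywhere equality are handled through representatives that are
   pointwise limits of simple functions; each class has one. *)
Definition simple_fun (R : realType) (V : zmodType) (N : V -> \bar R)
    (g : R -> V) : Prop :=
  [/\ finite_set (range g),
      forall x : V, measurable (g @^-1` [set x] : set R) &
      forall t, (N (g t) < +oo)%E].

Definition strongly_measurable (R : realType) (V : zmodType)
    (N : V -> \bar R) (f : R -> V) : Prop :=
  exists g : nat -> R -> V,
    (forall n, simple_fun N (g n)) /\
    (forall t, N (f t - g n t) @[n --> \oo] --> (0 : \bar R)%E).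

Definition L2loc (R : realType) (V : zmodType) (N : V -> \bar R) :
    set (R -> V) :=
  [set f | strongly_measurable N f /\
     forall a b : R,
       ((\int[lebesgue_measure]_(t in `[a, b]) N (f t)) < +oo)%E].

Definition test_function (R : realType) (phi : R -> R) : Prop :=
  (forall n x, derivable (derive1n n phi) x 1) /\
  (exists M : R, forall x, M < `|x| -> phi x = 0).

(* v is the derivative of u in the sense of distributions with values in some
   D(A^s): as the coefficients are continuous linear forms on D(A^s) separating
   its points, the vector-valued identity is tested on each of them, real and
   imaginary parts apart. *)
Definition weak_derivative (R : realType) (u v : R -> cseq R) : Prop :=
  forall (phi : R -> R), test_function phi -> forall nu,
    (\int[lebesgue_measure]_t (complex.Re (u t nu) * derive1 phi t)) =
      - (\int[lebesgue_measure]_t (complex.Re (v t nu) * phi t)) /\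
    (\int[lebesgue_measure]_t (complex.Im (u t nu) * derive1 phi t)) =
      - (\int[lebesgue_measure]_t (complex.Im (v t nu) * phi t)).

(* u is in H^1_loc with derivative v, resp. in H^2_loc with derivatives v, w. *)
Definition H1loc (R : realType) (N : cseq R -> \bar R) (u v : R -> cseq R) :
    Prop :=
  [/\ L2loc N u, L2loc N v & weak_derivative u v].

Definition H2loc (R : realType) (N : cseq R -> \bar R)
    (u v w : R -> cseq R) : Prop :=
  H1loc N u v /\ H1loc N v w.

Definition weak_wave_solution (R : realType) (lambda : nat -> R) (s : R)
    (u v w : R -> cseq R) : Prop :=
  [/\ L2loc (sqnormA lambda (s / 2)) u,
      H1loc (sqnormA lambda ((s - 1) / 2)) u v,
      H2loc (sqnormA lambda (s / 2 - 1)) u v w &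
      {ae lebesgue_measure,
        forall t : R, w t + A_pow lambda 1 (u t) = 0}].

(* ** The observation operator *)

(* The integral over [0, T] of the squared norm. *)
Definition L2int (R : realType) (K : normedModType R[i]) (T : R)
    (g : R -> K) : \bar R :=
  (\int[lebesgue_measure]_(t in `[0%R, T]) sqnorm (g t))%E.

Definition observation_operator (R : realType) (K : normedModType R[i])
    (lambda : nat -> R) (m0 C0 : R) (L : cseq R -> K) : Prop :=
  linear_on (domA_pow lambda m0) L /\
  forall u, domA_pow lambda m0 u ->
    (sqnorm (L u) <= (C0 ^+ 2)%:E * sqnormA lambda m0 u)%E.

(* Lext, with domain Dext, is a linear operator from a subspace of
   L^2_loc(R; D(A^(l0/2))) into L^2_loc(R; K) that commutes with time
   translations and extends the pointwise action of L on
   L^2_loc(R; D(A^m0)).  The fields ext_class and ext_linear express that it is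
   a linear operator on classes modulo almost everywhere equality. *)
Record time_extension (R : realType) (K : normedModType R[i])
    (lambda : nat -> R) (m0 l0 : R) (L : cseq R -> K)
    (Dext : set (R -> cseq R)) (Lext : (R -> cseq R) -> R -> K) : Prop := {
  ext_dom : Dext `<=` L2loc (sqnormA lambda (l0 / 2));
  ext_cod : forall f, Dext f -> L2loc (@sqnorm R K) (Lext f);
  ext_class : forall f g, Dext f -> L2loc (sqnormA lambda (l0 / 2)) g ->
    {ae lebesgue_measure, forall t : R, f t = g t} ->
    Dext g /\ {ae lebesgue_measure, forall t : R, Lext f t = Lext g t};
  ext_subspace : Dext (fun=> 0) /\
    forall (c : R[i]) f g, Dext f -> Dext g -> Dext (fun t => c *: f t + g t);
  ext_linear : forall (c : R[i]) f g, Dext f -> Dext g ->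
    {ae lebesgue_measure, forall t : R,
      Lext (fun s => c *: f s + g s) t = c *: Lext f t + Lext g t};
  ext_pointwise : forall f, L2loc (sqnormA lambda m0) f ->
    Dext f /\ {ae lebesgue_measure, forall t : R, Lext f t = L (f t)};
  ext_translation : forall (a : R) f, Dext f ->
    Dext (fun t => f (t + a)) /\
    {ae lebesgue_measure, forall t : R,
      Lext (fun s => f (s + a)) t = Lext f (t + a)}
}.

(* The energy of a solution given by classes u, v is the almost everywhere
   constant value of energy lambda l0 (u t) (v t). *)
Definition admissible (R : realType) (K : normedModType R[i])
    (lambda : nat -> R) (m0 l0 : R) (L : cseq R -> K)
    (Dext : set (R -> cseq R)) (Lext : (R -> cseq R) -> R -> K) : Prop :=
  time_extension lambda m0 l0 L Dext Lext /\
  exists S CS : R, [/\ 0 < S, 0 < CS &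
    forall u v w, weak_wave_solution lambda l0 u v w ->
      Dext u /\
      {ae lebesgue_measure, forall t : R,
        (L2int S (Lext u) <= CS%:E * energy lambda l0 (u t) (v t))%E}].

(* Main.v *)
Require Import Defs.
From HB Require Import structures.
From mathcomp Require Import all_boot all_order all_algebra.
From mathcomp Require Import complex.
From mathcomp Require Import all_classical all_reals all_analysis measurable_realfun.
From mathcomp Require Import ring lra zify.

(** Every solution is a sum of time exponentials of frequencies [+ omega v] and
[- omega v], [omega v] the square root of [lambda v], and what is observed of a
finite sum of modes is [F t = \sum_j (c j * cis (tau j * t)) *: y j], with
[y j] in [K] the observation of a mode.  The theorem is first proved for such
finite sums, with constants independent of the number of terms
([observability_sums]), then extended by density.

The hypothesis on the dyadic blocks says that the amplitudes with frequencies
in a dyadic window, of positive sign, are observed on [[0, T]]; conjugation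
gives the windows of negative sign ([window_exists]).  The windows are glued by
elementary filters.  Averaging [F] over [M] translates by a small step [delta],
after rotation by a unit complex number, and iterating [N] times, multiplies
each amplitude by a factor that decays like the power [- N] of the distance to
the frequency to which the filter is tuned.  Tuning it to [Q = N * M] equidistant
frequencies, Parseval's identity for the discrete Fourier transform shows that
the filtered signals together keep all the energy ([sum_nsq_ev_ge1]) while what
they show is at most [N] times what [F] shows on a slightly longer interval
([sum_filter_le]).  A filtered signal lives essentially in the window around its
frequency, where observability is known.  The error is controlled by
admissibility, which loses a power of the frequency because [l0] may exceed
[l1]; taking [N] larger than this power, the error is absorbed at high
frequency ([high_frequency]).

Only finitely many frequencies are left, and they are added one at a time
([remove_frequency]).  To handle the frequency [z], the signal
[F t - cis (- (z * s)) *: F (t + s)], from which [z] has disappeared, observes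
all the other amplitudes; then the filter tuned to [z] gives the vector of [K]
carried by [z].  By unique continuation the observations of the modes of
frequency [z] are linearly independent ([frequency_independent]), so this vector
determines the amplitudes, with a bound given by a Gram matrix ([gram_bound]).

For infinitely many modes, the solution of the wave equation is determined
coefficient by coefficient ([wave_solution_modes]).  It is cut into a finite sum
and a tail; admissibility, extended to all bounded intervals by translation,
shows that the observation of the tail tends to 0 ([observable_limit]). *)

Set Implicit Arguments.
Unset Strict Implicit.
Unset Printing Implicit Defensive.

Import Order.TTheory GRing.Theory Num.Theory.
Import numFieldNormedType.Exports.

Local Open Scope classical_set_scope.
Local Open Scope ring_scope.
Local Open Scope complex_scope.

(** * Squared norms and unit complex numbers *)

Section Scalars.
Variable R : realType.
Implicit Types (x y t : R) (z w : R[i]).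

(** Norms over [R[i]] take their values in [R[i]]; estimates are made on their
    squares, as real numbers. *)
Definition nsq (V : normedZmodType R[i]) (x : V) : R := rnorm x ^+ 2.

Lemma rnormK (V : normedZmodType R[i]) (x : V) : (rnorm x)%:C = `|x|.
Proof. by rewrite /rnorm RRe_real // normr_real. Qed.

Lemma rnorm_ge0 (V : normedZmodType R[i]) (x : V) : 0 <= rnorm x.
Proof. by rewrite -ler0c rnormK. Qed.

Lemma nsq_ge0 (V : normedZmodType R[i]) (x : V) : 0 <= nsq x.
Proof. exact: sqr_ge0. Qed.

Lemma nsqK (V : normedZmodType R[i]) (x : V) : (nsq x)%:C = `|x| ^+ 2.
Proof. by rewrite /nsq rmorphXn /= rnormK. Qed.

Lemma nsq0 (V : normedZmodType R[i]) : nsq (0 : V) = 0.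
Proof. by rewrite /nsq /rnorm normr0 /= expr0n. Qed.

Lemma nsq_eq0 (V : normedZmodType R[i]) (x : V) : (nsq x == 0) = (x == 0).
Proof.
by rewrite /nsq sqrf_eq0 -(inj_eq (@complexI R)) rnormK normr_eq0.
Qed.

Lemma nsqN (V : normedZmodType R[i]) (x : V) : nsq (- x) = nsq x.
Proof. by rewrite /nsq /rnorm normrN. Qed.

Lemma rnormD (V : normedZmodType R[i]) (x y : V) :
  rnorm (x + y) <= rnorm x + rnorm y.
Proof. by rewrite -lecR rmorphD /= !rnormK ler_normD. Qed.

Lemma nsqD (V : normedZmodType R[i]) (x y : V) :
  nsq (x + y) <= 2 * nsq x + 2 * nsq y.
Proof.
rewrite /nsq; have := rnormD x y.
have := rnorm_ge0 (x + y); have := rnorm_ge0 x; have := rnorm_ge0 y.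
set a := rnorm _; set b := rnorm _; set c := rnorm _ => a0 b0 c0 h.
by have := sqr_ge0 (b - a); nra.
Qed.

Lemma nsqB (V : normedZmodType R[i]) (x y : V) :
  nsq (x - y) <= 2 * nsq x + 2 * nsq y.
Proof. by rewrite -(nsqN y) nsqD. Qed.

Lemma nsqZ (V : normedModType R[i]) z (x : V) : nsq (z *: x) = nsq z * nsq x.
Proof. by apply: (@complexI R); rewrite [RHS]rmorphM /= !nsqK normrZ exprMn. Qed.

Lemma nsqM z w : nsq (z * w) = nsq z * nsq w.
Proof. by apply: (@complexI R); rewrite [RHS]rmorphM /= !nsqK normrM exprMn. Qed.

Lemma nsqX z n : nsq (z ^+ n) = nsq z ^+ n.
Proof. by apply: (@complexI R); rewrite [RHS]rmorphXn /= !nsqK normrX exprAC. Qed.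

Lemma nsqE z : nsq z = complex.Re z ^+ 2 + complex.Im z ^+ 2.
Proof. by apply: (@complexI R); rewrite nsqK add_Re2_Im2. Qed.

Lemma nsq_real x : nsq x%:C = x ^+ 2.
Proof. by rewrite nsqE /= expr0n addr0. Qed.

Lemma nsq_mulJ z : (nsq z)%:C = z * z^*%R.
Proof. by rewrite nsqK normCK. Qed.

Lemma nsq_conj z : nsq (Num.conj z) = nsq z.
Proof. by apply: (@complexI R); rewrite !nsqK norm_conjC. Qed.

Lemma cisD x y : cis (x + y) = cis x * cis y.
Proof. by rewrite /cis cosD sinD; apply/eqP; rewrite eq_complex /= addrC (addrC (_ * _)) !eqxx. Qed.

Lemma cis0 : cis (0 : R) = 1.
Proof. by rewrite /cis cos0 sin0. Qed.

Lemma cisMn x n : cis (x *+ n) = cis x ^+ n.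
Proof. by elim: n => [|n IH]; rewrite ?mulr0n ?cis0 // mulrS cisD IH exprS. Qed.

Lemma nsq_cis x : nsq (cis x) = 1.
Proof. by rewrite nsqE /= cos2Dsin2. Qed.

Lemma conj_cis x : (cis x)^*%R = cis (- x).
Proof.
have cis_n0 : cis x != 0 by rewrite -nsq_eq0 nsq_cis oner_eq0.
by apply: (mulfI cis_n0); rewrite -nsq_mulJ nsq_cis -cisD subrr cis0.
Qed.

Lemma conjCM z w : (z * w)^*%R = z^*%R * w^*%R.
Proof. exact: rmorphM. Qed.

Lemma cis2pi : cis (pi *+ 2 : R) = 1.
Proof. by rewrite /cis cos2pi sin2pi. Qed.

Lemma nsq_1Bcis x : nsq (1 - cis x) = 2 - 2 * cos x.
Proof. by rewrite nsqE /= /cis /=; have := cos2Dsin2 x; lra. Qed.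

Lemma half_angle x : 1 - cos x = 2 * sin (x / 2) ^+ 2.
Proof.
have -> : cos x = cos (x / 2 + x / 2) by congr cos; field.
by rewrite cosD; have := cos2Dsin2 (x / 2); nra.
Qed.

Lemma sin_le x : 0 <= x -> sin x <= x.
Proof.
rewrite le_eqVlt => /predU1P[<-|x0]; first by rewrite sin0.
have [c cI] := @MVT R sin cos 0 x x0 (fun y _ => is_derive_sin y)
  (continuous_subspaceT (@continuous_sin R)).
rewrite sin0 !subr0 => ->.
by rewrite ler_piMl ?cos_le1 // ltW.
Qed.

Lemma cos_ge x : 1 - x ^+ 2 / 2 <= cos x.
Proof.
wlog x0 : x / 0 <= x.
  move=> H; have [/H//|/ltW x0] := leP 0 x.
  by have := H (- x); rewrite cosN sqrrN; apply; rewrite oppr_ge0.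
have := half_angle x; have := @sin_le (x / 2) _.
have h : 0 <= x / 2 by rewrite divr_ge0.
have : - (x / 2) <= sin (x / 2) \/ sin (x / 2) < - (x / 2).
  by case: (leP (- (x / 2)) (sin (x / 2))); [left|right].
case=> [h1 /(_ h) h2 h3|h1].
  by have : sin (x / 2) ^+ 2 <= (x / 2) ^+ 2; [nra|lra].
move=> _ h3.
have [c cI] := @MVT_segment R sin cos 0 (x/2) h (fun y _ => is_derive_sin y)
  (continuous_subspaceT (@continuous_sin R)).
rewrite sin0 !subr0 => hc; have := cos_geN1 c; nra.
Qed.

(** By the mean value theorem, from [cos_ge]. *)
Lemma sin_ge x : 0 <= x -> x - x ^+ 3 / 6 <= sin x.
Proof.
rewrite le_eqVlt => /predU1P[<-|x0]; first by rewrite sin0; lra.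
pose f y : R := sin y - y + y ^+ 3 / 6.
pose f' y : R := cos y - 1 + y ^+ 2 / 2.
have df y : is_derive y 1 f (f' y).
  rewrite /f /f'; apply: is_derive_eq; rewrite /GRing.scale /=.
  by field.
have [c cI] := @MVT R f f' 0 x x0 (fun y _ => df y)
  (@derivable_within_continuous _ _ f _ (fun y _ => @ex_derive _ _ _ _ _ _ _ (df y))).
rewrite /f sin0 /f' => h.
rewrite subr0 in h.
have k : 0 <= (cos c - 1 + c ^+ 2 / 2) * x.
  by apply: mulr_ge0; [have := cos_ge c; lra|exact: ltW].
by lra.
Qed.

(** Bounding the chord below by the angle allows dividing geometric sums by
    [1 - cis x].  The angles met below are at most [pi], plus a small shift, and
    [41 / 10] leaves room for a shift of [1 / 10] when [pi] is bounded by 4. *)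
Lemma nsq_1Bcis_ge x : `|x| <= 41 / 10 -> x ^+ 2 / 16 <= nsq (1 - cis x).
Proof.
wlog x0 : x / 0 <= x.
  move=> H; have [/H//|/ltW xn] := leP 0 x; move=> h.
  have := H (- x); rewrite oppr_ge0 normrN sqrrN => /(_ xn h).
  by rewrite !nsq_1Bcis cosN.
rewrite ger0_norm // => xle; rewrite nsq_1Bcis.
have := half_angle x; have := @sin_ge (x / 2) _.
have h : 0 <= x / 2 by rewrite divr_ge0.
move=> /(_ h) h1 h2.
have : x / 8 <= sin (x / 2) by nra.
by nra.
Qed.

Lemma nsq_1Bcis_le1 x : `|x| <= 1 -> x ^+ 2 / 16 <= nsq (1 - cis x).
Proof. by move=> h; apply: nsq_1Bcis_ge; lra. Qed.

End Scalars.

(** * Finite sums of time exponentials *)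

Section ModeSums.
Variables (R : realType) (K : normedModType R[i]).
Variable ip : {dot K for Num.conj}.
Hypothesis hK : hilbert_norm ip.
Variables (tau : nat -> R) (y : nat -> K).
Implicit Types (c : nat -> R[i]) (n : nat) (t s : R).

(** For the wave equation, [tau] lists the time frequencies and [y j] is the
    observation of the mode that oscillates at the frequency [tau j]. *)
Definition modesum c n t : K := \sum_(j < n) (c j * cis (tau j * t)) *: y j.

Lemma nsq_ip (x : K) : (nsq x)%:C = ip x x.
Proof. by rewrite nsqK hK. Qed.

Lemma ip_sum (I J : Type) (r : seq I) (r' : seq J) (P : pred I) (P' : pred J)
    (a : I -> R[i]) (b : J -> R[i]) (x : I -> K) (z : J -> K) :
  ip (\sum_(i <- r | P i) a i *: x i) (\sum_(j <- r' | P' j) b j *: z j) =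
  \sum_(i <- r | P i) \sum_(j <- r' | P' j) (a i * (b j)^*) * ip (x i) (z j).
Proof.
rewrite linear_sumlz; apply: eq_bigr => i _.
rewrite linear_sumr; apply: eq_bigr => j _.
by rewrite linearZl_LR /= linearZr_LR /= mulrA.
Qed.

Lemma Re_mul_cis (z : R[i]) t :
  complex.Re (z * cis t) = complex.Re z * cos t - complex.Im z * sin t.
Proof. by case: z. Qed.

Lemma continuous_Re_cis (z : R[i]) (a : R) :
  continuous (fun t => complex.Re (z * cis (a * t))).
Proof.
move=> t.
under eq_fun do rewrite Re_mul_cis.
apply: cvgB; apply: cvgM; try exact: cvg_cst.
  apply: (@continuous_comp _ _ _ (fun t => a * t) cos); last exact: continuous_cos.
  by apply: cvgM; [exact: cvg_cst|exact: cvg_id].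
apply: (@continuous_comp _ _ _ (fun t => a * t) sin); last exact: continuous_sin.
by apply: cvgM; [exact: cvg_cst|exact: cvg_id].
Qed.

(** The expansion reduces regularity in time to that of scalar exponentials. *)
Lemma nsq_modesum c n t : nsq (modesum c n t) =
  \sum_(i < n) \sum_(j < n)
     complex.Re ((c i * (c j)^* * ip (y i) (y j)) * cis ((tau i - tau j) * t)).
Proof.
have -> : nsq (modesum c n t) = complex.Re (ip (modesum c n t) (modesum c n t)).
  by rewrite -nsq_ip.
rewrite /modesum ip_sum raddf_sum; apply: eq_bigr => i _.
rewrite raddf_sum; apply: eq_bigr => j _; congr (complex.Re _).
rewrite conjCM conj_cis mulrBl cisD -mulNr.
by ring.
Qed.

Lemma continuous_sumR (I : Type) (r : seq I) (f : I -> R -> R) :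
  (forall i, continuous (f i)) -> continuous (fun t => \sum_(i <- r) f i t).
Proof.
move=> h; elim: r => [|i r IH].
  by under eq_fun do rewrite big_nil; move=> t; exact: cvg_cst.
under eq_fun do rewrite big_cons.
by move=> t; apply: cvgD; [exact: h|exact: IH].
Qed.

Lemma continuous_nsq_modesum c n : continuous (fun t => nsq (modesum c n t)).
Proof.
under eq_fun do rewrite nsq_modesum.
do 2 (apply: continuous_sumR => ?).
exact: continuous_Re_cis.
Qed.

Lemma modesumD c s n t :
  modesum c n (t + s) = modesum (fun j => c j * cis (tau j * s)) n t.
Proof.
apply: eq_bigr => j _; congr (_ *: _).
by rewrite mulrDr cisD mulrA mulrAC.
Qed.

Lemma eq_modesum c c' n t :
  (forall j, (j < n)%N -> c j = c' j) -> modesum c n t = modesum c' n t.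
Proof. by move=> h; apply: eq_bigr => j _; rewrite h. Qed.

(** A polynomial [p] acts on signals through translations by multiples of a step
    [delta], rotated by an angle [theta]; by [modesum_filter], this multiplies
    the amplitude of frequency [tau] by the value of [p] at the unit complex
    number of argument [tau * delta - theta]. *)
Definition ev (p : {poly R}) (z : R[i]) : R[i] := (map_poly (real_complex R) p).[z].

Lemma evE (p : {poly R}) Q z : (size p <= Q)%N -> ev p z = \sum_(m < Q) (p`_m)%:C * z ^+ m.
Proof.
move=> h; rewrite /ev (@horner_coef_wide _ Q).
  by apply: eq_bigr => m _; rewrite coef_map.
by rewrite size_map_poly.
Qed.

Lemma evX p n z : ev (p ^+ n) z = ev p z ^+ n.
Proof. by rewrite /ev rmorphXn horner_exp. Qed.

Lemma modesum_filter (p : {poly R}) Q (delta theta : R) c n t : (size p <= Q)%N ->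
  modesum (fun j => c j * ev p (cis (tau j * delta - theta))) n t =
  \sum_(m < Q) cis (- (theta * m%:R)) *: ((p`_m)%:C *: modesum c n (t + m%:R * delta)).
Proof.
move=> h; rewrite /modesum.
under [RHS]eq_bigr do rewrite !scaler_sumr.
rewrite exchange_big /=; apply: eq_bigr => j _.
rewrite (evE _ h) mulr_sumr mulr_suml scaler_suml; apply: eq_bigr => m _.
rewrite !scalerA; congr (_ *: _).
rewrite -cisMn -[in LHS]mulr_natr (mulrBl _ (tau j * delta)) mulrDr !cisD.
rewrite (_ : tau j * delta * m%:R = tau j * (m%:R * delta)); last by ring.
by ring.
Qed.

End ModeSums.

(** * Parseval identity for the discrete Fourier transform *)

Section Parseval.
Variable R : realType.
Implicit Types (Q i m : nat).

(** The arguments of the [Q]-th roots of unity, taken in [-pi, pi] so that the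
    chord still controls the angle after a small shift. *)
Definition ang Q i : R :=
  pi *+ 2 * i%:R / Q%:R - (if (2 * i <= Q)%N then 0 else pi *+ 2).

Lemma ang_le Q i : (0 < Q)%N -> (i < Q)%N -> `|ang Q i| <= pi.
Proof.
move=> Q0 iQ; rewrite /ang ler_norml.
have q0 : (0 : R) < Q%:R by rewrite ltr0n.
have pi0 := pi_gt0 R.
have i0 : (0 : R) <= i%:R by rewrite ler0n.
have iq : (i%:R : R) <= Q%:R by rewrite ler_nat ltnW.
set r : R := pi *+ 2 * i%:R / Q%:R.
have rE : r * Q%:R = pi *+ 2 * i%:R by rewrite /r mulfVK // gt_eqF.
case: ifPn => h.
  have h2 : 2 * i%:R <= Q%:R :> R by rewrite -natrM ler_nat.
  have r0 : 0 <= r by rewrite /r divr_ge0 ?mulr_ge0 ?(ltW q0) // mulrn_wge0 // (ltW pi0).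
  rewrite subr0; apply/andP; split; first by lra.
  by rewrite /r ler_pdivrMr // mulr2n; nra.
have h2 : Q%:R <= 2 * i%:R :> R by rewrite -natrM ler_nat ltnW // ltnNge.
apply/andP; split.
  have : pi <= r by rewrite /r ler_pdivlMr // mulr2n; nra.
  by rewrite mulr2n; lra.
have : r <= pi *+ 2 by rewrite /r ler_pdivrMr // mulr2n; nra.
by rewrite mulr2n; lra.
Qed.

Lemma cis_2pi_int (k : int) : cis (pi *+ 2 * k%:~R : R) = 1.
Proof.
case: k => k; first by rewrite -pmulrn mulr_natr cisMn cis2pi expr1n.
rewrite NegzE mulrNz mulrN -conj_cis -pmulrn mulr_natr cisMn cis2pi expr1n.
by rewrite rmorph1.
Qed.

Lemma cis_ang Q i (d : int) :
  cis (ang Q i * d%:~R) = cis (pi *+ 2 * d%:~R / Q%:R) ^+ i.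
Proof.
rewrite /ang mulrBl cisD.
have -> : cis (- ((if (2 * i <= Q)%N then 0 else pi *+ 2) * d%:~R : R)) = 1.
  case: ifP => _; first by rewrite mul0r oppr0 cis0.
  by rewrite -conj_cis cis_2pi_int rmorph1.
rewrite mulr1 -cisMn; congr cis; rewrite -mulr_natr.
by ring.
Qed.

Lemma cis_neq1 (x : R) : 0 < x < pi *+ 2 -> cis x != 1.
Proof.
move=> /andP[x0 x2]; apply/negP => /eqP h.
have : nsq (1 - cis x) = 0 by rewrite h subrr nsq0.
rewrite nsq_1Bcis; have := half_angle x.
have : 0 < sin (x / 2).
  by apply: sin_gt0_pi; rewrite mulr2n in x2; apply/andP; split; lra.
by nra.
Qed.

Lemma sum_root Q (d : int) : (0 < Q)%N -> (`|d|%N < Q)%N ->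
  \sum_(i < Q) cis (ang Q i * d%:~R) = if d == 0 then Q%:R else 0 :> R[i].
Proof.
move=> Q0 dQ; have q0 : (0 : R) < Q%:R by rewrite ltr0n.
under eq_bigr do rewrite cis_ang.
case: eqP => [->|/eqP dn0].
  under eq_bigr do rewrite mulr0 mul0r cis0 expr1n.
  by rewrite sumr_const card_ord.
set z := cis _.
have zn1 : z != 1.
  have pi0 := pi_gt0 R.
  case: d dQ dn0 @z => k.
    rewrite absz_nat => kQ k0 z; apply: cis_neq1.
    have kq : (k%:R : R) < Q%:R by rewrite ltr_nat.
    have kp : (0 : R) < k%:R by rewrite ltr0n lt0n.
    rewrite -pmulrn.
    have p2 : 0 < pi *+ 2 :> R by rewrite mulr2n; lra.
    rewrite divr_gt0 ?mulr_gt0 //.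
    by rewrite ltr_pdivrMr // ltr_pM2l.
  rewrite NegzE abszN absz_nat => kQ _ z.
  have kq : (k.+1%:R : R) < Q%:R by rewrite ltr_nat.
  have kp : (0 : R) < k.+1%:R by rewrite ltr0n.
  have : cis (pi *+ 2 * k.+1%:R / Q%:R : R) != 1.
    have p2 : 0 < pi *+ 2 :> R by rewrite mulr2n; lra.
    apply: cis_neq1; rewrite divr_gt0 ?mulr_gt0 //.
    by rewrite ltr_pdivrMr // ltr_pM2l.
  apply: contra => /eqP zE; apply/eqP.
  have := conj_cis (pi *+ 2 * (- k.+1%:Z)%:~R / Q%:R : R).
  rewrite -/z zE rmorph1 => ->; congr cis.
  by rewrite mulrNz; ring.
have zQ : z ^+ Q = 1.
  rewrite /z -cisMn -[X in cis X]mulr_natr mulfVK ?gt_eqF //.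
  exact: cis_2pi_int.
have := subrX1 z Q; rewrite zQ subrr => /esym/eqP.
by rewrite mulf_eq0 subr_eq0 (negbTE zn1) /= => /eqP.
Qed.

(** The sum over the roots of unity kills the terms off the diagonal. *)
Lemma sum_dft Q (G : 'I_Q -> 'I_Q -> R[i]) : (0 < Q)%N ->
  \sum_(i < Q) \sum_(m < Q) \sum_(k < Q)
     (cis (- (ang Q i * m%:R)) * (cis (- (ang Q i * k%:R)))^*) * G m k =
  Q%:R * \sum_(m < Q) G m m.
Proof.
move=> Q0; rewrite exchange_big /= mulr_sumr; apply: eq_bigr => m _.
rewrite exchange_big /= (bigD1 m) //= [X in _ + X]big1 ?addr0; last first.
  move=> k km; rewrite -mulr_suml.
  under eq_bigr do rewrite conj_cis opprK -cisD -mulrN -mulrDr.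
  rewrite (eq_bigr (fun i : 'I_Q => cis (ang Q i * ((k%:Z - m%:Z)%:~R)))).
    rewrite sum_root //.
      by rewrite subr_eq0 eqz_nat val_eqE (negbTE km) mul0r.
    by have := ltn_ord k; have := ltn_ord m; lia.
  by move=> i _; rewrite intrB !pmulrn addrC.
rewrite -mulr_suml; congr (_ * _).
under eq_bigr do rewrite conj_cis -cisD subrr cis0.
by rewrite sumr_const card_ord.
Qed.

(** Applied to translates of the observed signal, this bounds the sum of what
    the filtered signals show. *)
Lemma parseval (K : normedModType R[i]) (ip : {dot K for Num.conj})
    (hK : hilbert_norm ip) Q (x : nat -> K) : (0 < Q)%N ->
  \sum_(i < Q) nsq (\sum_(m < Q) cis (- (ang Q i * m%:R)) *: x m) =
  Q%:R * \sum_(m < Q) nsq (x m).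
Proof.
move=> Q0; apply: (@complexI R); rewrite rmorphM rmorph_nat !rmorph_sum /=.
under eq_bigr do rewrite (nsq_ip hK) ip_sum.
under [in RHS]eq_bigr do rewrite (nsq_ip hK).
exact: (sum_dft (fun m k : 'I_Q => ip (x m) (x k)) Q0).
Qed.

(** Applied to the multipliers, this shows that the filters keep all the
    energy. *)
Lemma parseval_scalar Q (x : nat -> R[i]) : (0 < Q)%N ->
  \sum_(i < Q) nsq (\sum_(m < Q) cis (- (ang Q i * m%:R)) * x m) =
  Q%:R * \sum_(m < Q) nsq (x m).
Proof.
move=> Q0; apply: (@complexI R); rewrite rmorphM rmorph_nat !rmorph_sum /=.
under [in RHS]eq_bigr do rewrite nsq_mulJ.
rewrite -(sum_dft (fun m k : 'I_Q => x m * (x k)^*) Q0).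
apply: eq_bigr => i _; rewrite nsq_mulJ [in X in _ * X]rmorph_sum mulr_suml.
apply: eq_bigr => m _; rewrite mulr_sumr; apply: eq_bigr => k _.
by rewrite rmorphM /=; ring.
Qed.

End Parseval.

(** * Integrals over bounded time intervals *)

Section Integrals.
Variable R : realType.
Local Notation mu := (@lebesgue_measure R).
Implicit Types (f g : R -> R) (T s : R).

(** The Lebesgue measure is the only measure giving intervals their lengths. *)
Lemma lebesgue_measure_shift s (A : set R) : measurable A ->
  pushforward mu (fun t : R => t + s : measurableTypeR R) A = mu A.
Proof.
have ms : measurable_fun [set: R] (fun t : R => t + s : measurableTypeR R).
  by apply: measurable_funD => //; exact: measurable_cst.
pose m_mixin := isMeasurableFun.Build _ _ _ _ _ ms.
pose m_pack : {mfun _ >-> _} := HB.pack (fun t : R => t + s : measurableTypeR R) m_mixin.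
move=> mA; apply/esym/(@lebesgue_measure_unique _ (pushforward mu m_pack)) => //= _ [[a b]] _ <-.
rewrite /pushforward.
have -> : (fun t : R => t + s) @^-1` `]a, b] = `]a - s, b - s]%classic.
  apply/seteqP; split=> t /=; rewrite !in_itv /=; first by
    move=> /andP[? ?]; apply/andP; split; lra.
  by move=> /andP[? ?]; apply/andP; split; lra.
rewrite !lebesgue_measure_itv /= !lte_fin ltrD2r; case: ifP => // _.
by rewrite -!EFinB; congr EFin; ring.
Qed.

Lemma ge0_integral_shift (f : R -> \bar R) s a b :
  measurable_fun [set: R] f -> (forall t, 0 <= f t)%E ->
  (\int[mu]_(t in `[a, b]) f (t + s)%R = \int[mu]_(t in `[(a + s)%R, (b + s)%R]) f t)%E.
Proof.
move=> mf f0.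
pose F : measurableTypeR R -> measurableTypeR R := fun t : R => t + s.
have ms : measurable_fun setT F.
  by apply: measurable_funD => //; exact: measurable_cst.
have E : `[a, b]%classic = F @^-1` `[(a + s)%R, (b + s)%R].
  by apply/seteqP; split=> t; rewrite /F /= !in_itv /= !lerD2r.
have := @ge0_integral_pushforward _ _ _ _ R _ ms mu `[(a + s)%R, (b + s)%R]%classic f.
rewrite -E => <- //; last exact: measurable_funS mf.
by apply: eq_measure_integral => //= A mA AS; exact: lebesgue_measure_shift.
Qed.

Definition integ T g : R := \int[mu]_(t in `[0%R, T]) g t.

Lemma continuous_measurable g : continuous g -> measurable_fun [set: R] g.
Proof. by move=> cg; apply: continuous_measurable_fun. Qed.

Lemma continuous_integrable g T : continuous g ->
  mu.-integrable `[0%R, T] (EFin \o g).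
Proof.
move=> cg; apply: continuous_compact_integrable; first exact: segment_compact.
exact: continuous_subspaceT.
Qed.

Lemma integE g T : continuous g ->
  ((integ T g)%:E = \int[mu]_(t in `[0%R, T]) (g t)%:E)%E.
Proof.
by move=> cg; rewrite /integ /Rintegral fineK // integrable_fin_num // continuous_integrable.
Qed.

Lemma integ_ge0 T g : (forall t, 0 <= g t) -> 0 <= integ T g.
Proof. by move=> g0; apply: Rintegral_ge0. Qed.

Lemma integ_le T f g : continuous f -> continuous g -> (forall t, f t <= g t) ->
  integ T f <= integ T g.
Proof. by move=> cf cg fg; apply: le_Rintegral => //; exact: continuous_integrable. Qed.

Lemma integ_sum (I : Type) (r : seq I) T (a : I -> R) (g : I -> R -> R) :
  (forall i, continuous (g i)) ->
  integ T (fun t => \sum_(i <- r) a i * g i t) = \sum_(i <- r) a i * integ T (g i).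
Proof.
move=> cg; elim: r => [|i r IH].
  rewrite big_nil; under eq_fun do rewrite big_nil.
  by rewrite /integ Rintegral_cst // mul0r.
rewrite big_cons -IH; under eq_fun do rewrite big_cons.
have ca j : continuous (fun t => a j * g j t).
  by move=> t; apply: cvgM; [exact: cvg_cst|exact: cg].
rewrite /integ RintegralD //.
- by rewrite RintegralZl //; exact: continuous_integrable.
- exact: continuous_integrable.
- by apply: continuous_integrable; apply: continuous_sumR.
Qed.

Lemma integ_scale T a g : continuous g -> integ T (fun t => a * g t) = a * integ T g.
Proof. by move=> cg; rewrite /integ RintegralZl //; exact: continuous_integrable. Qed.

Lemma integ_shift T T' s g : continuous g -> (forall t, 0 <= g t) ->
  0 <= s -> T + s <= T' -> integ T (fun t => g (t + s)) <= integ T' g.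
Proof.
move=> cg g0 s0 Ts.
have cgs : continuous (fun t => g (t + s)).
  move=> t; apply: (@continuous_comp _ _ _ (fun t => t + s) g); last exact: cg.
  by apply: cvgD; [exact: cvg_id|exact: cvg_cst].
rewrite -lee_fin !integE //.
have mg : measurable_fun [set: R] (fun t => (g t)%:E).
  by apply/measurable_EFinP; exact: continuous_measurable.
rewrite (@ge0_integral_shift (fun t => (g t)%:E)) //.
apply: ge0_subset_integral => //; first exact: measurable_funS mg.
  by move=> t _; rewrite lee_fin.
by move=> t /=; rewrite !in_itv /= => /andP[? ?]; apply/andP; split; lra.
Qed.

Lemma integ_cst T a : 0 <= T -> integ T (fun=> a) = a * T.
Proof.
move=> T0; rewrite /integ Rintegral_cst //= lebesgue_measure_itv /= lte_fin.
by case: ltP => h /=; [rewrite subr0|have -> : T = 0 by lra].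
Qed.

End Integrals.

(** * Averaging filters *)

Section Averages.
Variable R : realType.
Implicit Types (M N Q : nat).

(** The uniform weights on [M] consecutive translates.  The filters are its
    powers: each factor gains one power of decay away from the tuned frequency,
    at the price of a fixed additional time of observation. *)
Definition avg M : {poly R} := \poly_(m < M) M%:R^-1.

Lemma sum_coef (p : {poly R}) Q : (size p <= Q)%N -> \sum_(m < Q) p`_m = p.[1].
Proof.
move=> h; rewrite (horner_coef_wide _ h); apply: eq_bigr => m _.
by rewrite expr1n mulr1.
Qed.

Lemma avg1 M : (0 < M)%N -> (avg M).[1] = 1.
Proof.
move=> M0; rewrite horner_poly; under eq_bigr do rewrite expr1n mulr1.
by rewrite sumr_const card_ord -[_ *+ _]mulr_natr mulVf // pnatr_eq0 -lt0n.
Qed.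

Lemma avgX1 M N : (0 < M)%N -> (avg M ^+ N).[1] = 1.
Proof. by move=> M0; rewrite horner_exp avg1 // expr1n. Qed.

Lemma avgX_ge0 M N i : 0 <= (avg M ^+ N)`_i.
Proof.
elim: N i => [|N IH] i; first by rewrite expr0 coef1 ler0n.
rewrite exprS coefM sumr_ge0 // => j _; rewrite mulr_ge0 //.
by rewrite coef_poly; case: ifP => // _; rewrite invr_ge0 ler0n.
Qed.

Lemma size_avgX M N : (0 < M)%N -> (0 < N)%N -> (size (avg M ^+ N) <= N * M)%N.
Proof.
move=> M0 N0; apply: (leq_trans (size_poly_exp_leq _ _)).
have : (size (avg M) <= M)%N by exact: size_poly.
by nia.
Qed.

(** One factor has its weights equal to [M%:R^-1], and the others average them. *)
Lemma avgX_le M N i : (0 < M)%N -> (0 < N)%N -> (avg M ^+ N)`_i <= M%:R^-1.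
Proof.
move=> M0; case: N => // N _; rewrite exprS coefMr.
have M0' : (0 : R) <= M%:R^-1 by rewrite invr_ge0 ler0n.
apply: (@le_trans _ _ (\sum_(j < i.+1) M%:R^-1 * (avg M ^+ N)`_j)).
  apply: ler_sum => j _; apply: ler_wpM2r; first exact: avgX_ge0.
  by rewrite coef_poly; case: ifP.
rewrite -mulr_sumr ler_piMr //.
set p := avg M ^+ N.
apply: (@le_trans _ _ (\sum_(j < i.+1 + size p) p`_j)).
  by rewrite big_split_ord /= lerDl sumr_ge0 // => j _; exact: avgX_ge0.
by rewrite sum_coef ?leq_addl // avgX1.
Qed.

Lemma ev_avg_mul M z : (0 < M)%N ->
  M%:R * ev (avg M) z * (1 - z) = 1 - z ^+ M :> R[i].
Proof.
move=> M0; rewrite (@evE _ _ M) ?size_poly //.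
have -> : M%:R * (\sum_(m < M) ((avg M)`_m)%:C * z ^+ m) = \sum_(m < M) z ^+ m.
  rewrite mulr_sumr; apply: eq_bigr => m _.
  rewrite coef_poly ltn_ord mulrA -(rmorph_nat (real_complex R)) -rmorphM.
  by rewrite mulfV ?pnatr_eq0 -?lt0n // rmorph1 mul1r.
by rewrite -opprB mulrN mulrC -subrX1 opprB.
Qed.

(** Decay away from the tuned frequency: the geometric sum has a bounded
    numerator, and [nsq_1Bcis_ge] bounds its denominator below. *)
Lemma nsq_ev_avg M x : (0 < M)%N -> `|x| <= 41 / 10 ->
  (M%:R * x) ^+ 2 * nsq (ev (avg M) (cis x)) <= 64.
Proof.
move=> M0 xle; have := ev_avg_mul (cis x) M0 => /(congr1 (@nsq _ R[i])).
rewrite !nsqM -cisMn -(rmorph_nat (real_complex R)) nsq_real => E.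
have := nsqB (1 : R[i]) (cis (x *+ M)).
rewrite -E nsq_cis (_ : nsq 1 = 1) => [|]; last by rewrite -cis0 nsq_cis.
have := nsq_1Bcis_ge xle.
set a := nsq (ev _ _); set b := nsq _.
have a0 : 0 <= a by exact: nsq_ge0.
have m0 : (0 : R) <= M%:R ^+ 2 by exact: sqr_ge0.
move=> h1 h2.
have : M%:R ^+ 2 * a * (x ^+ 2 / 16) <= M%:R ^+ 2 * a * b.
  by apply: ler_wpM2l => //; exact: mulr_ge0.
rewrite exprMn; set m := M%:R ^+ 2 in h2 *; nra.
Qed.

Lemma rnorm_sum (V : normedModType R[i]) (I : Type) (r : seq I) (x : I -> V) :
  rnorm (\sum_(i <- r) x i) <= \sum_(i <- r) rnorm (x i).
Proof.
elim: r => [|i r IH]; first by rewrite !big_nil /rnorm normr0.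
by rewrite !big_cons; apply: (le_trans (rnormD _ _)); rewrite lerD2l.
Qed.

Lemma nsq_ev_avg_le1 M x : (0 < M)%N -> nsq (ev (avg M) (cis x)) <= 1.
Proof.
move=> M0; rewrite (@evE _ _ M) ?size_poly //.
set z := \sum_(m < M) _.
have : rnorm z <= 1.
  apply: (le_trans (@rnorm_sum (R[i])^o _ _ _)).
  rewrite -[leRHS](avg1 M0) -(sum_coef (size_poly _ _)).
  apply: ler_sum => m _; rewrite -ler_sqr ?nnegrE ?rnorm_ge0 //; last first.
    by have := avgX_ge0 M 1 m; rewrite expr1.
  by rewrite -[_ ^+ 2]/(nsq _) nsqM nsq_real -cisMn nsq_cis mulr1.
by move=> h; rewrite /nsq expr_le1 // rnorm_ge0.
Qed.

Lemma nsq_ev_avgX_le1 M N x : (0 < M)%N -> nsq (ev (avg M ^+ N) (cis x)) <= 1.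
Proof.
by move=> M0; rewrite evX nsqX exprn_ile1 ?nsq_ge0 // nsq_ev_avg_le1.
Qed.

(** Cauchy-Schwarz for weights of sum 1. *)
Lemma sum_sqr_avgX M N Q : (0 < M)%N -> (0 < N)%N -> (size (avg M ^+ N) <= Q)%N ->
  1 <= Q%:R * \sum_(m < Q) (avg M ^+ N)`_m ^+ 2.
Proof.
move=> M0 N0 sQ; set p := avg M ^+ N.
have Q0 : (0 < Q)%N.
  case: Q sQ => // ; rewrite leqn0 size_poly_eq0 => /eqP h.
  by have := avgX1 N M0; rewrite h horner0 => /esym/eqP; rewrite oner_eq0.
have := sum_coef sQ; rewrite avgX1 // -/p => S.
have q0 : (0 : R) < Q%:R by rewrite ltr0n.
have : 0 <= \sum_(m < Q) (Q%:R * p`_m - 1) ^+ 2.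
  by apply: sumr_ge0 => m _; exact: sqr_ge0.
rewrite (eq_bigr (fun m : 'I_Q => Q%:R ^+ 2 * p`_m ^+ 2 - 2 * Q%:R * p`_m + 1)).
  rewrite !big_split /= sumrN -!mulr_sumr S sumr_const card_ord.
  set B := \sum_(_ < _) _; rewrite -[1 *+ Q]mulr_natr => h.
  have {}h : 0 <= Q%:R * (Q%:R * B - 1) by nra.
  by move: h; rewrite pmulr_rge0 // subr_ge0 mul1r.
by move=> m _; ring.
Qed.

End Averages.

(** * Observability of finite sums *)

Section Core.
Variables (R : realType) (K : normedModType R[i]).
Variable ip : {dot K for Num.conj}.
Hypothesis hK : hilbert_norm ip.
Variables (tau : nat -> R) (y : nat -> K).
Implicit Types (c : nat -> R[i]) (n : nat) (t s T : R) (P : pred nat) (w : nat -> R).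
Local Notation modesum := (modesum tau y).

Definition energy_sum w c n : R := \sum_(j < n) w j * nsq (c j).

Definition keep P c : nat -> R[i] := fun j => if P j then c j else 0.

Definition obs_int T c n : R := integ T (fun t => nsq (modesum c n t)).

(** The constant must not depend on the number [n] of terms, which is what
    survives in the limit of infinitely many modes. *)
Definition observable w P T (C : R) := forall c n,
  energy_sum w (keep P c) n <= C * obs_int T (keep P c) n.

Local Notation cont := (continuous_nsq_modesum hK).

Lemma obs_int_ge0 T c n : 0 <= obs_int T c n.
Proof. by apply: integ_ge0 => t; exact: nsq_ge0. Qed.

Lemma obs_int_shift T T' s c n : 0 <= s -> T + s <= T' ->
  integ T (fun t => nsq (modesum c n (t + s))) <= obs_int T' c n.
Proof.
by move=> s0 h; apply: (@integ_shift _ T T' s (fun t => nsq (modesum c n t))) => //;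
  [exact: cont|move=> t; exact: nsq_ge0].
Qed.

Lemma cont_shift c n s : continuous (fun t => nsq (modesum c n (t + s))).
Proof. by under eq_fun do rewrite modesumD; exact: cont. Qed.

Lemma obs_int_le T T' c n : T <= T' -> obs_int T c n <= obs_int T' c n.
Proof.
move=> h; have := @obs_int_shift T T' 0 c n (lexx _).
by rewrite addr0 => /(_ h); under eq_fun do rewrite addr0.
Qed.

Lemma energy_sum_ge0 w c n : (forall j, 0 <= w j) -> 0 <= energy_sum w c n.
Proof. by move=> w0; apply: sumr_ge0 => j _; rewrite mulr_ge0 ?nsq_ge0. Qed.

Lemma eq_energy_sum w c c' n :
  (forall j, (j < n)%N -> c j = c' j) -> energy_sum w c n = energy_sum w c' n.
Proof. by move=> h; apply: eq_bigr => j _; rewrite h. Qed.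

Lemma eq_obs_int T c c' n :
  (forall j, (j < n)%N -> c j = c' j) -> obs_int T c n = obs_int T c' n.
Proof. by move=> h; congr integ; apply/funext => t; rewrite (eq_modesum tau y t h). Qed.

Lemma modesumN c n t : modesum (fun j => - c j) n t = - modesum c n t.
Proof.
rewrite /modesum -sumrN; apply: eq_bigr => j _.
by rewrite mulNr scaleNr.
Qed.

Lemma modesum_add c c' n t : modesum (fun j => c j + c' j) n t = modesum c n t + modesum c' n t.
Proof.
rewrite /modesum -big_split; apply: eq_bigr => j _.
by rewrite mulrDl scalerDl.
Qed.

Lemma keep_split P c n t :
  modesum (keep P c) n t = modesum c n t - modesum (keep (predC P) c) n t.
Proof.
rewrite -modesumN -modesum_add; apply: eq_modesum => j _.
by rewrite /keep /=; case: (P j); rewrite ?oppr0 ?addr0 ?subrr.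
Qed.

Lemma obs_int_split T P c n :
  obs_int T (keep P c) n <=
    2 * obs_int T c n + 2 * obs_int T (keep (predC P) c) n.
Proof.
rewrite /obs_int -!integ_scale; [|exact: cont|exact: cont].
have c1 c' : continuous (fun t => 2 * nsq (modesum c' n t)).
  by move=> t; apply: cvgM; [exact: cvg_cst|exact: cont].
rewrite -[leRHS]RintegralD //; [|exact: continuous_integrable..].
apply: integ_le; [exact: cont|by move=> t; apply: cvgD; exact: c1|].
by move=> t; rewrite keep_split nsqB.
Qed.

Lemma observable_sub w P P' T C :
  (forall j, P' j -> P j) -> observable w P T C -> observable w P' T C.
Proof.
move=> PP h c n; have := h (keep P' c) n.
have E j : keep P (keep P' c) j = keep P' c j.
  by rewrite /keep; case: (boolP (P' j)) => [/PP ->|_] //; case: ifP.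
rewrite (@eq_energy_sum _ _ (keep P' c)); last by move=> j _; exact: E.
by rewrite (@eq_obs_int _ _ (keep P' c)); last by move=> j _; exact: E.
Qed.

(** The amplitudes outside the window enter as an error, measured by
    admissibility in the weight [w0]. *)
Lemma window_split w1 w0 P C T CT c n : 0 <= C ->
  observable w1 P T C ->
  (forall c n, obs_int T c n <= CT * energy_sum w0 c n) ->
  energy_sum w1 c n <= 2 * C * obs_int T c n +
    \sum_(j < n) (if P j then 0 else (w1 j + 2 * C * CT * w0 j) * nsq (c j)).
Proof.
move=> C0 hP hadm.
have -> : energy_sum w1 c n =
    energy_sum w1 (keep P c) n + energy_sum w1 (keep (predC P) c) n.
  rewrite /energy_sum -big_split; apply: eq_bigr => j _.
  by rewrite /keep /=; case: (P j); rewrite nsq0 mulr0 ?addr0 ?add0r.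
have -> : \sum_(j < n) (if P j then 0 else (w1 j + 2 * C * CT * w0 j) * nsq (c j)) =
    energy_sum w1 (keep (predC P) c) n +
    2 * C * (CT * energy_sum w0 (keep (predC P) c) n).
  rewrite /energy_sum !mulr_sumr -big_split; apply: eq_bigr => j _.
  by rewrite /keep /=; case: (P j); rewrite ?nsq0; ring.
have h1 := hP c n.
have h2 := obs_int_split T P c n.
have h3 := hadm (keep (predC P) c) n.
have h4 := ler_wpM2l C0 h2.
have h5 := ler_wpM2l C0 h3.
by lra.
Qed.

(** The weights of the filter have sum 1 and are at most [M%:R^-1], so that
    the factor [N * M] of Parseval's identity is reduced to [N]: the bound does
    not depend on the fineness of the sampling. *)
Lemma sum_filter_le M N (delta : R) c n t : (0 < M)%N -> (0 < N)%N ->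
  \sum_(i < N * M) nsq (modesum (fun j =>
     c j * ev (avg R M ^+ N) (cis (tau j * delta - ang R (N * M) i))) n t) <=
  N%:R * \sum_(m < N * M) (avg R M ^+ N)`_m * nsq (modesum c n (t + m%:R * delta)).
Proof.
move=> M0 N0; set Q := (N * M)%N; set p := avg R M ^+ N.
have Q0 : (0 < Q)%N by rewrite muln_gt0 N0.
have sQ : (size p <= Q)%N by exact: size_avgX.
under eq_bigr do rewrite (modesum_filter _ _ _ _ _ _ _ sQ).
rewrite (parseval hK (fun m => (p`_m)%:C *: modesum c n (t + m%:R * delta)) Q0).
rewrite natrM -mulrA; apply: ler_wpM2l => //.
rewrite mulr_sumr; apply: ler_sum => m _.
rewrite nsqZ nsq_real; set F := nsq _.
have -> : M%:R * (p`_m ^+ 2 * F) = (M%:R * p`_m) * (p`_m * F) by ring.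
have pF : 0 <= p`_m * F by apply: mulr_ge0; [exact: avgX_ge0|exact: nsq_ge0].
rewrite ler_piMl //.
have m0 : (M%:R : R) != 0 by rewrite pnatr_eq0 -lt0n.
rewrite -[leRHS](mulfV m0).
by apply: ler_wpM2l => //; exact: avgX_le.
Qed.

Lemma sum_double (V : nmodType) (f : nat -> V) m :
  \sum_(j < m.*2) f j = \sum_(v < m) (f v.*2 + f v.*2.+1).
Proof.
elim: m => [|m IH]; first by rewrite !big_ord0.
by rewrite doubleS !big_ord_recr /= IH addrA.
Qed.

(** Sequences of amplitudes can be completed by zeros so that the two frequencies
    of each mode are both listed. *)
Lemma sum_cut_double (V : nmodType) (f g : nat -> V) n :
  (forall j, (j < n)%N -> g j = f j) -> (forall j, (n <= j)%N -> g j = 0) ->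
  \sum_(j < n.*2) g j = \sum_(j < n) f j.
Proof.
move=> gf g0; rewrite [RHS](big_ord_widen n.*2); last by rewrite -addnn leq_addr.
rewrite [RHS]big_mkcond; apply: eq_bigr => j _.
by case: ltnP => [/gf|/g0].
Qed.

Lemma energy_sum_double w c n :
  energy_sum w (keep (fun j => (j < n)%N) c) n.*2 = energy_sum w c n.
Proof.
pose F c j := w j * nsq (c j).
apply: (@sum_cut_double _ (F c) (F (keep _ c))) => j jn; rewrite /F /keep.
  by rewrite jn.
by rewrite ltnNge jn nsq0 mulr0.
Qed.

Lemma obs_int_double T c n :
  obs_int T (keep (fun j => (j < n)%N) c) n.*2 = obs_int T c n.
Proof.
congr integ; apply/funext => t; congr nsq.
pose F c j : K := (c j * cis (tau j * t)) *: y j.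
apply: (@sum_cut_double _ (F c) (F (keep _ c))) => j jn; rewrite /F /keep.
  by rewrite jn.
by rewrite ltnNge jn mul0r scale0r.
Qed.

End Core.

Section ScalarFilter.
Variable R : realType.
Implicit Types (M N : nat) (sigma : R).

Lemma ev_avgX_dft M N Q (x theta : R) : (size (avg R M ^+ N) <= Q)%N ->
  ev (avg R M ^+ N) (cis (x - theta)) =
  \sum_(m < Q) cis (- (theta * m%:R)) * (((avg R M ^+ N)`_m)%:C * cis x ^+ m).
Proof.
move=> sQ; rewrite (evE _ sQ); apply: eq_bigr => m _.
rewrite -!cisMn mulrnBl cisD mulr_natr.
by ring.
Qed.

Lemma sum_nsq_ev M N Q (x : R) : (0 < Q)%N -> (size (avg R M ^+ N) <= Q)%N ->
  \sum_(i < Q) nsq (ev (avg R M ^+ N) (cis (x - ang R Q i))) =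
  Q%:R * \sum_(m < Q) (avg R M ^+ N)`_m ^+ 2.
Proof.
move=> Q0 sQ; under eq_bigr do rewrite (ev_avgX_dft _ _ sQ).
rewrite (parseval_scalar (fun m => ((avg R M ^+ N)`_m)%:C * cis x ^+ m) Q0).
congr (_ * _); apply: eq_bigr => m _.
by rewrite nsqM nsq_real -cisMn nsq_cis mulr1.
Qed.

(** No frequency is lost by all the filters. *)
Lemma sum_nsq_ev_ge1 M N (x : R) : (0 < M)%N -> (0 < N)%N ->
  1 <= \sum_(i < N * M) nsq (ev (avg R M ^+ N) (cis (x - ang R (N * M) i))).
Proof.
move=> M0 N0; rewrite sum_nsq_ev ?muln_gt0 ?N0 ?size_avgX //.
by apply: sum_sqr_avgX => //; exact: size_avgX.
Qed.

(** A single factor of the filters is summable over the windows, uniformly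
    in [M]. *)
Lemma sum_nsq_ev_avg M N (x : R) : (0 < M)%N -> (0 < N)%N ->
  \sum_(i < N * M) nsq (ev (avg R M) (cis (x - ang R (N * M) i))) <= N%:R.
Proof.
move=> M0 N0; have sQ : (size (avg R M ^+ 1) <= N * M)%N.
  by apply: (leq_trans (size_avgX R M0 (ltn0Sn 0))); rewrite leq_mul2r N0 orbT.
have := @sum_nsq_ev M 1 (N * M) x.
rewrite muln_gt0 N0 M0 => /(_ isT sQ).
rewrite expr1 => ->.
have := sum_coef sQ; rewrite avgX1 // expr1 => S.
apply: (@le_trans _ _ ((N * M)%:R * \sum_(m < N * M) M%:R^-1 * (avg R M)`_m)).
  apply: ler_wpM2l => //; apply: ler_sum => m _; rewrite expr2.
  have := @avgX_ge0 R M 1 m; have := @avgX_le R M 1 m M0 isT; rewrite expr1.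
  by move=> h1 h2; exact: ler_wpM2r.
rewrite -mulr_sumr S mulr1 natrM -mulrA mulfV ?mulr1 //.
by rewrite pnatr_eq0 -lt0n.
Qed.

End ScalarFilter.

(** * Gluing frequency windows *)

Section HighFrequency.
Variables (R : realType) (K : normedModType R[i]).
Variable ip : {dot K for Num.conj}.
Hypothesis hK : hilbert_norm ip.
Variables (tau : nat -> R) (y : nat -> K).
Implicit Types (c : nat -> R[i]) (n : nat) (t s T : R) (P : pred nat) (w : nat -> R).
Local Notation modesum := (modesum tau y).
Local Notation observable := (observable tau y).
Local Notation obs_int := (obs_int tau y).

(** Here [u] is a squared frequency and [a] the squared multiplier of one averaging
    factor, of order [u^-1].  One of the [p.+2] factors is kept, to sum the errors
    over the windows; the others beat the loss [u ^+ p] and leave a spare factor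
    [u^-1], hence a constant as small as desired for large [u]. *)
Lemma far_weight (p : nat) (a u B D v1 v0 : R) : 0 <= a -> 1 <= u -> a * u <= B ->
  0 <= D -> 0 <= v1 -> v0 <= v1 * u ^+ p ->
  2 * p.+2%:R * (1 + D) * B ^+ p.+1 <= u ->
  (v1 + D * v0) * a ^+ p.+2 <= v1 * a / (2 * p.+2%:R).
Proof.
move=> a0 u1 auB D0 v10 v0le Gu.
have u0 : 0 < u by lra.
have n0 : (0 : R) < 2 * p.+2%:R by rewrite mulr_gt0.
rewrite ler_pdivlMr // -(ler_pM2r u0).
have up1 : 1 <= u ^+ p by rewrite exprn_ege1.
have e1 : v1 + D * v0 <= (1 + D) * v1 * u ^+ p.
  have := ler_wpM2l D0 v0le; have := ler_wpM2l v10 up1; nra.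
have e2 : (a * u) ^+ p.+1 <= B ^+ p.+1.
  by rewrite lerXn2r // nnegrE ?mulr_ge0 ?(ltW u0) // (le_trans _ auB) // mulr_ge0 // ltW.
have ap0 : 0 <= a ^+ p.+2 by rewrite exprn_ge0.
have := ler_wpM2r ap0 e1 => e3.
apply: (@le_trans _ _ ((2 * p.+2%:R) * (1 + D) * (v1 * a) * (a * u) ^+ p.+1)).
  have -> : 2 * p.+2%:R * (1 + D) * (v1 * a) * (a * u) ^+ p.+1 =
     ((1 + D) * v1 * u ^+ p * a ^+ p.+2) * ((2 * p.+2%:R) * u).
    by rewrite exprMn !exprS; ring.
  rewrite -(mulrA _ (2 * _) u); apply: ler_wpM2r => //.
  by rewrite mulr_ge0 // ltW.
have va0 : 0 <= v1 * a by rewrite mulr_ge0.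
apply: (@le_trans _ _ ((2 * p.+2%:R) * (1 + D) * (v1 * a) * B ^+ p.+1)).
  apply: ler_wpM2l => //.
  by rewrite !mulr_ge0 // addr_ge0.
have -> : 2 * p.+2%:R * (1 + D) * (v1 * a) * B ^+ p.+1 =
  v1 * a * (2 * p.+2%:R * (1 + D) * B ^+ p.+1) by ring.
exact: ler_wpM2l.
Qed.

(** The step must keep all the angles within reach of [nsq_1Bcis_ge], hence
    depends on the largest frequency present; the constants of observability must
    not depend on it. *)
Lemma fine_step (eta X : R) : 0 < eta -> 0 <= X ->
  exists2 M, (0 < M)%N & X * (eta / M%:R) <= 1 / 10.
Proof.
move=> e0 X0; exists (Num.truncn (10 * (X * eta))).+1 => //.
have := truncnS_gt (10 * (X * eta)) => h.
have m0 : (0 : R) < (Num.truncn (10 * (X * eta))).+1%:R by rewrite ltr0n.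
by rewrite mulrA ler_pdivrMr //; lra.
Qed.

Lemma tau_bound n : exists2 X : R, 0 <= X & forall j, (j < n)%N -> `|tau j| <= X.
Proof.
exists (\sum_(j < n) `|tau j|); first by apply: sumr_ge0.
move=> j jn; rewrite (bigD1 (Ordinal jn)) //= lerDl.
by apply: sumr_ge0.
Qed.

(** Each signal filtered at [th i / delta] is concentrated in the window around
    this frequency, where observability holds on [[0, T]], up to an error that is
    at most half of the energy once summed over [i].  The filters use translations
    by at most [N%:R * eta = T' - T]. *)
Lemma high_frequency w1 w0 (p : nat) T T' (C c0 t1 CT : R) :
  T < T' -> 0 <= C -> 0 < c0 -> 0 <= CT ->
  (forall j, 0 <= w1 j) -> (forall j, 0 <= w0 j) ->
  (forall j, 1 <= `|tau j| -> w0 j <= w1 j * (tau j ^+ 2) ^+ p) ->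
  (forall s, exists P : pred nat, observable w1 P T C /\
     forall j, t1 <= `|tau j| -> ~~ P j -> c0 * `|tau j| <= `|tau j - s|) ->
  (forall c n, obs_int T c n <= CT * energy_sum w0 c n) ->
  exists t2 C', 0 <= C' /\ observable w1 (fun j => t2 <= `|tau j|) T' C'.
Proof.
move=> TT C0 c00 CT0 w10 w00 hw hwin hadm.
(* one factor sums the errors, one makes the constant small, [p] beat the loss *)
pose N := p.+2; pose eta := (T' - T) / N%:R.
have N0 : (0 : R) < N%:R by rewrite ltr0n.
have eta0 : 0 < eta by rewrite divr_gt0 // subr_gt0.
have etaE : eta * N%:R = T' - T by rewrite /eta mulfVK // gt_eqF.
clearbody eta.
pose B := 64 / (eta ^+ 2 * c0 ^+ 2).
pose D := 2 * C * CT.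
have D0 : 0 <= D by rewrite !mulr_ge0.
pose G := 2 * N%:R * (1 + D) * B ^+ p.+1.
have B0 : 0 <= B by rewrite divr_ge0 // mulr_ge0 // sqr_ge0.
have G0 : 0 <= G.
  by apply: mulr_ge0; [rewrite !mulr_ge0 // addr_ge0|exact: exprn_ge0].
exists (1 + `|t1| + G), (4 * C * N%:R); split; first by rewrite !mulr_ge0.
set H := (fun j => _ <= _).
move=> c' n; set c := keep H c'.
have [X X0 hX] := tau_bound n.
have [M M0 hM] := fine_step eta0 X0.
pose delta := eta / M%:R.
have m0 : (0 : R) < M%:R by rewrite ltr0n.
have delta0 : 0 < delta by rewrite divr_gt0.
pose Q := (N * M)%N.
have Q0 : (0 < Q)%N by rewrite muln_gt0 M0.
pose th i := ang R Q i.
pose q (i j : nat) : R[i] := ev (avg R M ^+ N) (cis (tau j * delta - th i)).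
pose a (i j : nat) : R := nsq (ev (avg R M) (cis (tau j * delta - th i))).
pose ci (i : nat) := fun j => c j * q i j.
have qa i j : nsq (q i j) = a i j ^+ N by rewrite /q evX nsqX.
have a0 i j : 0 <= a i j by exact: nsq_ge0.
(* the angles stay in the range where the chord controls the angle *)
have angle i j : (i < Q)%N -> (j < n)%N -> `|tau j * delta - th i| <= 41 / 10.
  move=> iQ jn; apply: (le_trans (ler_normB _ _)).
  have := @ang_le R Q i Q0 iQ; have := pihalf_lt2 R => pi4 h2.
  rewrite normrM (gtr0_norm delta0).
  have h3 : `|tau j| * delta <= X * delta by rewrite ler_pM2r // hX.
  by rewrite -/(th i) in h2; rewrite -/delta in hM; lra.
(* the filter is negligible outside of its window *)
have out (i j : nat) (P : pred nat) : (i < Q)%N -> (j < n)%N -> H j -> ~~ P j ->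
    (forall j, t1 <= `|tau j| -> ~~ P j -> c0 * `|tau j| <= `|tau j - th i / delta|) ->
    (w1 j + D * w0 j) * nsq (q i j) <= w1 j * a i j / (2 * N%:R).
  move=> iQ jn; rewrite /H => Hj nP hP.
  have t1j : t1 <= `|tau j| by have := ler_norm t1; lra.
  have n1 := normr_ge0 t1.
  have tj1 : 1 <= `|tau j| by lra.
  have u1 : 1 <= tau j ^+ 2 by rewrite -real_normK ?num_real // exprn_ege1.
  have uG : G <= tau j ^+ 2 by rewrite -real_normK ?num_real // expr2; nra.
  rewrite qa; apply: (@far_weight p (a i j) (tau j ^+ 2) B D) => //; last exact: hw.
  have := nsq_ev_avg M0 (angle i j iQ jn); rewrite -/(a i j).
  have -> : M%:R * (tau j * delta - th i) = eta * (tau j - th i / delta).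
    by rewrite /delta; field; rewrite ?gt_eqF.
  move: (hP j t1j nP) => h1 h2.
  have h3 : (c0 * `|tau j|) ^+ 2 <= (tau j - th i / delta) ^+ 2.
    rewrite -[leRHS]real_normK ?num_real // lerXn2r // nnegrE ?normr_ge0 //.
    by rewrite mulr_ge0 // ltW.
  rewrite exprMn real_normK ?num_real // in h3.
  rewrite /B ler_pdivlMr ?mulr_gt0 ?exprn_gt0 //.
  apply: le_trans h2; rewrite exprMn.
  have e2 : 0 <= eta ^+ 2 * a i j by rewrite mulr_ge0 ?sqr_ge0.
  by have := ler_wpM2l e2 h3; lra.
have key (i : nat) : (i < Q)%N ->
  energy_sum w1 (ci i) n <= 2 * C * obs_int T (ci i) n +
    \sum_(j < n) nsq (c j) * w1 j * a i j / (2 * N%:R).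
  move=> iQ; have [P [hP1 hP2]] := hwin (th i / delta).
  apply: (le_trans (window_split hK (ci i) n C0 hP1 hadm)); rewrite lerD2l.
  apply: ler_sum => j _.
  have r0 : 0 <= nsq (c j) * w1 j * a i j / (2 * N%:R).
    apply: divr_ge0; last by rewrite mulr_ge0.
    by apply: mulr_ge0 => //; apply: mulr_ge0 => //; exact: nsq_ge0.
  case: ifPn => // nP.
  rewrite /ci nsqM /c /keep; case: ifPn => [Hj|_]; last first.
    by rewrite nsq0 mul0r mulr0 !mul0r.
  have := ler_wpM2l (nsq_ge0 (c' j)) (out i j P iQ (ltn_ord j) Hj nP hP2).
  by rewrite -/D; lra.
have E1 : energy_sum w1 c n <= \sum_(i < Q) energy_sum w1 (ci i) n.
  rewrite exchange_big; apply: ler_sum => j _ /=.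
  rewrite -mulr_sumr; apply: ler_wpM2l => //.
  under eq_bigr do rewrite nsqM.
  rewrite -mulr_sumr -[leLHS]mulr1; apply: ler_wpM2l; first exact: nsq_ge0.
  exact: sum_nsq_ev_ge1.
have E2 : \sum_(i < Q) \sum_(j < n) nsq (c j) * w1 j * a i j / (2 * N%:R) <=
    energy_sum w1 c n / 2.
  rewrite exchange_big /energy_sum mulr_suml; apply: ler_sum => j _ /=.
  rewrite -mulr_suml -mulr_sumr.
  have := @sum_nsq_ev_avg R M N (tau j * delta) M0 isT; rewrite -/Q => S.
  have w : 0 <= nsq (c j) * w1 j by apply: mulr_ge0 => //; exact: nsq_ge0.
  have := ler_wpM2l w S => S'.
  rewrite ler_pdivrMr ?mulr_gt0 //.
  by rewrite /a; lra.
have E3 : \sum_(i < Q) obs_int T (ci i) n <= N%:R * obs_int T' c n.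
  have cc i : continuous (fun t => nsq (modesum (ci i) n t))
    by exact: continuous_nsq_modesum hK _ _ _ _.
  pose Gi (i : 'I_Q) t := nsq (modesum (ci i) n t).
  have -> : \sum_(i < Q) obs_int T (ci i) n = integ T (fun t => \sum_(i < Q) 1 * Gi i t).
    rewrite (@integ_sum _ _ _ _ _ Gi); last by move=> i; exact: cc.
    by apply: eq_bigr => i _; rewrite mul1r.
  pose F (m : 'I_Q) t := nsq (modesum c n (t + m%:R * delta)).
  have cF m : continuous (F m) by exact: cont_shift hK _ _ _ _ _.
  apply: (@le_trans _ _ (integ T (fun t => \sum_(m < Q) (N%:R * (avg R M ^+ N)`_m) * F m t))).
    apply: integ_le.
    - by apply: continuous_sumR => i t; apply: cvgM; [exact: cvg_cst|exact: cc].
    - by apply: continuous_sumR => i t; apply: cvgM; [exact: cvg_cst|exact: cF].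
    - move=> t; under eq_bigr do rewrite mul1r.
      have := sum_filter_le hK tau y delta c n t M0 (isT : (0 < N)%N).
      by rewrite mulr_sumr; under [X in _ <= X -> _]eq_bigr do rewrite mulrA.
  rewrite (@integ_sum _ _ _ _ _ F); last by move=> m; exact: cF.
  apply: (@le_trans _ _ (\sum_(m < Q) (N%:R * (avg R M ^+ N)`_m) * obs_int T' c n)).
    apply: ler_sum => m _; apply: ler_wpM2l; first by rewrite mulr_ge0 ?avgX_ge0.
    apply: obs_int_shift => //; first by rewrite mulr_ge0 // ltW.
    have : (m%:R : R) <= Q%:R by rewrite ler_nat ltnW.
    rewrite natrM => mQ.
    have : m%:R * delta <= N%:R * M%:R * delta by rewrite ler_pM2r.
    have -> : N%:R * M%:R * delta = T' - T.
      by rewrite /delta -etaE; field; rewrite !gt_eqF.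
    by lra.
  rewrite -mulr_suml -mulr_sumr sum_coef ?size_avgX // avgX1 // mulr1.
  exact: lexx.
have E4 : \sum_(i < Q) energy_sum w1 (ci i) n <=
    2 * C * (N%:R * obs_int T' c n) + energy_sum w1 c n / 2.
  apply: (@le_trans _ _ (\sum_(i < Q) (2 * C * obs_int T (ci i) n +
    \sum_(j < n) nsq (c j) * w1 j * a i j / (2 * N%:R)))).
    by apply: ler_sum => i _; exact: key.
  rewrite big_split /= -mulr_sumr lerD //.
  by apply: ler_wpM2l => //; rewrite mulr_ge0.
by lra.
Qed.

End HighFrequency.

(** * Adding a frequency *)

Section RemoveFrequency.
Variables (R : realType) (K : normedModType R[i]).
Variable ip : {dot K for Num.conj}.
Hypothesis hK : hilbert_norm ip.
Variables (tau : nat -> R) (y : nat -> K).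
Implicit Types (c : nat -> R[i]) (n : nat) (t s T : R) (P : pred nat) (w : nat -> R).
Local Notation modesum := (modesum tau y).
Local Notation observable := (observable tau y).
Local Notation obs_int := (obs_int tau y).

Lemma ipBl (x x' z : K) : ip (x - x') z = ip x z - ip x' z.
Proof. exact: linearBl. Qed.

Lemma ipBr (x z z' : K) : ip x (z - z') = ip x z - ip x z'.
Proof. exact: linearBr. Qed.

Lemma ipZl a (x z : K) : ip (a *: x) z = a * ip x z.
Proof. by rewrite linearZl_LR. Qed.

Lemma ipZr a (x z : K) : ip x (a *: z) = a^*%R * ip x z.
Proof. by rewrite linearZr_LR. Qed.

Lemma cauchy_schwarz (x z : K) : nsq (ip x z) <= nsq x * nsq z.
Proof.
have [->|z0] := eqVneq z 0; first by rewrite linear0r !nsq0 mulr0.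
have u0 : 0 < nsq z by rewrite lt0r nsq_eq0 z0 nsq_ge0.
have : 0 <= nsq ((nsq z)%:C *: x - ip x z *: z) by exact: nsq_ge0.
have -> : nsq ((nsq z)%:C *: x - ip x z *: z) =
    nsq z * (nsq x * nsq z - nsq (ip x z)).
  have key (u v w : R) : (u * (v * u - w))%:C = u%:C * (v%:C * u%:C - w%:C).
    by rewrite rmorphM rmorphB rmorphM.
  apply: (@complexI R); rewrite [LHS](nsq_ip hK) ipBl !ipBr.
  rewrite !ipZl !ipZr.
  have zx : ip z x = (ip x z)^*%R by rewrite (hermC ip z x) expr0 mul1r.
  have zr : ((nsq z)%:C)^*%R = (nsq z)%:C.
    by rewrite nsqK rmorphXn /= conj_Creal ?normr_real.
  rewrite zx zr -!(nsq_ip hK) key (nsq_mulJ (ip x z)).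
  by ring.
by rewrite pmulr_rge0 // subr_ge0.
Qed.

(** The coefficients are recovered from the scalar products with the family by
    inverting its Gram matrix, completed by the identity outside [P]. *)
Lemma gram_bound n P :
  (forall c, \sum_(j < n | P j) c j *: y j = 0 ->
     forall j, (j < n)%N -> P j -> c j = 0) ->
  exists G, 0 <= G /\ forall c j, (j < n)%N -> P j ->
    nsq (c j) <= G * nsq (\sum_(i < n | P i) c i *: y i).
Proof.
move=> inj.
pose G : 'M[R[i]]_n := \matrix_(j, i)
  if P i then (if P j then ip (y j) (y i) else 0) else (j == i)%:R.
have GE (a : 'rV_n) (i : 'I_n) : (a *m G) 0 i =
    if P i then ip (\sum_(j < n | P j) a 0 j *: y j) (y i) else a 0 i.
  rewrite mxE; case: ifPn => Pi.
    rewrite linear_sumlz [RHS]big_mkcond; apply: eq_bigr => j _.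
    by rewrite mxE Pi; case: ifP => _; rewrite ?mulr0 // linearZl_LR.
  rewrite (bigD1 i) //= big1 ?addr0 => [|j ji]; rewrite mxE (negbTE Pi).
    by rewrite eqxx mulr1.
  by rewrite (negbTE ji) mulr0.
have Gu : G \in unitmx.
  rewrite -row_free_unit -kermx_eq0; apply/rowV0P => a /sub_kermxP aG.
  pose c j := if insub j is Some i then a 0 i else 0.
  have cE (i : 'I_n) : c i = a 0 i by rewrite /c valK.
  have x0 : \sum_(j < n | P j) c j *: y j = 0.
    under eq_bigr do rewrite cE.
    set x := \sum_(_ < _ | _) _.
    apply/eqP; rewrite -nsq_eq0 -(inj_eq (@complexI R)) (nsq_ip hK) {2}/x.
    rewrite linear_sumr big1 // => i Pi; rewrite linearZr_LR /=.
    by have := GE a i; rewrite aG mxE Pi => <-; rewrite mulr0.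
  apply/rowP => i; rewrite mxE; have := GE a i; rewrite aG mxE.
  by case: ifPn => Pi // _; rewrite -cE; apply: inj.
pose G1 := \sum_(j < n) \sum_(i < n) rnorm (y i) * rnorm (invmx G i j).
have t0 (i j : 'I_n) : 0 <= rnorm (y i) * rnorm (invmx G i j).
  by rewrite mulr_ge0 // rnorm_ge0.
have G10 : 0 <= G1 by apply: sumr_ge0 => j _; apply: sumr_ge0.
exists (G1 ^+ 2); split; first exact: sqr_ge0.
move=> c j jn Pj; pose j' := Ordinal jn.
set x := \sum_(_ < _ | _) _.
pose a : 'rV_n := \row_i (if P i then c i else 0).
have xE : \sum_(i < n | P i) a 0 i *: y i = x.
  by apply: eq_bigr => i Pi; rewrite mxE Pi.
have aE : c j = \sum_(i < n) (a *m G) 0 i * invmx G i j'.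
  have : a 0 j' = c j by rewrite mxE Pj.
  by move=> <-; rewrite -[in LHS](mulmxK Gu a) mxE.
rewrite /nsq -exprMn lerXn2r ?nnegrE ?mulr_ge0 ?rnorm_ge0 //.
rewrite aE; apply: (le_trans (@rnorm_sum R (R[i])^o _ _ _)).
apply: (@le_trans _ _ (\sum_(i < n) (rnorm (y i) * rnorm (invmx G i j')) * rnorm x)).
  apply: ler_sum => i _; rewrite GE xE.
  have -> : rnorm ((if P i then ip x (y i) else a 0 i) * invmx G i j') =
     rnorm (if P i then ip x (y i) else a 0 i) * rnorm (invmx G i j').
    by apply: (@complexI R); rewrite rmorphM /= !rnormK normrM.
  case: ifPn => Pi.
    rewrite mulrAC; apply: ler_wpM2r; first exact: rnorm_ge0.
    have := cauchy_schwarz x (y i).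
    rewrite /nsq -exprMn ler_sqr ?nnegrE ?mulr_ge0 ?rnorm_ge0 //.
    by rewrite mulrC.
  rewrite mxE (negbTE Pi) {1}/rnorm normr0 mul0r mulr_ge0 ?rnorm_ge0 //.
rewrite -mulr_suml; apply: ler_wpM2r; first exact: rnorm_ge0.
rewrite /G1 [leRHS](bigD1 j') //= lerDl.
by apply: sumr_ge0 => k _; apply: sumr_ge0.
Qed.

(** By positivity of the variance of the norms. *)
Lemma nsq_convex Q (p : nat -> R) (x : nat -> K) : (forall m, 0 <= p m) ->
  \sum_(m < Q) p m = 1 ->
  nsq (\sum_(m < Q) (p m)%:C *: x m) <= \sum_(m < Q) p m * nsq (x m).
Proof.
move=> p0 p1.
set S := \sum_(m < Q) p m * rnorm (x m).
have h1 : rnorm (\sum_(m < Q) (p m)%:C *: x m) <= S.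
  apply: (le_trans (rnorm_sum _ _)); apply: ler_sum => m _.
  rewrite le_eqVlt; apply/orP; left; apply/eqP.
  apply: (@complexI R); rewrite rmorphM /= !rnormK normrZ ger0_norm ?ler0c //.
have h2 : 0 <= \sum_(m < Q) p m * (rnorm (x m) - S) ^+ 2.
  by apply: sumr_ge0 => m _; rewrite mulr_ge0 // sqr_ge0.
have h3 : \sum_(m < Q) p m * (rnorm (x m) - S) ^+ 2 =
    \sum_(m < Q) p m * nsq (x m) - S ^+ 2.
  transitivity (\sum_(m < Q) (p m * nsq (x m) - 2 * S * (p m * rnorm (x m)) + S ^+ 2 * p m)).
    by apply: eq_bigr => m _; rewrite /nsq; ring.
  by rewrite !big_split /= sumrN -!mulr_sumr p1 -/S; ring.
have h4 : nsq (\sum_(m < Q) (p m)%:C *: x m) <= S ^+ 2.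
  rewrite /nsq lerXn2r ?nnegrE ?rnorm_ge0 //.
  by apply: sumr_ge0 => m _; rewrite mulr_ge0 // rnorm_ge0.
by lra.
Qed.

Hypothesis tau_infty : forall X : R, exists n, forall j, (n <= j)%N -> X < `|tau j|.

Lemma bounded_below_frequency (X : R) (f : nat -> R) :
  exists2 W, 0 <= W & forall j, `|tau j| <= X -> f j <= W.
Proof.
have [n hn] := tau_infty X.
exists (\sum_(j < n) `|f j|); first exact: sumr_ge0.
move=> j jX; have jn : (j < n)%N.
  by rewrite ltnNge; apply/negP => /hn; rewrite ltNge jX.
apply: (le_trans (ler_norm _)); rewrite (bigD1 (Ordinal jn)) //= lerDl.
exact: sumr_ge0.
Qed.

Lemma frequency_gap z : exists2 g, 0 < g & forall j, tau j != z -> g <= `|tau j - z|.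
Proof.
have [W W0 hW] := bounded_below_frequency (`|z| + 1) (fun j => `|tau j - z|^-1).
exists (W + 1)^-1; first by rewrite invr_gt0; lra.
move=> j jz; have d0 : 0 < `|tau j - z| by rewrite normr_gt0 subr_eq0.
have W10 : 0 < W + 1 by lra.
have [/hW h|h] := leP `|tau j| (`|z| + 1).
  by rewrite -lef_pV2 ?posrE ?invr_gt0 // invrK; lra.
apply: (@le_trans _ _ 1); first by rewrite invf_le1 //; lra.
by have := lerB_dist (tau j) z; lra.
Qed.

(** At high frequency, [p] of the factors of the filter beat the loss between the
    weights; the remaining frequencies are finitely many. *)
Lemma filter_weight w1 w0 (p : nat) z (eta : R) :
  0 < eta -> (forall j, 0 < w1 j) -> (forall j, 0 <= w0 j) ->
  (forall j, 1 <= `|tau j| -> w0 j <= w1 j * (tau j ^+ 2) ^+ p) ->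
  exists2 W, 0 <= W & forall M j, (0 < M)%N ->
    `|(tau j - z) * (eta / M%:R)| <= 41 / 10 ->
    w0 j * nsq (ev (avg R M ^+ p.+1) (cis ((tau j - z) * (eta / M%:R)))) <= W * w1 j.
Proof.
move=> eta0 w10 w00 hw.
have [W W0 hW] := bounded_below_frequency (1 + 2 * `|z|) (fun j => w0 j / w1 j).
pose B := 256 / eta ^+ 2.
have e2 : 0 < eta ^+ 2 by rewrite exprn_gt0.
have B0 : 0 <= B by rewrite divr_ge0 // ltW.
have Bp : 0 <= B ^+ p by rewrite exprn_ge0.
exists (W + B ^+ p); first by rewrite addr_ge0.
move=> M j M0 hang.
set a1 := nsq _.
have a1le : a1 <= 1 by exact: nsq_ev_avgX_le1.
have [/hW h|h] := leP `|tau j| (1 + 2 * `|z|).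
  rewrite ler_pdivrMr // in h.
  have := ler_wpM2l (w00 j) a1le; have := w10 j; nra.
have z0 := normr_ge0 z.
have m0 : (0 : R) < M%:R by rewrite ltr0n.
rewrite /a1 evX nsqX.
have := nsq_ev_avg M0 hang; have := nsq_ev_avg_le1 ((tau j - z) * (eta / M%:R)) M0.
set a := nsq _ => ale h2.
have a0 : 0 <= a by exact: nsq_ge0.
have := lerB_dist (tau j) z => h3.
have h4 : (`|tau j| / 2) ^+ 2 <= (tau j - z) ^+ 2.
  rewrite -[leRHS]real_normK ?num_real // lerXn2r ?nnegrE ?divr_ge0 //.
  by lra.
rewrite expr_div_n real_normK ?num_real // in h4.
have h5 : a * tau j ^+ 2 <= B.
  rewrite /B ler_pdivlMr //.
  move: h2; have -> : M%:R * ((tau j - z) * (eta / M%:R)) = eta * (tau j - z).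
    by field; rewrite gt_eqF.
  rewrite exprMn => h2.
  have := ler_wpM2l (mulr_ge0 (ltW e2) a0) h4.
  by lra.
have h6 : (a * tau j ^+ 2) ^+ p <= B ^+ p.
  apply: lerXn2r => //; rewrite nnegrE; apply: mulr_ge0 => //; exact: sqr_ge0.
have h7 : w0 j <= w1 j * (tau j ^+ 2) ^+ p by apply: hw; lra.
have ap0 : 0 <= a ^+ p by rewrite exprn_ge0.
apply: (@le_trans _ _ (w0 j * a ^+ p)).
  by apply: ler_wpM2l => //; rewrite exprS ler_piMl.
have := ler_wpM2r ap0 h7; rewrite -mulrA -exprMn (mulrC _ a) => h8.
have := ler_wpM2l (ltW (w10 j)) h6 => h9.
have := w10 j; nra.
Qed.

(** Subtracting from a signal its translate, rotated at the frequency [z],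
    kills that frequency. *)
Lemma observable_difference w1 (C T1 T' s z : R) P c n :
  0 <= C -> observable w1 (fun j => P j && (tau j != z)) T1 C ->
  (forall j, ~~ P j -> c j = 0) -> 0 <= s -> T1 + s <= T' ->
  \sum_(j < n) w1 j * nsq (c j) * nsq (1 - cis ((tau j - z) * s)) <=
    4 * C * obs_int T' c n.
Proof.
move=> C0 hC cP s0 se; pose d j := c j * (1 - cis ((tau j - z) * s)).
have dE j : keep (fun j => P j && (tau j != z)) d j = d j.
  rewrite /keep /d; case: ifPn => //; rewrite negb_and negbK => /orP[/cP ->|/eqP ->].
    by rewrite mul0r.
  by rewrite subrr mul0r cis0 subrr mulr0.
have := hC d n.
rewrite (@eq_energy_sum _ _ _ d); last by move=> j _; exact: dE.
rewrite (@eq_obs_int _ _ _ _ _ _ d); last by move=> j _; exact: dE.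
have -> : energy_sum w1 d n =
    \sum_(j < n) w1 j * nsq (c j) * nsq (1 - cis ((tau j - z) * s)).
  by apply: eq_bigr => j _; rewrite /d nsqM mulrA.
move=> h; apply: (le_trans h).
suff : obs_int T1 d n <= 4 * obs_int T' c n by move=> /(ler_wpM2l C0); lra.
have E t : modesum d n t = modesum c n t - cis (- (z * s)) *: modesum c n (t + s).
  rewrite modesumD /modesum scaler_sumr -sumrB; apply: eq_bigr => j _.
  rewrite scalerA -scalerBl /d; congr (_ *: _).
  by rewrite (_ : (tau j - z) * s = tau j * s + - (z * s)) ?cisD; ring.
pose F := fun t => nsq (modesum c n t).
pose Fs := fun t => nsq (modesum c n (t + s)).
have cF : continuous F by exact: (continuous_nsq_modesum hK).
have cFs : continuous Fs by exact: (cont_shift hK).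
have c2F : continuous (fun t => 2 * F t).
  by move=> t; apply: cvgM; [exact: cvg_cst|exact: cF].
have c2Fs : continuous (fun t => 2 * Fs t).
  by move=> t; apply: cvgM; [exact: cvg_cst|exact: cFs].
apply: (@le_trans _ _ (integ T1 (fun t => 2 * F t + 2 * Fs t))).
  apply: integ_le; first exact: (continuous_nsq_modesum hK).
    by move=> t; apply: cvgD; [exact: c2F|exact: c2Fs].
  move=> t; rewrite E; apply: (le_trans (nsqB _ _)).
  by rewrite nsqZ nsq_cis mul1r.
have -> : integ T1 (fun t => 2 * F t + 2 * Fs t) = 2 * integ T1 F + 2 * integ T1 Fs.
  by rewrite -!integ_scale // /integ RintegralD //; exact: continuous_integrable.
have T1T' : T1 <= T' by lra.
have := obs_int_le hK tau y c n T1T'.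
have := @obs_int_shift _ _ _ hK tau y T1 T' s c n s0 se.
by rewrite -/Fs -[obs_int T1 c n]/(integ T1 F); lra.
Qed.

Lemma chord_near (g s x : R) : 0 < g -> 0 < s -> g <= `|x| -> `|x| * s <= 1 ->
  (g * s) ^+ 2 / 16 <= nsq (1 - cis (x * s)).
Proof.
move=> g0 s0 gx xs.
apply: (le_trans _ (nsq_1Bcis_le1 _)); last by rewrite normrM (gtr0_norm s0).
rewrite ler_pM2r ?invr_gt0 // !exprMn ler_pM2r ?exprn_gt0 //.
by rewrite -[leRHS]real_normK ?num_real // lerXn2r ?nnegrE // ltW.
Qed.

Lemma sum_inv_cst M (x : R) : (0 < M)%N -> \sum_(m < M) M%:R^-1 * x = x.
Proof.
move=> M0; rewrite sumr_const card_ord -[_ *+ M]mulr_natr mulrAC mulVf ?mul1r //.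
by rewrite pnatr_eq0 -lt0n.
Qed.

(** The average of the squared chords is [2 - 2 * complex.Re a], with [a] the
    value of the averaging filter, which is small far from the tuned frequency. *)
Lemma chord_far M (eta x : R) : 0 < eta -> (0 < M)%N -> 16 <= `|x| * eta ->
  `|x * (eta / M%:R)| <= 41 / 10 ->
  1 <= \sum_(m < M) M%:R^-1 * nsq (1 - cis (x * (m%:R * (eta / M%:R)))).
Proof.
move=> eta0 M0 big ang.
have m0 : (0 : R) < M%:R by rewrite ltr0n.
have := nsq_ev_avg M0 ang; set a := ev _ _.
have -> : M%:R * (x * (eta / M%:R)) = x * eta by field; rewrite gt_eqF.
move=> h.
have h2 : 16 ^+ 2 <= (x * eta) ^+ 2.
  rewrite -[leRHS]real_normK ?num_real // normrM (gtr0_norm eta0).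
  by rewrite lerXn2r ?nnegrE // (le_trans _ big).
have h3 : nsq a <= 4^-1 by have := nsq_ge0 a; nra.
have h4 : complex.Re a <= 2^-1.
  by rewrite nsqE in h3; have := sqr_ge0 (complex.Im a); nra.
have -> : \sum_(m < M) M%:R^-1 * nsq (1 - cis (x * (m%:R * (eta / M%:R)))) =
    2 - 2 * complex.Re a.
  transitivity (\sum_(m < M) (M%:R^-1 * 2 -
      2 * complex.Re (((avg R M)`_m)%:C * cis (x * (eta / M%:R)) ^+ m))).
    apply: eq_bigr => m _.
    rewrite nsq_1Bcis coef_poly ltn_ord -cisMn -[X in cis X]mulr_natr.
    rewrite (_ : x * (eta / M%:R) * m%:R = x * (m%:R * (eta / M%:R))); last by ring.
    by rewrite /cis /= mul0r subr0; ring.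
  rewrite big_split /= sumrN (sum_inv_cst 2 M0) -mulr_sumr.
  by rewrite /a (@evE _ _ M) ?size_poly // raddf_sum.
by lra.
Qed.

(** The factor [nsq (1 - cis ((tau j - z) * s))] vanishes for some shifts [s]: a
    small [s] suits the frequencies close to [z], which stay at a positive
    distance of [z], and an average over [s] suits the others. *)
Lemma observable_away w1 (C T1 T' z : R) P :
  0 <= C -> T1 < T' -> (forall j, 0 <= w1 j) ->
  observable w1 (fun j => P j && (tau j != z)) T1 C ->
  exists2 C1, 0 <= C1 & forall c n, (forall j, ~~ P j -> c j = 0) ->
    energy_sum w1 (keep (fun j => tau j != z) c) n <= C1 * obs_int T' c n.
Proof.
move=> C0 TT w10 hC.
pose eta := T' - T1; have eta0 : 0 < eta by rewrite /eta; lra.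
have [g g0 hg] := frequency_gap z.
(* frequencies at distance more than [s1^-1 = 16 / eta] of [z] are within reach of
   [chord_far], the others of [chord_near] *)
pose s1 := eta / 16.
have s10 : 0 < s1 by rewrite /s1 divr_gt0.
pose k1 := (g * s1) ^+ 2 / 16.
have k10 : 0 < k1 by rewrite divr_gt0 // exprn_gt0 // mulr_gt0.
exists (4 * C / k1 + 4 * C).
  by rewrite addr_ge0 ?divr_ge0 ?mulr_ge0 // ltW.
move=> c n cP; set J := obs_int T' c n.
have [X X0 hX] := @tau_bound _ (fun j => tau j - z) n.
have [M M0 hM] := fine_step eta0 X0.
have m0 : (0 : R) < M%:R by rewrite ltr0n.
pose delta := eta / M%:R.
have delta0 : 0 < delta by rewrite divr_gt0.
have s1T : T1 + s1 <= T' by rewrite /s1 /eta in eta0 *; lra.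
have near := observable_difference n C0 hC cP (ltW s10) s1T.
have far : \sum_(j < n) w1 j * nsq (c j) *
    (\sum_(m < M) M%:R^-1 * nsq (1 - cis ((tau j - z) * (m%:R * delta)))) <= 4 * C * J.
  under eq_bigr do rewrite mulr_sumr.
  rewrite exchange_big /= -[leRHS](sum_inv_cst _ M0).
  apply: ler_sum => m _.
  have mi : 0 <= (M%:R : R)^-1 by rewrite invr_ge0 ltW.
  have md : m%:R * delta <= eta.
    by rewrite /delta mulrA ler_pdivrMr // mulrC ler_pM2l // ler_nat ltnW.
  have mdT : T1 + m%:R * delta <= T' by rewrite /eta in md; lra.
  have md0 : 0 <= m%:R * delta by rewrite mulr_ge0 // ltW.
  have := ler_wpM2l mi (observable_difference n C0 hC cP md0 mdT).
  rewrite mulr_sumr; apply: le_trans; apply: ler_sum => j _.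
  by rewrite mulrCA.
have split : energy_sum w1 (keep (fun j => tau j != z) c) n <=
  \sum_(j < n) (w1 j * nsq (c j) * nsq (1 - cis ((tau j - z) * s1)) / k1 +
    w1 j * nsq (c j) *
    (\sum_(m < M) M%:R^-1 * nsq (1 - cis ((tau j - z) * (m%:R * delta))))).
  apply: ler_sum => j _; rewrite /keep.
  have wc : 0 <= w1 j * nsq (c j) by apply: mulr_ge0 => //; exact: nsq_ge0.
  have a0 : 0 <= nsq (1 - cis ((tau j - z) * s1)) by exact: nsq_ge0.
  set S := \sum_(m < M) _.
  have S0 : 0 <= S.
    apply: sumr_ge0 => m _; apply: mulr_ge0; last exact: nsq_ge0.
    by rewrite invr_ge0 ltW.
  have t1 : 0 <= w1 j * nsq (c j) * nsq (1 - cis ((tau j - z) * s1)) / k1.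
    by apply: divr_ge0; [apply: mulr_ge0|exact: ltW].
  have t2 : 0 <= w1 j * nsq (c j) * S by apply: mulr_ge0.
  case: ifPn => jz; last by rewrite nsq0 mulr0 addr_ge0.
  have gj := hg j jz.
  have [small|big] := leP (`|tau j - z| * s1) 1.
    suff h : 1 <= nsq (1 - cis ((tau j - z) * s1)) / k1.
      by have := ler_wpM2l wc h; lra.
    by rewrite ler_pdivlMr // mul1r; exact: chord_near.
  suff h : 1 <= S.
    by have := ler_wpM2l wc h; lra.
  apply: chord_far => //; first by move: big; rewrite /s1; lra.
  rewrite normrM (gtr0_norm delta0).
  have h3 : `|tau j - z| * delta <= X * delta by rewrite ler_pM2r // hX.
  by rewrite -/delta in hM; lra.
apply: (le_trans split); rewrite big_split /= -mulr_suml mulrDl lerD //.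
rewrite mulrAC ler_pM2r ?invr_gt0 //.
Qed.

(** The filter tuned to [z] reproduces the component at [z] exactly, and damps the
    rest enough to be controlled in the weaker weight [w1]. *)
Lemma observable_component w1 w0 (p : nat) (T T' CT z : R) :
  0 < T -> T < T' -> 0 <= CT -> (forall j, 0 < w1 j) -> (forall j, 0 <= w0 j) ->
  (forall j, 1 <= `|tau j| -> w0 j <= w1 j * (tau j ^+ 2) ^+ p) ->
  (forall c n, obs_int T c n <= CT * energy_sum w0 c n) ->
  exists2 W, 0 <= W & forall c n,
    nsq (\sum_(j < n | tau j == z) c j *: y j) <=
    W * (obs_int T' c n + energy_sum w1 (keep (fun j => tau j != z) c) n).
Proof.
move=> T0 TT CT0 w10 w00 hw hadm.
have N0 : (0 : R) < p.+1%:R by rewrite ltr0n.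
pose eta := (T' - T) / p.+1%:R.
have eta0 : 0 < eta by rewrite divr_gt0 // subr_gt0.
have etaE : eta * p.+1%:R = T' - T by rewrite /eta mulfVK // gt_eqF.
clearbody eta.
have [W W0 hW] := filter_weight z eta0 w10 w00 hw.
exists ((2 + 2 * CT * W) / T); first by rewrite divr_ge0 ?addr_ge0 ?mulr_ge0 // ltW.
move=> c n; set x := \sum_(j < n | _) _.
have [X X0 hX] := @tau_bound _ (fun j => tau j - z) n.
have [M M0 hM] := fine_step eta0 X0.
have m0 : (0 : R) < M%:R by rewrite ltr0n.
pose delta := eta / M%:R.
have delta0 : 0 < delta by rewrite divr_gt0.
pose Q := (p.+1 * M)%N.
have sQ : (size (avg R M ^+ p.+1) <= Q)%N by exact: size_avgX.
pose q j := ev (avg R M ^+ p.+1) (cis (tau j * delta - z * delta)).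
pose cq j := c j * q j.
pose v := keep (fun j => tau j != z) cq.
pose F := fun t => nsq (modesum cq n t).
have cF : continuous F by exact: (continuous_nsq_modesum hK).
pose V := fun t => nsq (modesum v n t).
have cV : continuous V by exact: (continuous_nsq_modesum hK).
have xE t : cis (z * t) *: x = modesum cq n t - modesum v n t.
  rewrite scaler_sumr big_mkcond /= /modesum -sumrB; apply: eq_bigr => j _.
  rewrite -scalerBl /v /keep /cq /q -mulrBl; case: eqP => [->|_] /=; last first.
    by rewrite subrr mul0r scale0r.
  rewrite subr0 subrr scalerA; congr (_ *: _).
  suff -> : ev (avg R M ^+ p.+1) (cis 0) = 1 by rewrite mulr1 mulrC.
  rewrite cis0 evX; suff -> : ev (avg R M) 1 = 1 by rewrite expr1n.
  rewrite -(rmorph1 (real_complex R)) /ev horner_map /=.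
  by rewrite avg1.
have e1 : T * nsq x <= 2 * integ T F + 2 * integ T V.
  have -> : T * nsq x = integ T (fun=> nsq x) by rewrite integ_cst ?(ltW T0) // mulrC.
  have c2F : continuous (fun t => 2 * F t).
    by move=> t; apply: cvgM; [exact: cvg_cst|exact: cF].
  have c2V : continuous (fun t => 2 * V t).
    by move=> t; apply: cvgM; [exact: cvg_cst|exact: cV].
  have -> : 2 * integ T F + 2 * integ T V = integ T (fun t => 2 * F t + 2 * V t).
    by rewrite -!integ_scale // /integ RintegralD //; exact: continuous_integrable.
  apply: integ_le; [by move=> t; exact: cvg_cst| |].
    by move=> t; apply: cvgD; [exact: c2F|exact: c2V].
  move=> t; have -> : nsq x = nsq (cis (z * t) *: x) by rewrite nsqZ nsq_cis mul1r.
  rewrite xE.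
  exact: nsqB.
have e2 : integ T F <= obs_int T' c n.
  pose G (m : 'I_Q) t := nsq (modesum c n (t + m%:R * delta)).
  have cG m : continuous (G m) by exact: (cont_shift hK).
  apply: (@le_trans _ _ (integ T (fun t => \sum_(m < Q) (avg R M ^+ p.+1)`_m * G m t))).
    apply: integ_le => //.
      by apply: continuous_sumR => i t; apply: cvgM; [exact: cvg_cst|exact: cG].
    move=> t.
    have E2 : modesum cq n t = \sum_(m < Q) ((avg R M ^+ p.+1)`_m)%:C *:
        (cis (- (z * delta * m%:R)) *: modesum c n (t + m%:R * delta)).
      rewrite /cq /q (modesum_filter _ _ _ _ _ _ _ sQ).
      by apply: eq_bigr => m _; rewrite !scalerA mulrC.
    have S1 : \sum_(m < Q) (avg R M ^+ p.+1)`_m = 1 by rewrite sum_coef // avgX1.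
    have cv := @nsq_convex Q (fun m => (avg R M ^+ p.+1)`_m)
      (fun m => cis (- (z * delta * m%:R)) *: modesum c n (t + m%:R * delta))
      (fun m => avgX_ge0 R M p.+1 m) S1.
    rewrite /F E2; apply: (le_trans cv).
    by apply: ler_sum => m _; rewrite nsqZ nsq_cis mul1r.
  rewrite (@integ_sum _ _ _ _ _ G); last by move=> m; exact: cG.
  apply: (@le_trans _ _ (\sum_(m < Q) (avg R M ^+ p.+1)`_m * obs_int T' c n)).
    apply: ler_sum => m _; apply: ler_wpM2l; first exact: avgX_ge0.
    apply: obs_int_shift => //; first by rewrite mulr_ge0 // ltW.
    have : (m%:R : R) <= Q%:R by rewrite ler_nat ltnW.
    rewrite natrM => mQ.
    have : m%:R * delta <= p.+1%:R * M%:R * delta by rewrite ler_pM2r.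
    have -> : p.+1%:R * M%:R * delta = T' - T.
      by rewrite /delta -etaE; field; rewrite !gt_eqF.
    by lra.
  by rewrite -mulr_suml sum_coef // avgX1 // mul1r.
have e3 : integ T V <= CT * (W * energy_sum w1 (keep (fun j => tau j != z) c) n).
  apply: (le_trans (hadm v n)); apply: ler_wpM2l => //.
  rewrite mulr_sumr; apply: ler_sum => j _.
  rewrite /v /keep; case: ifPn => _; last by rewrite nsq0 !mulr0.
  rewrite /cq nsqM; suff h : w0 j * nsq (q j) <= W * w1 j.
    by have := ler_wpM2l (nsq_ge0 (c j)) h; lra.
  have E : tau j * delta - z * delta = (tau j - z) * (eta / M%:R).
    by rewrite /delta; ring.
  rewrite /q E; apply: hW => //.
  rewrite normrM (gtr0_norm delta0).
  have h3 : `|tau j - z| * delta <= X * delta by rewrite ler_pM2r // hX.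
  by rewrite -/delta in hM; lra.
rewrite mulrAC ler_pdivlMr // mulrC.
have e4 := energy_sum_ge0 (keep (fun j => tau j != z) c) n (fun j => ltW (w10 j)).
have e5 := obs_int_ge0 tau y T' c n.
have := mulr_ge0 CT0 W0.
set E := energy_sum _ _ _ in e3 e4 *; set J := obs_int _ _ _ in e2 e5 *.
by move=> cw; have := mulr_ge0 cw e5; nra.
Qed.

(** The amplitudes off [z] are observed by [observable_away]; this knowledge gives
    the vector carried by [z] through [observable_component], and the amplitudes
    at [z] follow by independence. *)
Lemma remove_frequency w1 w0 (p : nat) T z P :
  0 < T -> (forall j, 0 < w1 j) -> (forall j, 0 <= w0 j) ->
  (forall j, 1 <= `|tau j| -> w0 j <= w1 j * (tau j ^+ 2) ^+ p) ->
  (forall T, 0 < T ->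
     exists2 CT, 0 <= CT & forall c n, obs_int T c n <= CT * energy_sum w0 c n) ->
  (forall c n, \sum_(j < n | tau j == z) c j *: y j = 0 ->
     forall j, (j < n)%N -> tau j == z -> c j = 0) ->
  (forall T', T < T' -> exists2 C, 0 <= C &
     observable w1 (fun j => P j && (tau j != z)) T' C) ->
  forall T', T < T' -> exists2 C, 0 <= C & observable w1 P T' C.
Proof.
move=> T0 w10 w00 hw hadm ucp hobs T' TT.
pose T1 := (T + T') / 2.
have [T1l T1r] : T < T1 /\ T1 < T' by rewrite /T1; lra.
have [C C0 hC] := hobs T1 T1l.
have [C1 C10 hC1] := observable_away C0 T1r (fun j => ltW (w10 j)) hC.
have [CT CT0 hCT] := hadm T T0.
have [W W0 hW] := observable_component z T0 TT CT0 w10 w00 hw hCT.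
have [n0 hn0] := tau_infty `|z|.
have [G [G0 hG]] := gram_bound (fun c => ucp c n0).
have [V V0 hV] := bounded_below_frequency `|z| w1.
exists (C1 + n0%:R * V * G * (W * (1 + C1))).
  by rewrite addr_ge0 // !mulr_ge0 // addr_ge0.
move=> c' n; set c := keep P c'.
have cP j : ~~ P j -> c j = 0 by rewrite /c /keep => /negbTE ->.
have h1 := hC1 c n cP; have h2 := hW c n.
set J := obs_int T' c n in h1 h2 *.
have J0 : 0 <= J by exact: obs_int_ge0.
have -> : energy_sum w1 c n = energy_sum w1 (keep (fun j => tau j != z) c) n +
    \sum_(j < n | tau j == z) w1 j * nsq (c j).
  rewrite [X in _ + X]big_mkcond /= -big_split; apply: eq_bigr => j _ /=.
  by rewrite /keep; case: eqP => _ /=; rewrite ?nsq0 ?mulr0 ?add0r ?addr0.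
rewrite mulrDl lerD //.
set x := \sum_(j < n | _) _ in h2.
have h3 : nsq x <= W * (1 + C1) * J.
  by apply: (le_trans h2); rewrite -mulrA; apply: ler_wpM2l => //; lra.
pose c2 j := if (j < n)%N then c j else 0.
have lt_n0 j : tau j == z -> (j < n0)%N.
  by move=> /eqP jz; rewrite ltnNge; apply/negP => /hn0; rewrite jz ltxx.
have x2 : \sum_(j < n0 | tau j == z) c2 j *: y j = x.
  rewrite /x (big_ord_widen_cond (n + n0) (fun j => tau j == z)
    (fun j => c2 j *: y j)) ?leq_addl //.
  rewrite (big_ord_widen_cond (n + n0) (fun j => tau j == z) (fun j => c j *: y j)) ?leq_addr //.
  rewrite (bigID (fun j : 'I__ => (j < n)%N)) /= [X in _ + X]big1 ?addr0; last first.
    by move=> j /andP[_ /negbTE jn]; rewrite /c2 jn scale0r.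
  apply: eq_big => j.
    by case: eqP => //= /eqP /lt_n0 ->.
  by move=> /andP[_ jn]; rewrite /c2 jn.
have h4 j : (j < n)%N -> tau j == z -> w1 j * nsq (c j) <= V * (G * nsq x).
  move=> jn jz; have := hG c2 j (lt_n0 _ jz) jz; rewrite x2 {1}/c2 jn => h.
  have wV : w1 j <= V by apply: hV; rewrite (eqP jz).
  have := nsq_ge0 (c j); have := w10 j; nra.
apply: (@le_trans _ _ (\sum_(j < n0) V * (G * nsq x))).
  rewrite big_mkcond /= (big_ord_widen (n + n0)
    (fun j => if tau j == z then w1 j * nsq (c j) else 0)) ?leq_addr //.
  rewrite [leRHS](big_ord_widen (n + n0) (fun j => V * (G * nsq x))) ?leq_addl //.
  rewrite big_mkcond /= [leRHS]big_mkcond /=; apply: ler_sum => j _.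
  have v0 : 0 <= V * (G * nsq x).
    by apply: mulr_ge0 => //; apply: mulr_ge0 => //; exact: nsq_ge0.
  case: ifPn => jn; last by case: ifP.
  case: ifPn => jz; last by case: ifP.
  by rewrite (lt_n0 _ jz); exact: h4.
rewrite sumr_const card_ord -[_ *+ n0]mulr_natr.
have vg : 0 <= n0%:R * V * G by rewrite !mulr_ge0.
have := ler_wpM2l vg h3; lra.
Qed.

End RemoveFrequency.

(** * Observability of all finite sums *)

(** The finitely many frequencies that escape [high_frequency] are added back one
    at a time.  Each step uses some more time, as little as desired, so that the
    induction is on statements valid for all the times beyond [Tm]. *)
Lemma observability_sums (R : realType) (K : normedModType R[i])
    (ip : {dot K for Num.conj}) (hK : hilbert_norm ip)
    (tau : nat -> R) (y : nat -> K) (w1 w0 : nat -> R) (p : nat) (T C c0 t1 : R) :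
  0 < T -> 0 <= C -> 0 < c0 ->
  (forall X : R, exists n, forall j, (n <= j)%N -> X < `|tau j|) ->
  (forall j, 0 < w1 j) -> (forall j, 0 <= w0 j) ->
  (forall j, 1 <= `|tau j| -> w0 j <= w1 j * (tau j ^+ 2) ^+ p) ->
  (forall s, exists P : pred nat, observable tau y w1 P T C /\
     forall j, t1 <= `|tau j| -> ~~ P j -> c0 * `|tau j| <= `|tau j - s|) ->
  (forall T, 0 < T -> exists2 CT, 0 <= CT &
     forall c n, obs_int tau y T c n <= CT * energy_sum w0 c n) ->
  (forall z (c : nat -> R[i]) n, \sum_(j < n | tau j == z) c j *: y j = 0 ->
     forall j, (j < n)%N -> tau j == z -> c j = 0) ->
  forall T', T < T' -> exists2 C', 0 <= C' &
    forall c n, energy_sum w1 c n <= C' * obs_int tau y T' c n.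
Proof.
move=> T0 C0 c00 tau_infty w10 w00 hw hwin hadm ucp.
move=> T' TT; pose Tm := (T + T') / 2.
have [T1l T1r] : T < Tm /\ Tm < T' by rewrite /Tm; lra.
have Tm0 : 0 < Tm by lra.
have [CT CT0 hCT] := hadm T T0.
have [t2 [C2 [C20 hC2]]] := high_frequency hK T1l C0 c00 CT0 (fun j => ltW (w10 j)) w00 hw hwin hCT.
have [n0 hn0] := tau_infty t2.
pose Z := [seq tau j | j <- iota 0 n0].
have base T'' : Tm < T'' -> exists2 C', 0 <= C' &
    observable tau y w1 (fun j => tau j \notin Z) T'' C'.
  move=> TT''; exists C2 => //.
  have h : observable tau y w1 (fun j => tau j \notin Z) Tm C2.
    apply: observable_sub hC2 => j jZ; rewrite ltW // hn0 // leqNgt.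
    by apply: contra jZ => jn; apply: map_f; rewrite mem_iota.
  move=> c n; apply: (le_trans (h c n)); apply: ler_wpM2l => //.
  exact/(obs_int_le hK)/ltW.
suff main : forall T'', Tm < T'' -> exists2 C', 0 <= C' & observable tau y w1 predT T'' C'.
  by have [C' C'0 h] := main T' T1r; exists C' => // c n; exact: h c n.
elim: Z base => [|z Z IH] base.
  by move=> T'' /base[C' C'0 h]; exists C'; last exact: observable_sub h.
apply: IH; apply: (remove_frequency hK tau_infty Tm0 w10 w00 hw hadm (ucp z)).
move=> T'' /base[C' C'0 h]; exists C' => //.
by apply: observable_sub h => j; rewrite inE negb_or andbC.
Qed.

(** * Time frequencies of the wave equation *)

Section Spectrum.
Variables (R : realType) (lambda : nat -> R).
Hypothesis lambda_gt0 : forall v, 0 < lambda v.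
Hypothesis lambda_infty : lambda @ \oo --> +oo.
Implicit Types (c : nat -> R[i]) (u : cseq R) (v m n : nat).

Definition omega v : R := Num.sqrt (lambda v).

(** Each mode [v] contributes two time frequencies, [omega v] at the index [v.*2]
    and [- omega v] at the index [v.*2.+1]. *)
Definition freq j : R := if odd j then - omega j./2 else omega j./2.

Definition weight (l : R) j : R := lambda j./2 `^ l.

Lemma omega_gt0 v : 0 < omega v.
Proof. by rewrite /omega sqrtr_gt0. Qed.

Lemma sqr_omega v : omega v ^+ 2 = lambda v.
Proof. by rewrite /omega sqr_sqrtr // ltW. Qed.

Lemma norm_freq j : `|freq j| = omega j./2.
Proof. by rewrite /freq; case: ifP; rewrite ?normrN gtr0_norm ?omega_gt0. Qed.

Lemma sqr_freq j : freq j ^+ 2 = lambda j./2.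
Proof. by rewrite -real_normK ?num_real // norm_freq sqr_omega. Qed.

Lemma freq_even v : freq v.*2 = omega v.
Proof. by rewrite /freq odd_double doubleK. Qed.

Lemma freq_odd v : freq v.*2.+1 = - omega v.
Proof. by rewrite /freq /= odd_double /= uphalf_double. Qed.

Lemma weight_gt0 l j : 0 < weight l j.
Proof. by rewrite powR_gt0. Qed.

Lemma omega_infty X : exists n, forall v, (n <= v)%N -> X < omega v.
Proof.
have /cvgryPgt /(_ (X ^+ 2)) [n _ hn] := lambda_infty.
exists n => v nv; have [X0|X0] := ltP X 0; first exact: lt_trans (omega_gt0 v).
rewrite -ltr_sqr ?nnegrE ?(ltW (omega_gt0 v)) // sqr_omega.
exact: hn.
Qed.

Lemma freq_infty X : exists n, forall j, (n <= j)%N -> X < `|freq j|.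
Proof.
have [n hn] := omega_infty X; exists n.*2 => j nj; rewrite norm_freq; apply: hn.
by have := half_leq nj; rewrite doubleK.
Qed.

(** The loss of regularity from [l0] to [l1] is a power of the frequency. *)
Lemma weight_le (l0 l1 : R) : exists p, forall j, 1 <= `|freq j| ->
  weight l0 j <= weight l1 j * (freq j ^+ 2) ^+ p.
Proof.
exists (Num.truncn `|l0 - l1|).+1 => j j1.
set p := (Num.truncn _).+1.
have lp : l0 <= l1 + p%:R.
  have := truncnS_gt `|l0 - l1|; rewrite -/p => h.
  by have := ler_norm (l0 - l1); lra.
have l1j : 1 <= lambda j./2 by rewrite -sqr_freq -real_normK ?num_real // exprn_ege1.
rewrite sqr_freq /weight -powR_mulrn ?(ltW (lambda_gt0 _)) // -powRD.
  exact: ler_powR.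
by apply/implyP => _; rewrite gt_eqF.
Qed.

Definition dirac_cseq v : cseq R := fun n => (n == v)%:R.

Definition truncate m u : cseq R := fun v => if (v < m)%N then u v else 0.

(** The solution with amplitudes [c], which are indexed like [freq]. *)
Definition modes c (t : R) : cseq R :=
  fun v => c v.*2 * cis (freq v.*2 * t) + c v.*2.+1 * cis (freq v.*2.+1 * t).

Lemma eseries_fin (f : nat -> \bar R) m : (forall v, (m <= v)%N -> f v = 0%E) ->
  (\sum_(0 <= v <oo) f v = \sum_(v < m) f v)%E.
Proof.
move=> f0; apply: cvg_lim => //; apply: cvg_near_cst.
exists m => // n /= mn.
have z : (\sum_(m <= v < n) f v = 0)%E.
  by rewrite big_nat_cond big1 // => v /andP[/andP[mv _] _]; exact: f0.
by rewrite -(big_mkord xpredT f) (@big_cat_nat _ _ _ m) //= z adde0.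
Qed.

Lemma sqnormA_truncate s m u :
  sqnormA lambda s (truncate m u) = (\sum_(v < m) lambda v `^ (2 * s) * nsq (u v))%:E.
Proof.
rewrite /sqnormA (@eseries_fin _ m) => [|v mv]; last first.
  by rewrite /truncate ltnNge mv /= -[_ ^+ 2]/(nsq (0 : R[i])) nsq0 mulr0.
by rewrite sumEFin; congr EFin; apply: eq_bigr => v _; rewrite /truncate ltn_ord.
Qed.

Lemma domA_truncate s m u : domA_pow lambda s (truncate m u).
Proof. by rewrite /domA_pow /= sqnormA_truncate ltry. Qed.

Lemma sqnormA_ge0 s u : (0 <= sqnormA lambda s u)%E.
Proof. by apply: nneseries_ge0 => v _ _; rewrite lee_fin mulr_ge0 ?powR_ge0 ?sqr_ge0. Qed.

Section Operator.
Variables (K : normedModType R[i]) (m0 C0 : R) (L : cseq R -> K).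
Hypothesis hL : observation_operator lambda m0 C0 L.

Definition obs_vec j : K := L (dirac_cseq j./2).

Lemma truncate0 u : truncate 0 u = 0.
Proof. by apply/funext => v; rewrite /truncate ltn0. Qed.

Lemma truncate_dirac v : dirac_cseq v = truncate v.+1 (dirac_cseq v).
Proof.
apply/funext => n; rewrite /truncate ltnS /dirac_cseq.
by case: leqP => // vn; rewrite gtn_eqF.
Qed.

Lemma truncateS m u : truncate m.+1 u = u m *: dirac_cseq m + truncate m u.
Proof.
apply/funext => v; rewrite /truncate /dirac_cseq !fctE ltnS /GRing.scale /=.
by case: ltngtP => [vm|vm|->]; rewrite ?mulr0 ?mulr1 ?add0r ?addr0.
Qed.

Lemma L_truncate m u : L (truncate m u) = \sum_(v < m) u v *: L (dirac_cseq v).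
Proof.
have [lin _] := hL.
elim: m => [|m IH].
  rewrite big_ord0 truncate0.
  have d0 : domA_pow lambda m0 0 by rewrite -(truncate0 0); exact: domA_truncate.
  have := lin 1 0 0 d0 d0; rewrite scale1r addr0 scale1r => /eqP.
  by rewrite -subr_eq subrr eq_sym => /eqP.
rewrite truncateS lin; last exact: domA_truncate.
  by rewrite big_ord_recr /= addrC IH.
by rewrite truncate_dirac; exact: domA_truncate.
Qed.

Lemma modesum_L c m t :
  modesum freq obs_vec c m.*2 t = L (truncate m (modes c t)).
Proof.
rewrite L_truncate /modesum.
rewrite (sum_double (fun j => (c j * cis (freq j * t)) *: obs_vec j)).
apply: eq_bigr => v _.
by rewrite /modes scalerDl /obs_vec doubleK /= uphalf_double.
Qed.

Lemma observable_even w P (T C : R) :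
  (forall c m, energy_sum w (keep P c) m.*2 <= C * obs_int freq obs_vec T (keep P c) m.*2) ->
  observable freq obs_vec w P T C.
Proof.
move=> h c n; have := h (keep (fun j => (j < n)%N) c) n.
have -> : keep P (keep (fun j => (j < n)%N) c) = keep (fun j => (j < n)%N) (keep P c).
  by apply/funext => j; rewrite /keep; case: (P j); case: (j < n)%N.
by rewrite energy_sum_double obs_int_double.
Qed.

End Operator.

End Spectrum.

(** * Windows from dyadic blocks *)

Section Windows.
Variables (R : realType) (E K : completeNormedModType R[i]).
Variables (ipE : {dot E for Num.conj}) (ipK : {dot K for Num.conj}).
Hypothesis hK : hilbert_norm ipK.
Variables (e : nat -> E) (lambda : nat -> R).
Hypothesis lambda_gt0 : forall v, 0 < lambda v.
Hypothesis e_orth : forall i j, ipE (e i) (e j) = (i == j)%:R.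
Variables (m0 C0 : R) (L : cseq R -> K).
Hypothesis hL : observation_operator lambda m0 C0 L.
Hypothesis hconj : forall u : cseq R, domA_pow lambda m0 u ->
  `|L (cseq_conj u)| = `|L u|.

Local Notation omega := (omega lambda).
Local Notation freq := (freq lambda).
Local Notation y := (obs_vec L).
Local Notation truncate := (@truncate R).
Local Notation modes := (modes lambda).

Lemma coef_finite_sum (a : nat -> R[i]) m :
  coef ipE e (\sum_(v < m) a v *: e v) = truncate m a.
Proof.
apply/funext => v; rewrite /coef /truncate linear_sumlz.
under eq_bigr do rewrite linearZl_LR /= e_orth.
case: ltnP => vm; last first.
  rewrite big1 // => i _; rewrite ltn_eqF ?mulr0 //.
  exact: leq_trans (ltn_ord i) vm.
rewrite (bigD1 (Ordinal vm)) //= eqxx mulr1 big1 ?addr0 // => i iv.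
by rewrite -val_eqE /= in iv; rewrite (negbTE iv) mulr0.
Qed.

Lemma L2int_modesum T c n :
  L2int T (fun t => modesum freq y c n t) = (obs_int freq y T c n)%:E.
Proof. by rewrite /obs_int integE //; exact: (continuous_nsq_modesum hK). Qed.

(** The elements of the dyadic blocks stand for solutions with positive time
    frequencies only; [bwd] serves for their complex conjugates. *)
Definition fwd (a : nat -> R[i]) j := if odd j then 0 else a j./2.
Definition bwd (a : nat -> R[i]) j := if odd j then a j./2 else 0.

Lemma modes_fwd a t v : modes (fwd a) t v = a v * cis (t * omega v).
Proof.
rewrite /modes /fwd odd_double /= odd_double /= doubleK mul0r addr0.
by rewrite freq_even (mulrC t).
Qed.

Lemma modes_bwd a t v : modes (bwd a) t v = (modes (fwd (fun v => (a v)^*%R)) t v)^*%R.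
Proof.
rewrite modes_fwd /modes /bwd odd_double /= odd_double /= uphalf_double mul0r add0r.
rewrite conjCM conjCK conj_cis freq_odd; congr (_ * cis _); ring.
Qed.

Lemma energy_fwd l a m : energy_sum (weight lambda l) (fwd a) m.*2 =
  \sum_(v < m) lambda v `^ l * nsq (a v).
Proof.
rewrite /energy_sum (sum_double (fun j => weight lambda l j * nsq (fwd a j))).
apply: eq_bigr => v _; rewrite /fwd odd_double /= odd_double /= nsq0 mulr0 addr0.
by rewrite /weight doubleK.
Qed.

Lemma energy_bwd l a m : energy_sum (weight lambda l) (bwd a) m.*2 =
  \sum_(v < m) lambda v `^ l * nsq (a v).
Proof.
rewrite /energy_sum (sum_double (fun j => weight lambda l j * nsq (bwd a j))).
apply: eq_bigr => v _; rewrite /bwd odd_double /= odd_double /= nsq0 mulr0 add0r.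
by rewrite /weight /= !uphalf_double.
Qed.

Lemma nsq_i x : nsq (0 +i* x : R[i]) = x ^+ 2.
Proof. by rewrite nsqE /= expr0n add0r. Qed.

Lemma half_wave_truncate a m k t : half_wave lambda (truncate m a) k t =
  truncate m (fun v => (0 +i* omega v) ^+ k * cis (t * omega v) * a v).
Proof. by apply/funext => v; rewrite /half_wave /truncate; case: ifP; rewrite // mulr0. Qed.

Lemma energy_half_wave l a m :
  energy lambda l (half_wave lambda (truncate m a) 0 0) (half_wave lambda (truncate m a) 1 0) =
  (\sum_(v < m) lambda v `^ l * nsq (a v))%:E.
Proof.
rewrite /energy !half_wave_truncate !sqnormA_truncate -EFinD -EFinM; congr EFin.
rewrite -big_split mulr_sumr; apply: eq_bigr => v _ /=.
rewrite expr0 expr1 !mul0r cis0 !mulr1 !mul1r nsqM nsq_i (sqr_omega lambda_gt0).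
have -> : 2 * (l / 2) = l by field.
have -> : 2 * ((l - 1) / 2) = l - 1 by field.
rewrite mulrA; have -> : lambda v `^ (l - 1) * lambda v = lambda v `^ l.
  rewrite -[X in _ * X]powRr1 ?(ltW (lambda_gt0 v)) // -powRD ?subrK //.
  by apply/implyP => _; rewrite gt_eqF.
by field.
Qed.

Variables (alpha rho : R) (l1 C T : R) (k0 : nat).
Hypothesis hobs : forall U : nat -> E, Bplus e lambda alpha rho U ->
  forall k : nat, (k0 <= k)%N ->
  let uk := half_wave lambda (coef ipE e (U k)) in
  (energy lambda l1 (uk 0%N 0%R) (uk 1%N 0%R)
    <= C%:E * L2int T (fun t => L (uk 0%N t)))%E.

Definition in_window k v := alpha * rho ^+ k <= omega v < rho ^+ k / alpha.

Lemma Espace_sum (a : nat -> R[i]) m k : (forall v, ~~ in_window k v -> a v = 0) ->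
  Espace e lambda alpha rho k (\sum_(v < m) a v *: e v).
Proof.
move=> aJ; exists (truncate m a).
rewrite (eq_bigr (fun v : 'I_m => truncate m a v *: e v)); last first.
  by move=> v _; rewrite /truncate ltn_ord.
rewrite (fsbig_ord _ m (fun v => truncate m a v *: e v)).
set J := Jset lambda alpha rho k.
rewrite -(@fsbig_widen _ _ _ _ (J `&` `I_m) J); last 2 first.
- exact: subIsetl.
- move=> v [Jv /not_andP[//|/= /negP]]; rewrite -leqNgt => mv.
  by rewrite /truncate ltnNge mv /= scale0r.
rewrite -(@fsbig_widen _ _ _ _ (J `&` `I_m) `I_m); [by []|exact: subIsetr|].
move=> v [Iv /not_andP[/= Jv|//]]; rewrite /truncate; case: ifP => _; rewrite ?scale0r //.
by rewrite aJ ?scale0r //; apply/negP.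
Qed.

(** Both sides are quadratic: the assumption on the unit ball extends by scaling. *)
Lemma block_fwd (a : nat -> R[i]) m k : (k0 <= k)%N -> (forall v, ~~ in_window k v -> a v = 0) ->
  energy_sum (weight lambda l1) (fwd a) m.*2 <= C * obs_int freq y T (fwd a) m.*2.
Proof.
move=> kk0 aJ; pose V := \sum_(v < m) a v *: e v.
(* scaling by [eps] brings [V] into the unit ball, even when [V = 0] *)
pose eps := (1 + rnorm V)^-1.
have V0 : 0 < 1 + rnorm V by rewrite ltr_wpDr // rnorm_ge0.
have eps0 : 0 < eps by rewrite invr_gt0.
pose b v := eps%:C * a v.
have bE : eps%:C *: V = \sum_(v < m) b v *: e v.
  by rewrite scaler_sumr; apply: eq_bigr => v _; rewrite scalerA.
pose U k' : E := if k' == k then eps%:C *: V else 0.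
have BU : Bplus e lambda alpha rho U.
  move=> k' _; rewrite /U; case: eqP => [->|_]; last first.
    split; last by rewrite normr0.
    by have := @Espace_sum a 0 k'; exists (fun=> 0); rewrite fsbig1 // => i _; rewrite scale0r.
  split.
    by rewrite bE; apply: Espace_sum => v /aJ h; rewrite /b h mulr0.
  rewrite normrZ ger0_norm ?ler0c ?(ltW eps0) // -rnormK -rmorphM lecR.
  by rewrite /eps mulrC ler_pdivrMr // mul1r lerDr.
have := hobs BU kk0; rewrite /U eqxx bE coef_finite_sum /= energy_half_wave.
have -> : (fun t => L (half_wave lambda (truncate m b) 0 t)) =
    (fun t => modesum freq y (fwd b) m.*2 t).
  apply/funext => t; rewrite (modesum_L hL) half_wave_truncate; congr L.
  apply/funext => v; rewrite /truncate; case: ifP => // _.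
  by rewrite modes_fwd expr0 mul1r mulrC.
rewrite L2int_modesum -EFinM lee_fin energy_fwd.
have -> : \sum_(v < m) lambda v `^ l1 * nsq (b v) =
    eps ^+ 2 * \sum_(v < m) lambda v `^ l1 * nsq (a v).
  by rewrite mulr_sumr; apply: eq_bigr => v _; rewrite nsqM nsq_real mulrCA.
have -> : obs_int freq y T (fwd b) m.*2 = eps ^+ 2 * obs_int freq y T (fwd a) m.*2.
  rewrite /obs_int -integ_scale; last exact: (continuous_nsq_modesum hK).
  congr integ; apply/funext => t; rewrite -nsq_real -nsqZ; congr nsq.
  rewrite scaler_sumr; apply: eq_bigr => j _; rewrite scalerA; congr (_ *: _).
  by rewrite /fwd /b; case: ifP => _; rewrite ?mul0r ?mulr0 // !mulrA.
by rewrite mulrCA ler_pM2l // exprn_gt0.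
Qed.

(** Conjugation exchanges the signs of the frequencies and preserves the norm of
    the observation. *)
Lemma block_bwd (a : nat -> R[i]) m k : (k0 <= k)%N -> (forall v, ~~ in_window k v -> a v = 0) ->
  energy_sum (weight lambda l1) (bwd a) m.*2 <= C * obs_int freq y T (bwd a) m.*2.
Proof.
move=> kk0 aJ; pose b v := (a v)^*%R.
have := @block_fwd b m k kk0 _.
rewrite energy_bwd energy_fwd.
under eq_bigr do rewrite nsq_conj.
have -> : obs_int freq y T (bwd a) m.*2 = obs_int freq y T (fwd b) m.*2.
  congr integ; apply/funext => t; rewrite !(modesum_L hL) /nsq /rnorm; congr (complex.Re _ ^+ 2).
  rewrite -(hconj (domA_truncate _ _ _ _)); congr (`|L _|).
  apply/funext => v; rewrite /cseq_conj /truncate; case: ifP => _; last by rewrite rmorph0.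
  by rewrite modes_bwd conjCK.
by apply=> v /aJ h; rewrite /b h rmorph0.
Qed.

Lemma observable_block (b : bool) k : (k0 <= k)%N ->
  observable freq y (weight lambda l1) (fun j => (odd j == b) && in_window k j./2) T C.
Proof.
move=> kk0; apply: observable_even => c m.
case: b.
  pose a v := if in_window k v then c v.*2.+1 else 0.
  have aE j : keep (fun j => (odd j == true) && in_window k j./2) c j = bwd a j.
    rewrite /keep /bwd /a; case: (boolP (odd j)) => //= oj; case: ifP => // _.
    by rewrite -[in LHS](odd_double_half j) oj.
  rewrite (@eq_energy_sum _ _ _ (bwd a)); last by move=> j _; exact: aE.
  rewrite (@eq_obs_int _ _ _ _ _ _ (bwd a)); last by move=> j _; exact: aE.
  by apply: (@block_bwd a m k kk0) => v /negbTE; rewrite /a => ->.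
pose a v := if in_window k v then c v.*2 else 0.
have aE j : keep (fun j => (odd j == false) && in_window k j./2) c j = fwd a j.
  rewrite /keep /fwd /a; case: (boolP (odd j)) => //= oj; case: ifP => // _.
  by rewrite -[in LHS](odd_double_half j) (negbTE oj).
rewrite (@eq_energy_sum _ _ _ (fwd a)); last by move=> j _; exact: aE.
rewrite (@eq_obs_int _ _ _ _ _ _ (fwd a)); last by move=> j _; exact: aE.
by apply: (@block_fwd a m k kk0) => v /negbTE; rewrite /a => ->.
Qed.

Hypotheses (halpha : 0 < alpha < 1) (hrho : 1 < rho < alpha^-1).

Lemma dyadic_scale (S : R) : rho ^+ k0 <= S -> exists2 k, (k0 <= k)%N &
  rho ^+ k <= S < rho ^+ k.+1.
Proof.
move=> kS; have /andP[r1 _] := hrho.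
have [N hN] : exists N, S < rho ^+ N.
  have bern n : n%:R * (rho - 1) <= rho ^+ n.
    elim: n => [|n IH]; first by rewrite mul0r.
    have : 1 <= rho ^+ n by rewrite exprn_ege1 // ltW.
    by rewrite exprS -natr1; nra.
  exists (Num.truncn (S / (rho - 1))).+1; apply: lt_le_trans (bern _).
  by rewrite -ltr_pdivrMr ?subr_gt0 // truncnS_gt.
have exN : exists n, S < rho ^+ n by exists N.
have [k kP kmin] := ex_minnP exN.
case: k kP kmin => [|k] kP kmin.
  have : rho ^+ 0 <= rho ^+ k0 by rewrite expr0 exprn_ege1 // ltW.
  by move=> h; move: (lt_le_trans kP h); rewrite ltNge kS.
exists k; last first.
  by rewrite kP andbT leNgt; apply/negP => /kmin; rewrite ltnn.
rewrite -ltnS; rewrite ltnNge; apply/negP => kk.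
have : rho ^+ k.+1 <= rho ^+ k0 by rewrite ler_eXn2l.
by move=> h; move: (lt_le_trans kP h); rewrite ltNge kS.
Qed.

(** For large [s], the window is the block at the scale [k] of [s], on the side of
    the sign of [s].  As [alpha < 1] and [alpha * rho < 1], the numbers between
    [rho ^+ k] and [rho ^+ k.+1] are far inside the block, so that frequencies
    outside of it are at a distance of [s] comparable to their size.  For small
    [s] the window is empty. *)
Lemma window_exists (hC : 0 <= C) : exists c0 t1, 0 < c0 /\ forall s, exists P : pred nat,
  observable freq y (weight lambda l1) P T C /\
  forall j, t1 <= `|freq j| -> ~~ P j -> c0 * `|freq j| <= `|freq j - s|.
Proof.
have /andP[a0 a1] := halpha; have /andP[r1 ra] := hrho.
have ar1 : alpha * rho < 1 by rewrite mulrC -ltr_pdivlMr ?div1r.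
pose c0 := Num.min (2^-1) (Num.min (1 - alpha) (1 - alpha * rho)).
have c00 : 0 < c0 by rewrite !lt_min; apply/and3P; split; lra.
have [c1 [c2 c3]] : c0 <= 2^-1 /\ c0 <= 1 - alpha /\ c0 <= 1 - alpha * rho.
  by rewrite /c0 !ge_min !lexx ?orbT.
exists c0, (2 * rho ^+ k0); split=> // s.
have rk0 : 0 < rho ^+ k0 by rewrite exprn_gt0 // (lt_trans _ r1).
have [kS|Sk] := leP (rho ^+ k0) `|s|; last first.
  exists pred0; split.
    move=> c n; have -> : energy_sum (weight lambda l1) (keep pred0 c) n = 0.
      by rewrite /energy_sum big1 // => j _; rewrite /keep /= nsq0 mulr0.
    by rewrite mulr_ge0 // obs_int_ge0.
  move=> j tj _; have := lerB_dist (freq j) s; have := normr_ge0 (freq j); nra.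
have [k kk0 /andP[kS1 kS2]] := dyadic_scale kS.
exists (fun j => (odd j == (s < 0)) && in_window k j./2); split.
  exact: observable_block.
move=> j _; rewrite (norm_freq lambda_gt0).
have w0 := omega_gt0 lambda_gt0 j./2.
set w := omega _ in w0 *.
have rk : 0 < rho ^+ k by rewrite exprn_gt0 // (lt_trans _ r1).
rewrite exprS in kS2.
rewrite negb_and => /orP[sg|].
  have -> : `|freq j - s| = w + `|s|.
    rewrite /freq -/w; move: sg; case: (odd j) => /=; case: (ltP s 0) => s0 // _.
      by rewrite -opprD normrN ger0_norm ?addr_ge0 ?(ltW w0) // ger0_norm.
    by rewrite (ltr0_norm s0) gtr0_norm //; lra.
  have := normr_ge0 s; nra.
rewrite /in_window negb_and -ltNge -leNgt => out.
have h1 : `|w - `|s| | <= `|freq j - s|.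
  by have := ler_dist_dist (freq j) s; rewrite (norm_freq lambda_gt0).
apply: (le_trans _ h1).
case/orP: out => out.
  have : `|s| - w <= `|w - `|s| | by rewrite distrC ler_norm.
  have : w < alpha * `|s|.
    apply: (lt_le_trans out); rewrite ler_pM2l //.
  have := normr_ge0 s; nra.
rewrite ler_pdivrMr // -/w in out.
have h2 : w - `|s| <= `|w - `|s| | by rewrite ler_norm.
have h3 : `|s| <= alpha * rho * w by nra.
by nra.
Qed.

End Windows.

(** * Unique continuation *)

Section UniqueContinuation.
Variables (R : realType) (E K : completeNormedModType R[i]).
Variable ipE : {dot E for Num.conj}.
Variables (D : set E) (A : E -> E) (e : nat -> E) (lambda : nat -> R).
Hypotheses (subD : Defs.subspace D) (linA : linear_on D A).
Hypothesis lambda_gt0 : forall v, 0 < lambda v.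
Hypothesis e_orth : forall i j, ipE (e i) (e j) = (i == j)%:R.
Hypothesis eigen : forall v, D (e v) /\ A (e v) = (lambda v)%:C *: e v.
Variables (m0 C0 : R) (L : cseq R -> K).
Hypothesis hL : observation_operator lambda m0 C0 L.
Hypothesis hUCP : forall (v : E) (mu : R[i]), D v -> A v = mu *: v ->
  L (coef ipE e v) = 0 -> v = 0.

Lemma eigenspace_sum (a : nat -> R[i]) (mu : R) n :
  (forall v, a v != 0 -> lambda v = mu) ->
  let x := \sum_(v < n) a v *: e v in D x /\ A x = mu%:C *: x.
Proof.
move=> amu /=; have [D0 Dlin] := subD.
elim: n => [|n [IHD IHA]].
  rewrite big_ord0; split=> //; rewrite scaler0.
  have := linA 1 D0 D0; rewrite scale1r addr0 scale1r => /eqP.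
  by rewrite -subr_eq subrr eq_sym => /eqP.
have [De Ae] := eigen n.
rewrite big_ord_recr /= addrC; split; first exact: Dlin.
rewrite linA // IHA Ae scalerDr; congr (_ + _).
have [->|an] := eqVneq (a n) 0; first by rewrite !scale0r scaler0.
by rewrite (amu n an) !scalerA mulrC.
Qed.

(** A relation between the observations at one time frequency says that
    some combination of eigenvectors for one eigenvalue is not observed. *)
Lemma frequency_independent z (c : nat -> R[i]) n :
  \sum_(j < n | freq lambda j == z) c j *: obs_vec L j = 0 ->
  forall j, (j < n)%N -> freq lambda j == z -> c j = 0.
Proof.
move=> sum0.
pose f j := if (j < n)%N && (freq lambda j == z) then c j else 0.
pose a v := if z < 0 then f v.*2.+1 else f v.*2.
have par j : freq lambda j == z -> odd j = (z < 0).
  move=> /eqP <-; rewrite /freq; have w0 := omega_gt0 lambda_gt0 j./2.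
  by case: ifP => _; apply/esym; [rewrite oppr_lt0|apply/negbTE; rewrite -leNgt ltW].
have f0 j : odd j != (z < 0) -> f j = 0.
  by rewrite /f; case: ifP => // /andP[_ /par ->]; rewrite eqxx.
have E0 : \sum_(v < n) a v *: L (dirac_cseq R v) = 0.
  have F0 : \sum_(j < n.*2) f j *: obs_vec L j = 0.
    rewrite -[RHS]sum0 [RHS]big_mkcond /=.
    rewrite [RHS](@big_ord_widen _ _ _ n n.*2
      (fun j => if freq lambda j == z then c j *: obs_vec L j else 0)); last first.
      by rewrite -addnn leq_addr.
    rewrite [RHS]big_mkcond /=; apply: eq_bigr => j _; rewrite /f.
    by case: (j < n)%N; case: (freq lambda j == z); rewrite /= ?scale0r.
  rewrite -[RHS]F0 (sum_double (fun j => f j *: obs_vec L j)); apply: eq_bigr => v _.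
  rewrite /obs_vec doubleK /= uphalf_double /a; case: ifPn => z0.
    by rewrite (f0 v.*2) ?scale0r ?add0r // odd_double z0.
  by rewrite (f0 v.*2.+1) ?scale0r ?addr0 //= odd_double (negbTE z0).
pose x := \sum_(v < n) a v *: e v.
have az v : a v != 0 -> lambda v = z ^+ 2.
  have sq j : f j != 0 -> lambda j./2 = z ^+ 2.
    rewrite /f; case: ifP; rewrite ?eqxx // => /andP[_ /eqP <-] _.
    by rewrite sqr_freq.
  by rewrite /a; case: ifP => _ /sq; rewrite /= ?uphalf_double ?doubleK.
have [Dx Ax] := eigenspace_sum n az.
have cx : coef ipE e x = truncate n a by exact: (coef_finite_sum e_orth).
have x0 : x = 0 by apply: (hUCP Dx Ax); rewrite cx (L_truncate hL).
move=> j jn jz.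
have jn2 : (j./2 < n)%N by apply: leq_ltn_trans jn; have := odd_double_half j; lia.
have := congr1 (fun u : cseq R => u j./2) cx.
rewrite x0 /coef linear0l /truncate jn2 /a -(par j jz).
have fj : f j = c j by rewrite /f jn jz.
by have := odd_double_half j; case: ifP => _ /=; rewrite ?add0n ?add1n => ->; rewrite fj => ->.
Qed.

End UniqueContinuation.

(** * Energy of infinite sums of modes *)

(** Dominated convergence for the counting measure. *)
Lemma nneseries_dominated (R : realType) (f : nat -> nat -> R) (b : nat -> R) :
  (forall n v, 0 <= f n v <= b v) -> (\sum_(0 <= v <oo) (b v)%:E < +oo)%E ->
  (forall v, f n v @[n --> \oo] --> (0 : R)) ->
  (\sum_(0 <= v <oo) (f n v)%:E @[n --> \oo] --> 0)%E.
Proof.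
move=> fb bfin f0.
have b0 v : 0 <= b v by have /andP[h1 h2] := fb 0%N v; exact: le_trans h2.
have mnat (g : nat -> \bar R) : measurable_fun [set: nat] g by [].
have ib : (@counting nat R).-integrable [set: nat] (fun v => (b v)%:E).
  apply/integrableP; split=> //.
  under eq_integral do rewrite gee0_abs ?lee_fin //.
  by rewrite ge0_integral_count // => k; rewrite lee_fin.
have := @dominated_convergence _ _ _ (@counting nat R) [set: nat] measurableT
  (fun n v => (f n v)%:E) (fun=> 0%E) (fun v => (b v)%:E) (fun n => mnat _) (mnat _) _ ib _.
case.
- apply: aeW => v _; apply: cvg_EFin; first exact: nearW.
  exact: f0.
- apply: aeW => v n _; have /andP[h1 h2] := fb n v.
  by rewrite gee0_abs ?lee_fin.
- move=> _ _; rewrite integral0 => h.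
  rewrite (_ : (fun n => _) = (fun n => \int[counting]_(x in [set: nat]) (f n x)%:E)%E) //.
  apply/funext => n; rewrite ge0_integral_count // => k.
  by have /andP[h1 h2] := fb n k; rewrite lee_fin.
Qed.

Section ModesAnalysis.
Variables (R : realType) (lambda : nat -> R).
Hypothesis lambda_gt0 : forall v, 0 < lambda v.
Hypothesis lambda_mono : forall m v, (m <= v)%N -> lambda m <= lambda v.
Implicit Types (c : nat -> R[i]) (u : cseq R) (v m n : nat) (s t : R).

Local Notation modes := (modes lambda).
Local Notation freq := (freq lambda).
Local Notation omega := (omega lambda).

Definition pair_sq c v : R := nsq (c v.*2) + nsq (c v.*2.+1).

(** Half of the sum of the squared norms of the solution in [D(A^s)] and of its
    time derivative in [D(A^(s - 1/2))]; see [energy_modes]. *)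
Definition amp_energy s c : \bar R :=
  (\sum_(0 <= v <oo) (lambda v `^ (2 * s) * pair_sq c v)%:E)%E.

(** The amplitudes of the time derivative. *)
Definition dcoef c j : R[i] := (0 +i* freq j) * c j.

Lemma modes_dcoef2 c t v :
  modes (dcoef (dcoef c)) t v = - (lambda v)%:C * modes c t v.
Proof.
rewrite /modes /dcoef freq_even freq_odd.
have sq (x : R) : (0 +i* x : R[i]) * (0 +i* x) = - (x ^+ 2)%:C.
  by apply/eqP; rewrite eq_complex /= !mul0r mulr0 sub0r addr0 oppr0 expr2 !eqxx.
by rewrite !mulrA !sq sqrrN (sqr_omega lambda_gt0) mulrDr; ring.
Qed.

Lemma pair_sq_ge0 c v : 0 <= pair_sq c v.
Proof. by apply: addr_ge0; exact: nsq_ge0. Qed.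

Lemma amp_term_ge0 s c v : (0 <= (lambda v `^ (2 * s) * pair_sq c v)%:E)%E.
Proof. by rewrite lee_fin mulr_ge0 ?powR_ge0 ?pair_sq_ge0. Qed.

Lemma amp_energy_ge0 s c : (0 <= amp_energy s c)%E.
Proof. by apply: nneseries_ge0 => v _ _; exact: amp_term_ge0. Qed.

Lemma nsq_modes c t v : nsq (modes c t v) <= 2 * pair_sq c v.
Proof.
rewrite /modes /pair_sq mulrDr; apply: (le_trans (nsqD _ _)).
by rewrite !nsqM !nsq_cis !mulr1.
Qed.

Lemma sqnormA_modes s c t : (sqnormA lambda s (modes c t) <= 2%:E * amp_energy s c)%E.
Proof.
rewrite /sqnormA /amp_energy -nneseriesZl; last by move=> v _; exact: amp_term_ge0.
apply: lee_nneseries => [v _ _|v _].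
  by rewrite lee_fin mulr_ge0 ?powR_ge0 ?sqr_ge0.
rewrite -EFinM lee_fin -/(nsq _).
by have := ler_wpM2l (powR_ge0 (lambda v) (2 * s)) (nsq_modes c t v); lra.
Qed.

Lemma amp_energy_sub s s' c : s' <= s -> (amp_energy s c < +oo)%E ->
  (amp_energy s' c < +oo)%E.
Proof.
move=> ss' fin; pose r := lambda 0%N `^ (2 * s' - 2 * s).
apply: (@le_lt_trans _ _ (r%:E * amp_energy s c)%E); last first.
  by apply: lte_mul_pinfty; rewrite ?lee_fin ?powR_ge0.
rewrite /amp_energy -nneseriesZl; last by move=> v _; exact: amp_term_ge0.
apply: lee_nneseries => [v _ _|v _]; first exact: amp_term_ge0.
rewrite -EFinM lee_fin mulrA; apply: ler_wpM2r; first exact: pair_sq_ge0.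
have -> : 2 * s' = (2 * s' - 2 * s) + 2 * s by ring.
rewrite powRD; last by apply/implyP => _; rewrite gt_eqF.
apply: ler_wpM2r; first exact: powR_ge0.
rewrite /r; have -> : 2 * s' - 2 * s = - (2 * s - 2 * s') by ring.
rewrite !powRN lef_pV2 ?posrE ?powR_gt0 //.
apply: ge0_ler_powR; rewrite ?nnegrE ?(ltW (lambda_gt0 _)) ?lambda_mono //.
by lra.
Qed.

Lemma amp_energy_dcoef s c : amp_energy s (dcoef c) = amp_energy (s + 2^-1) c.
Proof.
apply: eq_eseriesr => v _; congr EFin; rewrite /pair_sq /dcoef !nsqM !nsq_i.
rewrite !(sqr_freq lambda_gt0) doubleK /= uphalf_double -mulrDr mulrA; congr (_ * _).
have -> : 2 * (s + 2^-1) = 2 * s + 1 by field.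
rewrite powRD; last by apply/implyP => _; rewrite gt_eqF.
by rewrite powRr1 // ltW.
Qed.

(** The cross terms of the two exponentials cancel between the solution and its
    derivative, which is the conservation of energy. *)
Lemma energy_modes l c t :
  energy lambda l (modes c t) (modes (dcoef c) t) = amp_energy (l / 2) c.
Proof.
rewrite /energy /sqnormA -nneseriesD; last 2 first.
- by move=> v _ _; rewrite lee_fin mulr_ge0 ?powR_ge0 ?sqr_ge0.
- by move=> v _ _; rewrite lee_fin mulr_ge0 ?powR_ge0 ?sqr_ge0.
rewrite -nneseriesZl; last first.
  by move=> v _; rewrite -EFinD lee_fin addr_ge0 // mulr_ge0 ?powR_ge0 ?sqr_ge0.
apply: eq_eseriesr => v _; rewrite -EFinD -EFinM; congr EFin.
rewrite -!/(nsq _).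
have -> : 2 * (l / 2) = l by field.
have -> : 2 * ((l - 1) / 2) = l - 1 by field.
set x := c v.*2 * cis (freq v.*2 * t).
set z := c v.*2.+1 * cis (freq v.*2.+1 * t).
have E1 : nsq (modes (dcoef c) t v) = lambda v * nsq (x - z).
  have -> : modes (dcoef c) t v = (0 +i* omega v) * (x - z).
    rewrite /modes /dcoef freq_even freq_odd /x /z freq_even freq_odd.
    have -> : (0 +i* - omega v : R[i]) = - (0 +i* omega v).
      by apply/eqP; rewrite eq_complex /= oppr0 !eqxx.
    by ring.
  by rewrite nsqM nsq_i (sqr_omega lambda_gt0).
have E2 : nsq (modes c t v) + nsq (x - z) = 2 * pair_sq c v.
  have -> : modes c t v = x + z by [].
  have -> : pair_sq c v = nsq x + nsq z by rewrite /x /z !nsqM !nsq_cis !mulr1.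
  by rewrite !nsqE; case: (x) => ? ?; case: (z) => ? ? /=; ring.
have E3 : lambda v `^ (l - 1) * lambda v = lambda v `^ l.
  rewrite -[X in _ * X]powRr1 ?(ltW (lambda_gt0 v)) // -powRD ?subrK //.
  by apply/implyP => _; rewrite gt_eqF.
rewrite E1 mulrA E3 -mulrDr E2; by field.
Qed.

Lemma modes_shift c a t : modes c (t + a) = modes (fun j => c j * cis (freq j * a)) t.
Proof.
by apply/funext => v; rewrite /modes !mulrDr !cisD -!mulrA !(mulrC (cis (_ * t))).
Qed.

Lemma amp_energy_shift s c a :
  amp_energy s (fun j => c j * cis (freq j * a)) = amp_energy s c.
Proof.
apply: eq_eseriesr => v _; congr EFin; congr (_ * _).
by rewrite /pair_sq !nsqM !nsq_cis !mulr1.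
Qed.

Lemma nsq_cisB (x z : R) : nsq (cis x - cis z) <= (x - z) ^+ 2.
Proof.
have -> : cis x - cis z = cis z * - (1 - cis (x - z)).
  by rewrite opprB mulrBr mulr1 -cisD (_ : z + (x - z) = x) //; ring.
rewrite nsqM nsq_cis mul1r nsqN nsq_1Bcis.
by have := cos_ge (x - z); lra.
Qed.

Lemma nsq_modesB c t t' v :
  nsq (modes c t v - modes c t' v) <= 2 * pair_sq c v * (lambda v * (t - t') ^+ 2).
Proof.
have -> : modes c t v - modes c t' v =
    c v.*2 * (cis (freq v.*2 * t) - cis (freq v.*2 * t')) +
    c v.*2.+1 * (cis (freq v.*2.+1 * t) - cis (freq v.*2.+1 * t')).
  by rewrite /modes; ring.
apply: (le_trans (nsqD _ _)); rewrite !nsqM /pair_sq.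
have h j : nsq (cis (freq j * t) - cis (freq j * t')) <= lambda j./2 * (t - t') ^+ 2.
  by apply: (le_trans (nsq_cisB _ _)); rewrite -mulrBr exprMn (sqr_freq lambda_gt0).
have := ler_wpM2l (nsq_ge0 (c v.*2)) (h v.*2).
have := ler_wpM2l (nsq_ge0 (c v.*2.+1)) (h v.*2.+1).
rewrite doubleK /= uphalf_double.
by lra.
Qed.

(** Dominated convergence, each coefficient being continuous in time. *)
Lemma sqnormA_modes_cvg s c t (r : nat -> R) : (amp_energy s c < +oo)%E ->
  r @ \oo --> t ->
  sqnormA lambda s (modes c t - modes c (r n)) @[n --> \oo] --> 0%E.
Proof.
move=> fin rt.
apply: (@nneseries_dominated _ (fun n v => lambda v `^ (2 * s) *
   rnorm (modes c t v - modes c (r n) v) ^+ 2)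
   (fun v => 8 * (lambda v `^ (2 * s) * pair_sq c v))).
- move=> n v; rewrite mulr_ge0 ?powR_ge0 ?sqr_ge0 //= -/(nsq _).
  have h : nsq (modes c t v - modes c (r n) v) <= 8 * pair_sq c v.
    have := nsqB (modes c t v) (modes c (r n) v).
    by have := nsq_modes c t v; have := nsq_modes c (r n) v; lra.
  by have := ler_wpM2l (powR_ge0 (lambda v) (2 * s)) h; lra.
- under eq_eseriesr do rewrite EFinM.
  rewrite nneseriesZl; last by move=> v _; exact: amp_term_ge0.
  rewrite -/(amp_energy s c).
  by apply: lte_mul_pinfty.
- move=> v; apply: (@squeeze_cvgr _ _ _ _ (fun=> 0)
     (fun n => lambda v `^ (2 * s) * (2 * pair_sq c v * (lambda v * (t - r n) ^+ 2)))).
  + apply: nearW => n; rewrite mulr_ge0 ?powR_ge0 ?sqr_ge0 //=.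
    by apply: ler_wpM2l; [exact: powR_ge0|exact: nsq_modesB].
  + exact: cvg_cst.
  + have -> : 0 = lambda v `^ (2 * s) * (2 * pair_sq c v * (lambda v * (t - t) ^+ 2)).
      by rewrite subrr expr0n /= !mulr0.
    do 3 (apply: cvgM; first exact: cvg_cst).
    under eq_fun do rewrite expr2; rewrite expr2.
    by apply: cvgM; (apply: cvgB; [exact: cvg_cst|exact: rt]).
Qed.

End ModesAnalysis.

(** * Strong measurability *)

Section StrongMeasurability.
Import HBSimple.
Variable R : realType.

Lemma simple_identity : exists r : nat -> R -> R,
  [/\ forall n, finite_set (range (r n)),
      forall n x, measurable (r n @^-1` [set x] : set R) &
      forall t, r n t @[n --> \oo] --> t].
Proof.
have mE : measurable_fun [set: R] (@EFin R) by exact: EFin_measurable.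
have [g hg] := approximation_sfun measurableT mE.
exists (fun n => g n); split.
- by move=> n; exact: fimfunP.
- by move=> n x; rewrite /=; exact: measurable_sfunP.
- by move=> t; have /fine_cvg := hg t I.
Qed.

(** Composing with simple approximations of the identity of the line, sequential
    continuity is enough. *)
Lemma strongly_measurable_cvg (V : zmodType) (N : V -> \bar R) (f : R -> V) :
  (forall t, (N (f t) < +oo)%E) ->
  (forall t (r : nat -> R), r @ \oo --> t ->
     N (f t - f (r n)) @[n --> \oo] --> (0 : \bar R)%E) ->
  strongly_measurable N f.
Proof.
move=> Nfin Ncvg; have [r [rfin rmeas rcvg]] := simple_identity.
exists (fun n t => f (r n t)); split; last by move=> t; exact: Ncvg.
move=> n; split=> [|x|t]; last exact: Nfin.
- rewrite (_ : [set f (r n i) | i in _] = f @` range (r n)); first exact: finite_image.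
  by apply/seteqP; split=> [_ [t _ <-]|_ [_ [t _ <-] <-]];
    [exists (r n t) => //; exists t|exists t].
- rewrite (_ : _ @^-1` _ = \bigcup_(z in range (r n) `&` [set z | f z = x]) (r n @^-1` [set z])).
    apply: fin_bigcup_measurable => [|z _]; last exact: rmeas.
    exact: finite_setIl.
  apply/seteqP; split=> [t /= ft|t [z [_ /= fz] /= tz]]; last by rewrite tz.
  by exists (r n t) => //; split=> //; exists t.
Qed.

(** Composing a function with finitely many values preserves its measurability,
    whatever [h]. *)
Lemma simple_measurable (V : zmodType) (N : V -> \bar R) (g : R -> V) (h : V -> \bar R) :
  simple_fun N g -> measurable_fun [set: R] (fun t => h (g t)).
Proof.
move=> [gfin gmeas _] _ A mA; rewrite setTI.
rewrite (_ : _ @^-1` _ = \bigcup_(z in range g `&` [set z | A (h z)]) (g @^-1` [set z])).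
  apply: fin_bigcup_measurable => [|z _]; last exact: gmeas.
  exact: finite_setIl.
apply/seteqP; split=> [t /= ft|t [z [_ /= fz] /= tz]]; last by rewrite tz.
by exists (g t) => //; split=> //; exists t.
Qed.

Lemma measurable_sqnorm (K : normedModType R[i]) (f : R -> K) :
  strongly_measurable (@sqnorm R K) f ->
  measurable_fun [set: R] (fun t => sqnorm (f t)).
Proof.
move=> [g [gs gcvg]].
apply: (@emeasurable_fun_cvg _ _ _ _ (fun n t => sqnorm (g n t))).
  by move=> n; exact: simple_measurable (gs n).
move=> t _; have := gcvg t; rewrite /sqnorm => /fine_cvg h.
apply: cvg_EFin; first exact: nearW.
have h2 : rnorm (f t - g n t) @[n --> \oo] --> (0 : R).
  have -> : (0 : R) = Num.sqrt 0 by rewrite sqrtr0.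
  under eq_fun do rewrite -[rnorm _]ger0_norm ?rnorm_ge0 // -sqrtr_sqr.
  exact: (cvg_comp _ _ h (@sqrt_continuous R 0)).
have h3 : rnorm (g n t) @[n --> \oo] --> rnorm (f t).
  apply/cvgrPdist_le => eps eps0.
  have /cvgrPdist_le /(_ eps eps0) := h2.
  apply: filterS => n; rewrite sub0r normrN ger0_norm ?rnorm_ge0 // => hn.
  apply: (le_trans _ hn); rewrite ler_norml.
  have d1 := rnormD (f t - g n t) (g n t); rewrite subrK in d1.
  have d2 := rnormD (g n t - f t) (f t); rewrite subrK in d2.
  have d3 : rnorm (g n t - f t) = rnorm (f t - g n t) by rewrite /rnorm distrC.
  by apply/andP; split; lra.
by rewrite expr2; under eq_fun do rewrite /= expr2; exact: cvgM.
Qed.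

End StrongMeasurability.

(** * Sums of modes are weak solutions *)

Section WeakSolutions.
Variables (R : realType) (lambda : nat -> R).
Hypothesis lambda_gt0 : forall v, 0 < lambda v.
Hypothesis lambda_mono : forall m v, (m <= v)%N -> lambda m <= lambda v.
Implicit Types (c : nat -> R[i]) (u : cseq R) (v m n : nat) (s t : R).
Local Notation mu := (@lebesgue_measure R).
Local Notation modes := (modes lambda).
Local Notation freq := (freq lambda).
Local Notation amp_energy := (amp_energy lambda).
Local Notation dcoef := (dcoef lambda).

(** The values [1] and [0 +i* -1] of [z] give the real and imaginary parts, which
    are thus treated together. *)
Definition Re_modes (z : R[i]) c v t : R := complex.Re (z * modes c t v).

Lemma Re_modesE z c v t : Re_modes z c v t =
  complex.Re (z * c v.*2 * cis (freq v.*2 * t)) +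
  complex.Re (z * c v.*2.+1 * cis (freq v.*2.+1 * t)).
Proof. by rewrite /Re_modes /modes mulrDr !mulrA raddfD. Qed.

Lemma Re_modes1 c v t : complex.Re (modes c t v) = Re_modes 1 c v t.
Proof. by rewrite /Re_modes mul1r. Qed.

Lemma Re_modesi c v t : complex.Im (modes c t v) = Re_modes (0 +i* -1) c v t.
Proof. by rewrite /Re_modes; case: (modes c t v) => a b /=; ring. Qed.

Lemma is_derive_Re_cis (z : R[i]) (a t : R) :
  is_derive t 1 (fun x => complex.Re (z * cis (a * x)))
    (complex.Re ((0 +i* a) * z * cis (a * t))).
Proof.
under eq_fun do rewrite Re_mul_cis.
have dl : is_derive t 1 (fun x : R => a * x) a.
  by apply: is_derive_eq; rewrite /GRing.scale /= mulr1.
have dc : is_derive t 1 (fun x : R => cos (a * x)) (a * - sin (a * t)).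
  have := @is_derive1_comp _ cos (fun x : R => a * x) t _ _ (is_derive_cos (a * t)) dl.
  by rewrite mulrC.
have ds : is_derive t 1 (fun x : R => sin (a * x)) (a * cos (a * t)).
  have := @is_derive1_comp _ sin (fun x : R => a * x) t _ _ (is_derive_sin (a * t)) dl.
  by rewrite mulrC.
apply: is_derive_eq.
rewrite /GRing.scale /= Re_mul_cis; case: z => x y /=; ring.
Qed.

Lemma is_derive_Re_modes z c v t :
  is_derive t 1 (Re_modes z c v) (Re_modes z (dcoef c) v t).
Proof.
have -> : Re_modes z c v = fun t =>
   complex.Re (z * c v.*2 * cis (freq v.*2 * t)) +
   complex.Re (z * c v.*2.+1 * cis (freq v.*2.+1 * t)).
  by apply/funext => x; exact: Re_modesE.
rewrite Re_modesE /dcoef.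
have h1 := is_derive_Re_cis (z * c v.*2) (freq v.*2) t.
have h2 := is_derive_Re_cis (z * c v.*2.+1) (freq v.*2.+1) t.
rewrite (mulrCA z) (mulrCA z (_ +i* _)).
exact: (is_deriveD h1 h2).
Qed.

Lemma continuous_Re_modes z c v : continuous (Re_modes z c v).
Proof.
move=> t; apply/differentiable_continuous/derivable1_diffP.
by have [] := is_derive_Re_modes z c v t.
Qed.

(** Integration by parts on an interval that contains the support of [phi]. *)
Lemma test_by_parts (F f phi : R -> R) : test_function phi ->
  (forall x : R, is_derive x 1 F (f x)) -> continuous f ->
  \int[mu]_t (F t * derive1 phi t) = - \int[mu]_t (f t * phi t).
Proof.
move=> [dphi [M hM]] dF cf.
pose B := `|M| + 1.
have B0 : - B < B by have := normr_ge0 M; rewrite /B; lra.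
have MB x : B <= `|x| -> M < `|x|.
  by rewrite /B => h; have := ler_norm M; lra.
have phi0 x : ~ (`[(- B), B]%classic x) -> M < `|x|.
  move=> /negP; rewrite /= in_itv /= => h; apply: MB.
  rewrite leNgt; apply/negP; rewrite ltr_norml => /andP[h1 h2].
  by move: h; rewrite (ltW h1) (ltW h2).
have cont (g : R -> R) : (forall x, derivable g x 1) -> continuous g.
  by move=> dg x; apply/differentiable_continuous/derivable1_diffP; exact: dg.
have cphi : continuous phi by apply: cont => x; exact: (dphi 0%N x).
have cdphi : continuous (derive1 phi) by apply: cont => x; exact: (dphi 1%N x).
have dF' x : derivable F x 1 by have [] := dF x.
have cF : continuous F by exact: cont.
have LR (g : R -> R) : (forall x, derivable g x 1) -> derivable_oo_LRcontinuous g (- B) B.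
  move=> dg; split; first by move=> x _; exact: dg.
    by apply: cvg_at_right_filter; exact: cont.
  by apply: cvg_at_left_filter; exact: cont.
have restrict (g : R -> R) : (forall x, M < `|x| -> g x = 0) ->
    \int[mu]_t (g t) = \int[mu]_(t in `[(- B)%R, B]) (g t).
  move=> g0; rewrite [RHS]Rintegral_mkcond; congr Rintegral; apply/funext => x.
  rewrite /patch; case: ifPn => //; rewrite notin_setE => /phi0 h.
  exact: g0.
rewrite (restrict (fun t => F t * derive1 phi t)) => [|x Mx]; last first.
  rewrite derive1E (@near_eq_derive _ _ _ phi (fun=> 0)).
    by rewrite derive_cst mulr0.
  have o : open [set z : R | M < `|z|].
    apply: (@open_comp _ _ (fun z : R => `|z|) [set z | M < z]); last exact: open_gt.
    by move=> z _; exact: norm_continuous.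
  by apply: filterS (open_nbhs_nbhs (conj o Mx)) => z; exact: hM.
rewrite (restrict (fun t => f t * phi t)) => [|x Mx]; last by rewrite hM ?mulr0.
rewrite (@Rintegration_by_parts _ F phi f (derive1 phi) (- B) B B0).
- have e1 : phi B = 0 by apply: hM; apply: MB; exact: ler_norm.
  have e2 : phi (- B) = 0 by apply: hM; apply: MB; rewrite normrN; exact: ler_norm.
  by rewrite e1 e2 !mulr0 subrr sub0r.
- exact: continuous_subspaceT.
- exact: LR.
- by move=> x _; rewrite derive1E; have [_ ->] := dF x.
- exact: continuous_subspaceT.
- by apply: LR => x; exact: (dphi 0%N x).
- by [].
Qed.

Lemma weak_derivative_modes c : weak_derivative (modes c) (modes (dcoef c)).
Proof.
move=> phi tphi v; split.
- under eq_Rintegral do rewrite Re_modes1.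
  under [in RHS]eq_Rintegral do rewrite Re_modes1.
  apply: (@test_by_parts (Re_modes 1 c v) (Re_modes 1 (dcoef c) v)) => //.
    by move=> x; exact: is_derive_Re_modes.
  exact: continuous_Re_modes.
- under eq_Rintegral do rewrite Re_modesi.
  under [in RHS]eq_Rintegral do rewrite Re_modesi.
  apply: (@test_by_parts (Re_modes _ c v) (Re_modes _ (dcoef c) v)) => //.
    by move=> x; exact: is_derive_Re_modes.
  exact: continuous_Re_modes.
Qed.

Lemma continuous_nsq_modes c v : continuous (fun t => nsq (modes c t v)).
Proof.
have -> : (fun t => nsq (modes c t v)) = (fun t =>
    Re_modes 1 c v t * Re_modes 1 c v t + Re_modes (0 +i* -1) c v t * Re_modes (0 +i* -1) c v t).
  by apply/funext => t; rewrite nsqE Re_modes1 Re_modesi !expr2.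
by move=> t; apply: cvgD; apply: cvgM; exact: continuous_Re_modes.
Qed.

Lemma measurable_sqnormA_modes s c :
  measurable_fun [set: R] (fun t => sqnormA lambda s (modes c t)).
Proof.
apply: (@ge0_emeasurable_sum _ _ _ _ (fun v t =>
  (lambda v `^ (2 * s) * rnorm (modes c t v) ^+ 2)%:E) xpredT).
- by move=> v t _ _; rewrite lee_fin mulr_ge0 ?powR_ge0 ?sqr_ge0.
- move=> v _; apply/measurable_EFinP; apply: continuous_measurable => t.
  by apply: cvgM; [exact: cvg_cst|exact: continuous_nsq_modes].
Qed.

Lemma L2loc_modes s c : (amp_energy s c < +oo)%E ->
  L2loc (sqnormA lambda s) (modes c).
Proof.
move=> fin.
have two : (2%:E * amp_energy s c < +oo)%E by apply: lte_mul_pinfty.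
split.
  apply: strongly_measurable_cvg => [t|t r rt].
    exact: le_lt_trans (sqnormA_modes _ _ _ _) two.
  exact: sqnormA_modes_cvg.
move=> a b; pose M := (2%:E * amp_energy s c)%E.
have M0 : (0 <= M)%E by apply: mule_ge0 => //; exact: amp_energy_ge0.
apply: (@le_lt_trans _ _ (\int[mu]_(t in `[a, b]) (cst M t))%E).
  apply: ge0_le_integral => //.
  - by move=> t _; exact: sqnormA_ge0.
  - by apply: measurable_funS (measurable_sqnormA_modes s c).
  - by move=> t _; exact: sqnormA_modes.
rewrite integral_cst //= lte_mul_pinfty //.
  by rewrite ge0_fin_numE.
by rewrite lebesgue_measure_itv /=; case: ifP => _; rewrite -?EFinB ltry.
Qed.

(** This makes admissibility available for all sums of modes of finite
    energy. *)
Lemma weak_wave_solution_modes l c : (amp_energy (l / 2) c < +oo)%E ->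
  weak_wave_solution lambda l (modes c) (modes (dcoef c)) (modes (dcoef (dcoef c))).
Proof.
move=> fin.
have fin1 s : s <= l / 2 -> (amp_energy s c < +oo)%E.
  by move=> sl; exact: (amp_energy_sub lambda_gt0 lambda_mono sl fin).
have fin2 s : s <= (l - 1) / 2 -> (amp_energy s (dcoef c) < +oo)%E.
  by move=> sl; rewrite amp_energy_dcoef // fin1 //; lra.
have fin3 s : s <= l / 2 - 1 -> (amp_energy s (dcoef (dcoef c)) < +oo)%E.
  by move=> sl; rewrite amp_energy_dcoef // fin2 //; lra.
split.
- exact: L2loc_modes.
- split; [apply: L2loc_modes; apply: fin1; lra|apply: L2loc_modes; exact: fin2|].
  exact: weak_derivative_modes.
- split; split; try exact: weak_derivative_modes; apply: L2loc_modes.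
  + by apply: fin1; lra.
  + by apply: fin2; lra.
  + by apply: fin2; lra.
  + exact: fin3.
- apply: aeW => t; apply/funext => v; rewrite /A_pow !fctE /= powRr1 ?(ltW (lambda_gt0 v)) //.
  by rewrite modes_dcoef2 // mulNr addNr.
Qed.

End WeakSolutions.

(** * Uniqueness for the wave equation *)

Section Wave.
Variables (R : realType) (lambda : nat -> R).
Hypothesis lambda_gt0 : forall v, 0 < lambda v.
Implicit Types (c : nat -> R[i]) (u : cseq R) (v m n : nat) (s t : R).
Local Notation modes := (modes lambda).
Local Notation omega := (omega lambda).
Local Notation amp_energy := (amp_energy lambda).
Local Notation dcoef := (dcoef lambda).

Lemma coef_le_sqnormA s u v : ((lambda v `^ (2 * s) * nsq (u v))%:E <= sqnormA lambda s u)%E.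
Proof.
have h0 (n : nat) : (0 <= (lambda n `^ (2 * s) * rnorm (u n) ^+ 2)%:E)%E.
  by rewrite lee_fin mulr_ge0 ?powR_ge0 ?sqr_ge0.
apply: le_trans (nneseries_lim_ge v.+1 _); last by move=> n _ _; exact: h0.
by rewrite big_nat_recr //= leeDr // sume_ge0.
Qed.

(** Convergence in the scale of spaces implies convergence of each
    coefficient. *)
Lemma is_derive_coef s (f : R -> cseq R) (g : cseq R) t (z : R[i]) v :
  sqnormA lambda s (h^-1%:C *: (f (t + h) - f t) - g) @[h --> (0 : R)^'] --> (0 : \bar R)%E ->
  is_derive t 1 (fun t => complex.Re (z * f t v)) (complex.Re (z * g v)).
Proof.
move=> /fine_cvgP [ffin fcvg].
pose w := lambda v `^ (2 * s).
have w0 : 0 < w by rewrite powR_gt0.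
pose F (t : R) := complex.Re (z * f t v).
suff H : h^-1 *: ((F \o shift t) (h *: (1 : R^o)) - F t) @[h --> (0 : R)^']
    --> complex.Re (z * g v).
  apply: DeriveDef; first by apply/cvg_ex; exists (complex.Re (z * g v)).
  exact: cvg_lim H.
apply/cvgrPdist_lt => eps eps0.
have M0 : 0 < 1 + nsq z by rewrite ltr_pwDl // nsq_ge0.
pose eta := w * eps ^+ 2 / (1 + nsq z).
have eta0 : 0 < eta by rewrite divr_gt0 // mulr_gt0 // exprn_gt0.
have /cvgrPdist_lt /(_ eta eta0) := fcvg.
apply: filterS2 ffin => h hfin.
rewrite sub0r normrN /=; set x := _ - g in hfin *.
rewrite ger0_norm ?fine_ge0 ?sqnormA_ge0 // => hx.
have xv : w * nsq (x v) < eta.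
  by rewrite -lte_fin; apply: (le_lt_trans (coef_le_sqnormA _ _ _)); rewrite -(fineK hfin) lte_fin.
have E : complex.Re (z * g v) - h^-1 *: (F (h *: (1 : R^o) + t) - F t) = - complex.Re (z * x v).
  rewrite /F /x !fctE /GRing.scale /= mulr1 (addrC h t).
  case: (z) => z1 z2; case: (f (t + h) v) => a1 a2; case: (f t v) => b1 b2; case: (g v) => g1 g2 /=.
  by ring.
rewrite E normrN -ltr_sqr ?nnegrE ?normr_ge0 ?(ltW eps0) // real_normK ?num_real //.
have h1 : complex.Re (z * x v) ^+ 2 <= nsq z * nsq (x v).
  by rewrite -nsqM nsqE lerDl sqr_ge0.
apply: (le_lt_trans h1).
rewrite -(ltr_pM2l w0) mulrCA.
apply: (@le_lt_trans _ _ ((1 + nsq z) * (w * nsq (x v)))).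
  by rewrite ler_wpM2r ?lerDr // mulr_ge0 ?nsq_ge0 // ltW.
by rewrite mulrC -ltr_pdivlMr.
Qed.

(** The quantity [q t * q t + a * (p t * p t)] is conserved. *)
Lemma oscillator_unique (a : R) (p q : R -> R) : 0 < a ->
  (forall t, is_derive t 1 p (q t)) -> (forall t, is_derive t 1 q (- a * p t)) ->
  p 0 = 0 -> q 0 = 0 -> forall t, p t = 0 /\ q t = 0.
Proof.
move=> a0 dp dq p0 q0 t.
pose F (t : R) := q t * q t + a * (p t * p t).
have dF (x : R) : is_derive x 1 F 0.
  have h1 := is_deriveM (dq x) (dq x).
  have h2 := is_deriveM (dp x) (dp x).
  have h3 := is_deriveZ a h2.
  have h4 := is_deriveD h1 h3.
  apply: is_derive_eq h4 _.
  by rewrite /GRing.scale /=; ring.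
have Ft : F t = 0.
  by rewrite (@is_derive_0_is_cst _ F t 0 dF) /F p0 q0; ring.
have q2 := sqr_ge0 (q t); have p2 := sqr_ge0 (p t).
have ap : 0 <= a * p t ^+ 2 by rewrite mulr_ge0 // ltW.
move: Ft; rewrite /F -!expr2 => Ft.
have pz : a * p t ^+ 2 = 0 by lra.
have qz : q t ^+ 2 = 0 by lra.
split; last by apply/eqP; rewrite -sqrf_eq0 qz.
by apply/eqP; rewrite -sqrf_eq0; move/eqP: pz; rewrite mulf_eq0 gt_eqF.
Qed.

(** Even indices give the amplitudes [u^+] and odd indices [u^-] of the solution with
    initial data [u0] and [u1]. *)
Definition data_coef u0 u1 j : R[i] :=
  2^-1 * (u0 j./2 + (if odd j then 0 +i* 1 else - (0 +i* 1)) * u1 j./2 / (omega j./2)%:C).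

Lemma data_coefE u0 u1 v : modes (data_coef u0 u1) 0 v = u0 v.
Proof.
rewrite /modes /data_coef !mulr0 cis0 !mulr1 odd_double /= odd_double /= doubleK uphalf_double.
have h (x y z w : R[i]) : 2^-1 * (x + - y * z * w) + 2^-1 * (x + y * z * w) =
    (2^-1 * 2) * x by ring.
by rewrite h mulVf ?mul1r // pnatr_eq0.
Qed.

Lemma data_dcoefE u0 u1 v : modes (dcoef (data_coef u0 u1)) 0 v = u1 v.
Proof.
have w0 : (omega v)%:C != 0 by rewrite eq_complex /= gt_eqF // omega_gt0.
rewrite /modes /dcoef /data_coef !mulr0 cis0 !mulr1 odd_double /= odd_double /=.
rewrite doubleK uphalf_double freq_even freq_odd.
have iE (x : R) : (0 +i* x : R[i]) = x%:C * (0 +i* 1).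
  by apply/eqP; rewrite eq_complex /= !(mul0r, mulr0, mulr1, oppr0, addr0) !eqxx.
have i2 : (0 +i* 1 : R[i]) * (0 +i* 1) = -1.
  by apply/eqP; rewrite eq_complex /= !(mul0r, mulr0, mulr1, sub0r, addr0) oppr0 !eqxx.
rewrite iE (iE (- omega v)) rmorphN /=.
set W := (omega v)%:C in w0 *; set I := (0 +i* 1) in i2 *.
have -> : W * I * (2^-1 * (u0 v + - I * u1 v / W)) + - W * I * (2^-1 * (u0 v + I * u1 v / W))
   = (2^-1 * 2) * - (I * I) * u1 v * (W / W) by ring.
by rewrite i2 divff // mulVf ?pnatr_eq0 //; ring.
Qed.

(** Each coefficient of the difference is an oscillator with zero initial data. *)
Lemma wave_solution_modes l u0 u1 du : wave_solution lambda l u0 u1 du ->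
  let c := data_coef u0 u1 in
  forall t, du 0%N t = modes c t /\ du 1%N t = modes (dcoef c) t.
Proof.
move=> [_ _ dd eqn [d0 d1]] c t.
have comp (z : R[i]) v :
    complex.Re (z * (du 0%N t v - modes c t v)) = 0 /\
    complex.Re (z * (du 1%N t v - modes (dcoef c) t v)) = 0.
  have dE k x := is_derive_coef z v (dd k x).
  have e2 x : du 2%N x v = - (lambda v)%:C * du 0%N x v.
    have := congr1 (fun u : cseq R => u v) (eqn x).
    rewrite /A_pow !fctE powRr1 ?(ltW (lambda_gt0 v)) // => /eqP.
    by rewrite addr_eq0 mulNr => /eqP.
  have ReL (x : R) (y : R[i]) : complex.Re (z * (- x%:C * y)) = - x * complex.Re (z * y).
    by case: (z) => ? ?; case: y => ? ? /=; ring.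
  have := @oscillator_unique (lambda v)
    (fun x => complex.Re (z * du 0%N x v) - Re_modes lambda z c v x)
    (fun x => complex.Re (z * du 1%N x v) - Re_modes lambda z (dcoef c) v x)
    (lambda_gt0 v) _ _ _ _ t.
  have gB (x1 x2 : R[i]) : complex.Re (z * (x1 - x2)) = complex.Re (z * x1) - complex.Re (z * x2).
    by rewrite mulrBr raddfB.
  rewrite !gB; apply.
  - by move=> x; exact: (is_deriveB (dE 0%N x) (is_derive_Re_modes lambda z c v x)).
  - move=> x; have := is_deriveB (dE 1%N x) (is_derive_Re_modes lambda z (dcoef c) v x).
    move/is_derive_eq; apply.
    by rewrite e2 /Re_modes modes_dcoef2 // !ReL -mulrBr.
  - by rewrite /Re_modes d0 /c data_coefE subrr.
  - by rewrite /Re_modes d1 /c data_dcoefE subrr.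
have zero (x : R[i]) : complex.Re (1 * x) = 0 -> complex.Re ((0 +i* -1) * x) = 0 -> x = 0.
  case: x => a b /= h1 h2; apply/eqP; rewrite eq_complex /=; apply/andP; split; apply/eqP.
    by move: h1; rewrite mul1r mul0r subr0.
  by move: h2; rewrite mul0r mulN1r opprK add0r.
split; apply/funext => v; apply/eqP; rewrite -subr_eq0; apply/eqP; apply: zero.
- by have [] := comp 1 v.
- by have [] := comp (0 +i* -1) v.
- by have [] := comp 1 v.
- by have [] := comp (0 +i* -1) v.
Qed.

Lemma amp_energy_data l u0 u1 :
  domA_pow lambda (l / 2) u0 -> domA_pow lambda ((l - 1) / 2) u1 ->
  (amp_energy (l / 2) (data_coef u0 u1) < +oo)%E.
Proof.
rewrite /domA_pow /= => h0 h1.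
rewrite -(energy_modes lambda_gt0 l (data_coef u0 u1) 0) /energy.
have -> : modes (data_coef u0 u1) 0 = u0 by apply/funext => v; exact: data_coefE.
have -> : modes (dcoef (data_coef u0 u1)) 0 = u1 by apply/funext => v; exact: data_dcoefE.
by apply: lte_mul_pinfty; rewrite ?lee_fin ?invr_ge0 // lte_add_pinfty.
Qed.

End Wave.

(** * Admissibility on bounded intervals *)

(** The line is not negligible. *)
Lemma ae_constant (R : realType) (P : Prop) :
  {ae @lebesgue_measure R, forall t : R, P} -> P.
Proof.
move=> [N [mN N0 sub]]; apply: contrapT => nP.
have NT : N = setT by apply/seteqP; split=> // t _; apply: sub.
have := @lebesgue_measure_itv R `]-oo, +oo[.
by rewrite set_itvNyy -NT N0.
Qed.

Lemma ae_mono (R : realType) (P Q : R -> Prop) : (forall t, P t -> Q t) ->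
  {ae @lebesgue_measure R, forall t : R, P t} ->
  {ae @lebesgue_measure R, forall t : R, Q t}.
Proof.
move=> PQ [N [mN N0 sub]]; exists N; split=> //.
by apply: subset_trans sub => t /= nQ /PQ.
Qed.

Section Admissibility.
Variables (R : realType) (lambda : nat -> R).
Hypothesis lambda_gt0 : forall v, 0 < lambda v.
Hypothesis lambda_mono : forall m v, (m <= v)%N -> lambda m <= lambda v.
Variables (K : completeNormedModType R[i]) (ipK : {dot K for Num.conj}).
Hypothesis hK : hilbert_norm ipK.
Variables (m0 C0 l0 : R) (L : cseq R -> K).
Hypothesis hL : observation_operator lambda m0 C0 L.
Variables (Dext : set (R -> cseq R)) (Lext : (R -> cseq R) -> R -> K).
Hypothesis hext : time_extension lambda m0 l0 L Dext Lext.
Variables (S CS : R).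
Hypotheses (S0 : 0 < S) (CS0 : 0 < CS).
Hypothesis hadm : forall u v w, weak_wave_solution lambda l0 u v w ->
  Dext u /\
  {ae lebesgue_measure, forall t : R,
    (L2int S (Lext u) <= CS%:E * energy lambda l0 (u t) (v t))%E}.

Implicit Types (c : nat -> R[i]) (u : cseq R) (v m n : nat) (s t : R) (f g : R -> cseq R).
Local Notation mu := (@lebesgue_measure R).
Local Notation modes := (modes lambda).
Local Notation freq := (freq lambda).
Local Notation amp_energy := (amp_energy lambda).

Lemma admissible_modes c : (amp_energy (l0 / 2) c < +oo)%E ->
  Dext (modes c) /\ (L2int S (Lext (modes c)) <= CS%:E * amp_energy (l0 / 2) c)%E.
Proof.
move=> /(weak_wave_solution_modes lambda_gt0 lambda_mono) /hadm [Dc h]; split=> //.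
apply: (@ae_constant R); apply: ae_mono h => t.
by rewrite (energy_modes lambda_gt0).
Qed.

Lemma Lext_measurable f : Dext f ->
  measurable_fun [set: R] (fun t => sqnorm (Lext f t)).
Proof. by move=> /(ext_cod hext) [sm _]; exact: measurable_sqnorm. Qed.

Lemma sqnorm_ge0 (V : normedZmodType R[i]) (x : V) : (0 <= sqnorm x)%E.
Proof. by rewrite lee_fin sqr_ge0. Qed.

Lemma Lext_shift_measurable f a : Dext f ->
  measurable_fun [set: R] (fun t => sqnorm (Lext f (t + a))).
Proof.
move=> Df; apply: (@measurableT_comp _ _ _ _ _ _ (fun t => sqnorm (Lext f t)) _
  (fun t : R => t + a)).
  exact: Lext_measurable.
by apply: measurable_funD => //; exact: measurable_cst.
Qed.

Lemma ae_eq_L2int T (g h : R -> K) :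
  measurable_fun [set: R] (fun t => sqnorm (g t)) ->
  measurable_fun [set: R] (fun t => sqnorm (h t)) ->
  {ae mu, forall t : R, g t = h t} -> L2int T g = L2int T h.
Proof.
move=> mg mh gh; apply: ge0_ae_eq_integral => //.
- exact: measurable_funS mg.
- exact: measurable_funS mh.
- by move=> t _; exact: sqnorm_ge0.
- by move=> t _; exact: sqnorm_ge0.
- by apply: ae_mono gh => t -> _.
Qed.

(** A translate of a sum of modes is a sum of modes with the same energy. *)
Lemma admissible_shift c a : (amp_energy (l0 / 2) c < +oo)%E ->
  (\int[mu]_(t in `[a, (a + S)%R]) sqnorm (Lext (modes c) t) <= CS%:E * amp_energy (l0 / 2) c)%E.
Proof.
move=> fin; have [Dc _] := admissible_modes fin.
pose ca := fun j => c j * cis (freq j * a).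
have Ea : amp_energy (l0 / 2) ca = amp_energy (l0 / 2) c by exact: amp_energy_shift.
have [Dca] := @admissible_modes ca (eq_ind_r (fun x => (x < +oo)%E) fin Ea).
rewrite Ea; apply: le_trans.
have [_ tr] := ext_translation hext a Dc.
have caE : (fun t => modes c (t + a)) = modes ca by apply/funext => t; exact: modes_shift.
rewrite caE in tr.
have := @ge0_integral_shift R _ a 0 S (Lext_measurable Dc) (fun t => sqnorm_ge0 _).
rewrite add0r (addrC S) => <-.
rewrite -/(L2int S (fun t => Lext (modes c) (t + a))) (ae_eq_L2int _ _ _ tr) //.
  exact: Lext_measurable.
exact: Lext_shift_measurable.
Qed.

Lemma admissible_multiple n c : (amp_energy (l0 / 2) c < +oo)%E ->
  (L2int (n%:R * S) (Lext (modes c)) <= (n%:R * CS)%:E * amp_energy (l0 / 2) c)%E.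
Proof.
move=> fin; have [Dc _] := admissible_modes fin.
have mf := Lext_measurable Dc.
elim: n => [|n IH].
  by rewrite !mul0r mul0e /L2int set_itv1 integral_set1.
have split : `[0, n.+1%:R * S]%classic = `[0, n%:R * S] `|` `]n%:R * S, n.+1%:R * S].
  rewrite -itv_bndbnd_setU //= bnd_simp ?mulr_ge0 ?(ltW S0) //.
  by rewrite ler_wpM2r ?(ltW S0) // ler_nat.
rewrite /L2int split ge0_integral_setU //=.
- have -> : n.+1%:R * CS = n%:R * CS + CS by rewrite -natr1 mulrDl mul1r.
  rewrite EFinD ge0_muleDl ?lee_fin ?mulr_ge0 ?(ltW CS0) //.
  apply: leeD; first exact: IH.
  apply: le_trans (admissible_shift (n%:R * S) fin).
  rewrite (_ : n%:R * S + S = n.+1%:R * S); last by rewrite -natr1 mulrDl mul1r.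
  apply: ge0_subset_integral => //.
  + exact: measurable_funS mf.
  + by move=> t _; exact: sqnorm_ge0.
  + exact: subset_itv_oc_cc.
- exact: measurable_funS mf.
- by move=> t _; exact: sqnorm_ge0.
- apply/disj_setPS => t [/=]; rewrite !in_itv /= => /andP[_ h1] /andP[h2 _].
  by have := lt_le_trans h2 h1; rewrite ltxx.
Qed.

Lemma L2int_le T T' f : Dext f -> T <= T' -> (L2int T (Lext f) <= L2int T' (Lext f))%E.
Proof.
move=> Df TT; apply: ge0_subset_integral => //.
- exact: measurable_funS (Lext_measurable Df).
- by move=> t _; exact: sqnorm_ge0.
- by apply: subset_itvl; rewrite bnd_simp.
Qed.

(** Any bounded interval is covered by translates of [[0, S]]. *)
Lemma admissible_all T : exists2 CT, 0 <= CT &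
  forall c, (amp_energy (l0 / 2) c < +oo)%E ->
    (L2int T (Lext (modes c)) <= CT%:E * amp_energy (l0 / 2) c)%E.
Proof.
pose n := (Num.truncn (T / S)).+1.
exists (n%:R * CS) => [|c fin]; first by rewrite mulr_ge0 // ltW.
apply: le_trans (admissible_multiple n fin); apply: L2int_le.
  by have [] := admissible_modes fin.
by rewrite -ler_pdivrMr // ltW // truncnS_gt.
Qed.

(** * Finitely many modes *)

Definition supported m c := forall j, (m.*2 <= j)%N -> c j = 0.

Lemma amp_energy_supported s m c : supported m c ->
  amp_energy s c = (energy_sum (weight lambda (2 * s)) c m.*2)%:E.
Proof.
move=> fc; rewrite /amp_energy (@eseries_fin _ _ m) => [|v mv].
  rewrite sumEFin; congr EFin.
  rewrite /energy_sum (sum_double (fun j => weight lambda (2 * s) j * nsq (c j))).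
  by apply: eq_bigr => v _; rewrite /pair_sq /weight doubleK /= uphalf_double mulrDr.
by rewrite /pair_sq !fc ?nsq0 ?addr0 ?mulr0 // ?leq_double // ltnW // ltnS leq_double.
Qed.

Lemma modes_supported m c t : supported m c -> modes c t = truncate m (modes c t).
Proof.
move=> fc; apply/funext => v; rewrite /truncate; case: ltnP => // mv.
rewrite /modes !fc ?mul0r ?addr0 // ?leq_double // ltnW // ltnS leq_double //.
Qed.

(** On finitely many modes the extended operator acts pointwise in time, as [L]. *)
Lemma L2int_supported T m c : supported m c ->
  L2int T (Lext (modes c)) = (obs_int freq (obs_vec L) T c m.*2)%:E.
Proof.
move=> fc.
have fin s : (amp_energy s c < +oo)%E by rewrite (amp_energy_supported s fc) ltry.
have [Dc ae] := ext_pointwise hext (L2loc_modes lambda_gt0 (fin m0)).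
have E : (fun t => L (modes c t)) = fun t => modesum freq (obs_vec L) c m.*2 t.
  by apply/funext => t; rewrite (modesum_L hL) -modes_supported.
have mL : measurable_fun [set: R] (fun t => sqnorm (L (modes c t))).
  rewrite (_ : (fun t => _) = fun t => (nsq (modesum freq (obs_vec L) c m.*2 t))%:E); last first.
    by apply/funext => t; rewrite /sqnorm /nsq -[L _]/((fun t => L (modes c t)) t) E.
  by apply/measurable_EFinP; apply: continuous_measurable; exact: (continuous_nsq_modesum hK).
by rewrite (ae_eq_L2int _ (Lext_measurable Dc) mL ae) E (L2int_modesum hK).
Qed.

Lemma supported_keep c n : supported n (keep (fun j => (j < n)%N) c).
Proof.
move=> j nj; rewrite /keep ltnNge (leq_trans _ nj) //.
by rewrite -addnn leq_addr.
Qed.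

Lemma admissible_sums T : exists2 CT, 0 <= CT & forall c n,
  obs_int freq (obs_vec L) T c n <= CT * energy_sum (weight lambda l0) c n.
Proof.
have [CT CT0 h] := admissible_all T; exists CT => // c n.
have fc := @supported_keep c n; have := h (keep (fun j => (j < n)%N) c).
rewrite (amp_energy_supported _ fc) (L2int_supported _ fc) ltry -EFinM lee_fin.
rewrite energy_sum_double obs_int_double (_ : 2 * (l0 / 2) = l0); last by field.
exact.
Qed.

(** * Passage to infinitely many modes *)

Definition head m c : nat -> R[i] := keep (fun j => (j < m.*2)%N) c.
Definition tail m c : nat -> R[i] := keep (fun j => (m.*2 <= j)%N) c.

Lemma pair_sq_head m c v : pair_sq (head m c) v = if (v < m)%N then pair_sq c v else 0.
Proof.
rewrite /pair_sq /head /keep ltn_double ltn_Sdouble; case: ifP => //.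
by rewrite nsq0 addr0.
Qed.

Lemma pair_sq_tail m c v : pair_sq (tail m c) v = if (m <= v)%N then pair_sq c v else 0.
Proof.
rewrite /pair_sq /tail /keep leq_double (_ : (m.*2 <= v.*2.+1)%N = (m <= v)%N); last by lia.
by case: ifP => //; rewrite nsq0 addr0.
Qed.

Lemma supported_head m c : supported m (head m c).
Proof. by move=> j mj; rewrite /head /keep ltnNge mj. Qed.

Lemma amp_energy_head s m c :
  amp_energy s (head m c) = (\sum_(0 <= v < m) (lambda v `^ (2 * s) * pair_sq c v)%:E)%E.
Proof.
rewrite /amp_energy (@eseries_fin _ _ m) => [|v mv].
  rewrite big_mkord; apply: eq_bigr => v _.
  by rewrite pair_sq_head ltn_ord.
by rewrite pair_sq_head ltnNge mv mulr0.
Qed.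

Lemma amp_energy_head_cvg s c : amp_energy s (head m c) @[m --> \oo] --> amp_energy s c.
Proof.
under eq_fun do rewrite amp_energy_head.
by apply: is_cvg_nneseries => v _ _; exact: amp_term_ge0.
Qed.

Lemma amp_energy_tail s m c :
  amp_energy s (tail m c) = (\sum_(m <= v <oo) (lambda v `^ (2 * s) * pair_sq c v)%:E)%E.
Proof.
rewrite ereal_series eseries_mkcond; apply: eq_eseriesr => v _.
by rewrite pair_sq_tail; case: ifP; rewrite ?mulr0.
Qed.

Lemma amp_energy_tail_cvg s c : (amp_energy s c < +oo)%E ->
  amp_energy s (tail m c) @[m --> \oo] --> (0 : \bar R)%E.
Proof.
move=> fin; under eq_fun do rewrite amp_energy_tail.
by apply: nneseries_tail_cvg => // v _; exact: amp_term_ge0.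
Qed.

Lemma tail_le s m c : (amp_energy s (tail m c) <= amp_energy s c)%E.
Proof.
apply: lee_nneseries => v _; first by move=> _; exact: amp_term_ge0.
rewrite lee_fin ler_wpM2l ?powR_ge0 // pair_sq_tail; case: ifP => // _.
exact: pair_sq_ge0.
Qed.

Lemma modes_head m c t : modes (head m c) t = - 1 *: modes (tail m c) t + modes c t.
Proof.
apply/funext => v; rewrite !fctE /GRing.scale /= /modes /head /tail /keep.
rewrite (leqNgt m.*2 v.*2) (leqNgt m.*2 v.*2.+1).
by case: (ltnP v.*2 m.*2) => _; case: (ltnP v.*2.+1 m.*2) => _ /=; ring.
Qed.

(** The finite sum is compared with the whole solution through the tail, on which
    nothing but admissibility is known. *)
Lemma L2int_head T m c : (amp_energy (l0 / 2) c < +oo)%E ->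
  (L2int T (Lext (modes (head m c))) <=
   2%:E * L2int T (Lext (modes (tail m c))) + 2%:E * L2int T (Lext (modes c)))%E.
Proof.
move=> fin.
have [Dc _] := admissible_modes fin.
have [Dt _] := admissible_modes (le_lt_trans (tail_le _ m c) fin).
have [_ subsp] := ext_subspace hext.
have Dh := subsp (- 1) _ _ Dt Dc.
have ae := ext_linear hext (- 1) Dt Dc.
have hE : (fun s => - 1 *: modes (tail m c) s + modes c s) = modes (head m c).
  by apply/funext => t; rewrite modes_head.
rewrite hE in Dh ae.
have mh := Lext_measurable Dh; have mt := Lext_measurable Dt; have mc := Lext_measurable Dc.
rewrite /L2int -!ge0_integralZl_EFin //; try by move=> t _; exact: sqnorm_ge0.
- rewrite -ge0_integralD //.
  + apply: ae_ge0_le_integral => //.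
    * by move=> t _; exact: sqnorm_ge0.
    * exact: measurable_funS mh.
    * by move=> t _; rewrite adde_ge0 // mule_ge0 // sqnorm_ge0.
    * apply: emeasurable_funD; apply: measurable_funeM.
        exact: measurable_funS mt.
      exact: measurable_funS mc.
    * apply: ae_mono ae => t -> _; rewrite /sqnorm -!EFinM -EFinD lee_fin -!/(nsq _).
      rewrite scaleN1r; apply: (le_trans (nsqD _ _)).
      by rewrite nsqN.
  + by move=> t _; rewrite mule_ge0 // sqnorm_ge0.
  + by apply: measurable_funeM; exact: measurable_funS mt.
  + by move=> t _; rewrite mule_ge0 // sqnorm_ge0.
  + by apply: measurable_funeM; exact: measurable_funS mc.
- exact: measurable_funS mc.
- exact: measurable_funS mt.
Qed.

(** The energy of [head m c] tends to that of [c], and by admissibility what is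
    observed of [tail m c] tends to 0. *)
Lemma observable_limit T (C' s : R) : 0 <= C' ->
  (forall c n, energy_sum (weight lambda (2 * s)) c n <= C' * obs_int freq (obs_vec L) T c n) ->
  forall c, (amp_energy (l0 / 2) c < +oo)%E ->
  (amp_energy s c <= (2 * C')%:E * L2int T (Lext (modes c)))%E.
Proof.
move=> C'0 obs c fin; have [CT CT0 hCT] := admissible_all T.
set I := L2int T (Lext (modes c)).
have I0 : (0 <= I)%E by apply: integral_ge0 => t _; exact: sqnorm_ge0.
have bound m : (amp_energy s (head m c) <=
    (2 * C' * CT)%:E * amp_energy (l0 / 2) (tail m c) + (2 * C')%:E * I)%E.
  rewrite (amp_energy_supported s (@supported_head m c)).
  apply: (@le_trans _ _ (C'%:E * L2int T (Lext (modes (head m c))))%E).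
    by rewrite (L2int_supported T (@supported_head m c)) -EFinM lee_fin; exact: obs.
  apply: (@le_trans _ _ (C'%:E * (2%:E * L2int T (Lext (modes (tail m c))) + 2%:E * I))%E).
    by apply: lee_wpmul2l; [rewrite lee_fin|exact: L2int_head].
  have J0 : (0 <= L2int T (Lext (modes (tail m c))))%E.
    by apply: integral_ge0 => t _; exact: sqnorm_ge0.
  rewrite ge0_muleDr ?mule_ge0 //; apply: leeD.
    rewrite muleA -EFinM (mulrC C') [in leRHS]EFinM -[leRHS]muleA.
    apply: lee_wpmul2l; first by rewrite lee_fin mulr_ge0.
    exact: hCT (le_lt_trans (tail_le _ m c) fin).
  by rewrite muleA -EFinM (mulrC C').
have G : ((2 * C' * CT)%:E * amp_energy (l0 / 2) (tail m c) + (2 * C')%:E * I)%E @[m --> \oo]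
    --> ((2 * C')%:E * I)%E.
  rewrite -[X in _ --> X]add0e; apply: cvgeD => //; last exact: cvg_cst.
  rewrite -[X in _ --> X](mule0 (2 * C' * CT)%:E).
  by apply: cvgeZl => //; exact: amp_energy_tail_cvg.
have H := amp_energy_head_cvg (s := s) (c := c).
rewrite -(cvg_lim _ H) // -(cvg_lim _ G) //.
apply: lee_lim; [exact: cvgP H|exact: cvgP G|exact: nearW].
Qed.

End Admissibility.

(** * The observability theorem *)

Theorem corollary3p6 (R : realType) (E K : completeNormedModType R[i])
  (ipE : {dot E for Num.conj}) (ipK : {dot K for Num.conj})
  (hE : hilbert_norm ipE) (hK : hilbert_norm ipK)
  (D : set E) (A : E -> E)
  (hA : selfadjoint ipE D A) (hApos : positive_op ipE D A)
  (e : nat -> E) (lambda : nat -> R) (he : eigenbasis ipE D A e lambda)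
  (alpha rho : R) (halpha : 0 < alpha < 1) (hrho : 1 < rho < alpha^-1)
  (m0 C0 : R) (L : cseq R -> K) (hL : observation_operator lambda m0 C0 L)
  (l0 l1 : R) (hl1 : l1 <= l0) (hl0 : l0 <= 2 * m0)
  (C T : R) (k0 : nat) (hC : 0 < C) (hk0 : (0 < k0)%N) (hT : 0 < T)
  (hobs : forall U : nat -> E, Bplus e lambda alpha rho U ->
    forall k : nat, (k0 <= k)%N ->
    let uk := half_wave lambda (coef ipE e (U k)) in
    (energy lambda l1 (uk 0%N 0%R) (uk 1%N 0%R)
      <= C%:E * L2int T (fun t => L (uk 0%N t)))%E)
  (hconj : forall u : cseq R, domA_pow lambda m0 u ->
    `|L (cseq_conj u)| = `|L u|)
  (hUCP : forall (v : E) (mu : R[i]), D v -> A v = mu *: v ->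
    L (coef ipE e v) = 0 -> v = 0)
  (Dext : set (R -> cseq R)) (Lext : (R -> cseq R) -> R -> K)
  (hadm : admissible lambda m0 l0 L Dext Lext) :
  forall T' : R, T < T' ->
  exists2 C' : R, 0 < C' &
    forall u0 u1 : cseq R,
      domA_pow lambda (l0 / 2) u0 -> domA_pow lambda ((l0 - 1) / 2) u1 ->
    forall du : nat -> R -> cseq R, wave_solution lambda l0 u0 u1 du ->
    forall t : R,
    (energy lambda l1 (du 0%N t) (du 1%N t)
      <= C'%:E * L2int T' (Lext (du 0%N)))%E.
Proof.
move=> T' TT'.
have [[e_orth _] [eigen [lambda_gt0 lambda_mono lambda_infty]]] := he.
have [subD linA _ _] := hA.
have [hext [S [CS [S0 CS0 hS]]]] := hadm.
have [p hp] := weight_le lambda_gt0 l0 l1.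
have [c0 [t1 [c00 windows]]] := window_exists hK lambda_gt0 e_orth hL hconj hobs
  halpha hrho (ltW hC).
have adm (X : R) : 0 < X -> exists2 CT, 0 <= CT & forall c n,
    obs_int (freq lambda) (obs_vec L) X c n <= CT * energy_sum (weight lambda l0) c n.
  by move=> _; exact: (admissible_sums lambda_gt0 lambda_mono hK hL hext S0 CS0 hS).
have ucp := fun z c n => @frequency_independent _ _ _ _ _ _ _ _ subD linA lambda_gt0
  e_orth eigen _ _ _ hL hUCP z c n.
have [C' C'0 hC'] := observability_sums hK hT (ltW hC) c00
  (freq_infty lambda_gt0 lambda_infty)
  (weight_gt0 lambda_gt0 l1) (fun j => ltW (weight_gt0 lambda_gt0 l0 j)) hp windows
  adm ucp TT'.
exists (2 * C' + 1) => [|u0 u1 du0 du1 du hdu t]; first by lra.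
have fin := amp_energy_data lambda_gt0 du0 du1.
have sol := wave_solution_modes lambda_gt0 hdu.
have [-> ->] := sol t.
have -> : du 0%N = modes lambda (data_coef lambda u0 u1).
  by apply/funext => x; have [] := sol x.
rewrite (energy_modes lambda_gt0).
have := @observable_limit _ _ lambda_gt0 lambda_mono _ _ hK _ _ _ _ hL _ _ hext _ _ S0 CS0 hS
  T' C' (l1 / 2) C'0 _ _ fin.
rewrite (_ : 2 * (l1 / 2) = l1); last by field.
move=> /(_ hC') h; apply: (le_trans h).
apply: lee_wpmul2r; first by apply: integral_ge0 => x _; exact: sqnorm_ge0.
by rewrite lee_fin lerDl.
Qed.
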